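(* Consider the tensor product of Fock modules of type $\mathsf B$, $\mathsf C$ or $\mathsf D$, with the zeroth node chosen of type $\mathsf B$ (so $\mu=C^2s_{c_0}$), the extended dressed current $\tilde{\mathbf E}(z)=\mathbf E(z)+k^{\mathsf B}_{c_0}\boldsymbol\Lambda_{\bar0}(z)$ and the screening operators $S_0,\dots,S_\ell$, as defined in the context ($S_i$ stands for any of the screening operators attached to node $i$, when it is well defined). Assume that the matrix $\hat B$ is stable. Then the screening operators $S_i$ with $i\neq0$ commute with $\tilde{\mathbf E}(z)$: $$[S_i,\tilde{\mathbf E}(z)]=0,\qquad i=1,\dots,\ell.$$ For the zeroth screening operator we have $$[S_0,\tilde{\mathbf E}(z)]=b_{c_1}[S_0,\boldsymbol\Lambda_1(z)-\boldsymbol\Lambda_1(\mu z)].$$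
   Context: Parameters: $q_1,q_2,q_3\in\mathbb C^\times$, $q_1q_2q_3=1$, with fixed logarithms with $\ln q_1+\ln q_2+\ln q_3=0$, $q_i^a=\exp(a\ln q_i)$, generic ($q_1^aq_2^b=1$ for integers $a,b$ only if $a=b=0$). $s_c=q_c^{1/2}$, $t_c=s_c-s_c^{-1}$, $b_c=t_c/(t_1t_2t_3)$, $\kappa_r=\prod_{i=1}^3(1-q_i^r)$; $k_c^{\mathsf B}=(1+s_c)(s_d-s_b)/\kappa_1$ with $(c,d,b)=\mathrm{cycl}(1,2,3)$, where $\mathrm{cycl}(1,2,3)$ means ''a cyclic permutation of $(1,2,3)$''. Types. Fix $\ell\ge1$, colors $c_0,c_1,\dots,c_{\ell+1}\in\{1,2,3\}$, $u_1,\dots,u_\ell\in\mathbb C^\times$. The module is $\mathcal F_{c_1}(u_1)\otimes\cdots\otimes\mathcal F_{c_\ell}(u_\ell)\otimes\mathcal F^X_{c_{\ell+1}}$, $X\in\{\mathsf B,\mathsf{CD}\}$. The module (its $\ell$-th node) has type $\mathsf B$ if $X=\mathsf B$; type $\mathsf C$ if $X=\mathsf{CD}$, $c_\ell\ne c_{\ell+1}$; type $\mathsf D$ if $X=\mathsf{CD}$, $c_\ell=c_{\ell+1}$ (then $\ell\ge2$). $C_{\ell+1}=s_{c_{\ell+1}}^{1/2}$ for type $\mathsf B$ and $s_{c_{\ell+1}}^{-1}$ for types $\mathsf C,\mathsf D$; $C=C_{\ell+1}\prod_{i=1}^\ell s_{c_i}$; $a_i=C_{\ell+1}^{-1}\prod_{j=i+1}^\ell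 s_{c_j}^{-1}$. The zeroth node is of type $\mathsf B$: $\mu=C^2s_{c_0}$; it is assumed that $|\mu|<1$. Bosons. For $1\le j\le\ell$: $[h^{(j)}_r,h^{(j)}_s]=\delta_{r+s,0}\frac1{\kappa_r}\frac{s_{c_j}^r-s_{c_j}^{-r}}r$; and $[H_r,H_{-r}]=-\kappa_r\frac{1+C_{\ell+1}^{2r}}r$ ($r>0$); all other commutators vanish. All operators act on the Fock space $\mathbb F$ of these bosons; $:\ :$ puts negative modes to the left. In the $j$-th factor: $\psi^\pm(z)=\exp(\sum_{r>0}\kappa_rh^{(j)}_{\pm r}z^{\mp r})$, $V_{c_j}(z;u)=u\exp\bigl(\sum_{r>0}\frac{\kappa_rh^{(j)}_{-r}}{1-q_{c_j}^r}z^r\bigr)\exp\bigl(\sum_{r>0}\frac{\kappa_rh^{(j)}_r}{1-q_{c_j}^r}q_{c_j}^{r/2}z^{-r}\bigr)$; in the last factor: $K^\pm(z)=\exp(\sum_{\pm r>0}H_rz^{-r})$, and, for $c=c_{\ell+1}$, $\tilde K_c^\pm(z)=\exp(\sum_{\pm r>0}\frac{H_r}{1+s_c^{-r}}z^{-r})$, $\tilde K_c(z)=\tilde K^-_c(z)\tilde K^+_c(s_cz)$. For $1\le i\le\ell$, $$\Lambda_i(z)=1^{\otimes(i-1)}\otimes V_{c_i}(a_iz;u_i)\otimes\psi^+(s_{c_{i+1}}^{-1}a_{i+1}z)\otimes\cdots\otimes\psi^+(s_{c_\ell}^{-1}a_\ell z)\otimes K^+(z),$$ $$\Lambda_{\bar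 i}(z)=1^{\otimes(i-1)}\otimes:V_{c_i}(a_i^{-1}z;u_i)^{-1}:\otimes\,\psi^-(a_{i+1}^{-1}z)^{-1}\otimes\cdots\otimes\psi^-(a_\ell^{-1}z)^{-1}\otimes K^-(z),$$ $\Lambda_0(z)=1^{\otimes\ell}\otimes\tilde K_{c_{\ell+1}}(z)$. The current $E(z)$ acts by $E(z)=\sum_{i=1}^\ell b_{c_i}(\Lambda_i(z)+\Lambda_{\bar i}(z))$ for modules of types $\mathsf C,\mathsf D$, with the extra summand $k^{\mathsf B}_{c_{\ell+1}}\Lambda_0(z)$ for modules of type $\mathsf B$. Let $\mathbb K^+(z)=\bigotimes_{j=1}^\ell\psi^+(s_{c_j}^{-1}a_jz)\otimes K^+(z)$, $\mathbb K_\mu^+(z)=\prod_{s\ge0}\mathbb K^+(\mu^{-s}z)$, $\mathbf E(z)=E(z)\mathbb K^+_\mu(z)^{-1}$, $\boldsymbol\Lambda_i(z)=\Lambda_i(z)\mathbb K_\mu^+(z)^{-1}$ for all the indices $i$ above. Root currents. For $1\le i<\ell$: $A_i(z)=\,:\Lambda_i(a_i^{-1}z)\Lambda_{i+1}(a_i^{-1}z)^{-1}:$. $\ell$-th node: type $\mathsf B$: $A_\ell(z)=\,:\Lambda_\ell(a_\ell^{-1}z)\Lambda_0(a_\ell^{-1}z)^{-1}:$; type $\mathsf C$: $A_\ell(z)=\,:\Lambda_\ell(z)\Lambda_{\bar\ell}(z)^{-1}:$; type $\mathsf D$: $A_\ell(z)=\,:\Lambda_{\ell-1}(z)\Lambda_{\bar\ell}(z)^{-1}:$.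 Zeroth node: $A_0$ is defined by $:A_0(s_{c_0}^{-1/2}z)A_0(s_{c_0}^{1/2}z):\,=\,:\boldsymbol\Lambda_{\bar1}(\mu^{-1/2}z)\boldsymbol\Lambda_1(\mu^{1/2}z)^{-1}:$ with scalar prefactor $u_1^{-1}$. Write $A_i(z)=e^{\mathsf a_{i,0}}:\exp(\sum_{r\ne0}\mathsf a_{i,r}z^{-r}):$. Write $[\mathsf a_{i,r},\mathsf a_{j,-r}]=B_{i,j}^{[r]}/r$ for $r>0$; the matrix $\hat B=(B_{i,j})_{i,j=0}^\ell$ records these contractions of the $A_i(z)$, and ''$\hat B$ is stable'' means $B_{0,\ell}=B_{\ell,0}=0$, i.e. $[\mathsf a_{0,r},\mathsf a_{\ell,s}]=0$ for all $r,s\ne0$. Extra term: $\boldsymbol\Lambda_{\bar0}(z)=\,:\boldsymbol\Lambda_{\bar1}(z)A_0(\mu^{1/2}s_{c_0}^{-1/2}z)^{-1}:\,=\,:\boldsymbol\Lambda_1(\mu z)A_0(\mu^{1/2}s_{c_0}^{1/2}z):$. Screening operators. Given a root current $A(z)=e^{\mathsf a_0}:\exp(\sum_{r\neq0}\mathsf a_rz^{-r}):$, constants $k$ and $p=\exp(\ln p)$, and a transformation $T$ of $u=(u_j)$, the screening current $S(z)=e^Qz^{\mathsf s_0}S^{osc}(z)$ is determined by $A(z)=k:S(p^{-1}z)S(pz)^{-1}:$, i.e. $S^{osc}(z)=\exp(\sum_{r>0}\mathsf s_{-r}z^r)\exp(\sum_{r>0}\mathsf s_rz^{-r})$, $\mathsf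 s_r=\mathsf a_r/(p^r-p^{-r})$, $e^{\mathsf a_0}=kp^{-2\mathsf s_0}$; $e^Q$ commutes with oscillators, preserves the vacuum and changes the parameters $u$ to $T(u)$. $S=\frac1{2\pi i}\int S(z)dz$ (coefficient of $z^{-1}$) is well defined on the module with parameters $u$ when $\mathsf s_0$ acts as an integer $m$ (i.e. $e^{\mathsf a_0}=kp^{-2m}$); it maps that module to the one with parameters $T(u)$. $[S,X]=SX-XS$ with $X$ on the source in the first term and on the target in the second. The data are as follows (parameters not listed are unchanged). (1) Nodes $1\le i<\ell$, $k=s_{c_i}s_{c_{i+1}}$. If $c_i=c_{i+1}$, $(c_i,b,c)=\mathrm{cycl}(1,2,3)$: $S_i^+$: $p=s_b$, $u_i\mapsto q_cu_i$, $u_{i+1}\mapsto q_c^{-1}u_{i+1}$; $S_i^-$: $p=s_c$, $u_i\mapsto q_bu_i$, $u_{i+1}\mapsto q_b^{-1}u_{i+1}$. If $c_i\ne c_{i+1}$, $\{c_i,c_{i+1},d\}=\{1,2,3\}$: $S_i^f$: $p=s_d$, $u_i\mapsto q_{c_{i+1}}u_i$, $u_{i+1}\mapsto q_{c_i}^{-1}u_{i+1}$. (2) Node $\ell$. Type $\mathsf B$, $c_\ell=c_{\ell+1}$, $(c_\ell,b,c)=\mathrm{cycl}(1,2,3)$: only $S_\ell^+$: $k=s_{c_\ell}^2s_c$, $p=s_b$, $u_\ell\mapsto q_cu_\ell$. Type $\mathsf B$, $c_\ell\ne c_{\ell+1}$, $\{c_\ell,c_{\ell+1},b\}=\{1,2,3\}$: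 $k=s_{c_\ell}^2s_{c_{\ell+1}}$; $S_\ell^+$: $p=s_b$, $u_\ell\mapsto q_{c_{\ell+1}}u_\ell$; $S_\ell^-$: $p=s_{c_{\ell+1}}^{1/2}$, $u_\ell\mapsto q_b^2u_\ell$. Type $\mathsf C$, $\{c_\ell,c_{\ell+1},b\}=\{1,2,3\}$: $k=q_{c_\ell}q_{c_{\ell+1}}^{-1}$; $S_\ell^+$: $p=s_b$, $u_\ell\mapsto q_{c_{\ell+1}}^2u_\ell$; $S_\ell^-$: $p=s_{c_{\ell+1}}^2$, $u_\ell\mapsto q_bu_\ell$. Type $\mathsf D$, $c_{\ell-1}=c_\ell$, $(c_\ell,b,c)=\mathrm{cycl}(1,2,3)$: $k=q_{c_\ell}$; $S_\ell^+$: $p=s_b$, $u_{\ell-1}\mapsto q_cu_{\ell-1}$, $u_\ell\mapsto q_cu_\ell$; $S_\ell^-$: $p=s_c$, $u_{\ell-1}\mapsto q_bu_{\ell-1}$, $u_\ell\mapsto q_bu_\ell$. Type $\mathsf D$, $c_{\ell-1}\ne c_\ell$, $\{c_{\ell-1},c_\ell,b\}=\{1,2,3\}$: $S_\ell^f$: $k=s_b^{-1}$, $p=s_b$, $u_{\ell-1}\mapsto q_{c_\ell}u_{\ell-1}$, $u_\ell\mapsto q_{c_{\ell-1}}u_\ell$. (3) Node $0$ (type $\mathsf B$). If $c_0=c_1$, $(c_1,b,c)=\mathrm{cycl}(1,2,3)$: only $S_0^+$: $k=s_{c_1}^2s_c$, $p=s_b$, $u_1\mapsto q_c^{-1}u_1$.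 If $c_0\ne c_1$, $\{c_0,c_1,b\}=\{1,2,3\}$: $k=s_{c_1}^2s_{c_0}$; $S_0^+$: $p=s_b$, $u_1\mapsto q_{c_0}^{-1}u_1$; $S_0^-$: $p=s_{c_0}^{1/2}$, $u_1\mapsto q_b^{-2}u_1$.
   Formalization: At type B ends (node ℓ with c_ℓ≠c_{ℓ+1}; node 0 with c_0≠c_1) the constant k is replaced by −k when (c_ℓ,c_{ℓ+1},b), resp. (c_1,c_0,b), is not a cyclic permutation of (1,2,3); with the stated k the commutation relations fail in those cases. *)

(* Defs.v *)
From HB Require Import structures.
From mathcomp Require Import all_boot all_order all_algebra.
From mathcomp Require Import complex.
From mathcomp Require Import all_classical all_reals all_analysis.
From mathcomp Require Import ring.
Set Implicit Arguments.
Unset Strict Implicit.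
Unset Printing Implicit Defensive.
Import Order.TTheory GRing.Theory Num.Theory.
Import numFieldNormedType.Exports.
Local Open Scope classical_set_scope.
Local Open Scope ring_scope.
Local Open Scope complex_scope.

(* The complex numbers are R[i], for R : realType. *)
Definition cexp (R : realType) (x : R[i]) : R[i] :=
  let: a +i* b := x in (expR a * cos b) +i* (expR a * sin b).

(* The colours 1, 2, 3 are the elements 0, 1, 2 of 'I_3, whose addition is
   modulo 3: the cyclic permutations of (1,2,3) are the (x, x + 1, x + 1 + 1). *)
Definition color := 'I_3.
Definition cycl (x y z : color) : bool := (y == x + 1) && (z == y + 1).
Definition all_colors (x y z : color) : bool := uniq [:: x; y; z].

Inductive last_factor := FockB | FockCD.
Inductive node_type := TypeB | TypeC | TypeD.

(* colr i is the colour c_i; only the indices 0 <= i <= ell + 1 are used. *)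
Record datum (R : realType) := Datum {
  lnq : color -> R[i];
  ell : nat;
  lastf : last_factor;
  colr : nat -> color }.

Section Constants.
Variables (R : realType) (d : datum R).
Local Notation c := (colr d).
Local Notation l := (ell d).

Definition qpow (x : color) (e : R[i]) : R[i] := cexp (e * lnq d x).
Definition q_ (x : color) : R[i] := qpow x 1.
Definition s_ (x : color) : R[i] := qpow x 2^-1.
(* s_x^{1/2} *)
Definition sh (x : color) : R[i] := qpow x 4^-1.

Definition generic : Prop :=
  forall a b : int, q_ 0 ^ a * q_ 1 ^ b = 1 -> a = 0 /\ b = 0.

Definition t_ (x : color) : R[i] := s_ x - (s_ x)^-1.
Definition b_ (x : color) : R[i] := t_ x / \prod_(y < 3) t_ y.
Definition kappa (r : int) : R[i] := \prod_(y < 3) (1 - q_ y ^ r).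
Definition kB (x : color) : R[i] :=
  (1 + s_ x) * (s_ (x + 1) - s_ (x + 1 + 1)) / kappa 1.

Definition ntype : node_type :=
  match lastf d with
  | FockB => TypeB
  | FockCD => if c l == c l.+1 then TypeD else TypeC
  end.

Definition Clast : R[i] :=
  match lastf d with FockB => sh (c l.+1) | FockCD => (s_ (c l.+1))^-1 end.
Definition Cc : R[i] := Clast * \prod_(1 <= i < l.+1) s_ (c i).
Definition a_ (i : nat) : R[i] :=
  Clast^-1 * \prod_(i.+1 <= j < l.+1) (s_ (c j))^-1.
Definition mu : R[i] := Cc ^+ 2 * s_ (c 0).
Definition muh : R[i] := Cc * sh (c 0). (* mu^{1/2} *)

(* The scalar [x_r, x_{-r}] for the boson of the j-th tensor factor: x = h^(j)
   for 1 <= j <= ell, and x = H for j = ell + 1. *)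
Definition boson_comm (j : nat) (r : int) : R[i] :=
  if (j <= l)%N then (kappa r)^-1 * ((s_ (c j) ^ r - s_ (c j) ^ (- r)) / r%:~R)
  else - kappa `|r| * (1 + Clast ^ (2 * `|r|)) / r%:~R.

End Constants.

(* The Fock space of the bosons: the module generated by a nonzero vacuum
   killed by the positive modes. Modes with r = 0 or with j outside
   1 <= j <= ell + 1 do not belong to the algebra and are unconstrained. *)
Record is_fock (R : realType) (d : datum R) (V : lmodType R[i])
    (h : nat -> int -> V -> V) (vac : V) : Prop := IsFock {
  fock_linear : forall j r, (1 <= j <= (ell d).+1)%N -> r != 0 ->
    linear (h j r);
  fock_comm : forall j k r r' v,
    (1 <= j <= (ell d).+1)%N -> (1 <= k <= (ell d).+1)%N ->
    r != 0 -> r' != 0 ->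
    h j r (h k r' v) - h k r' (h j r v) =
      (if (j == k) && (r + r' == 0) then boson_comm d j r else 0) *: v;
  fock_vac_neq0 : vac != 0;
  fock_vac : forall j r, (1 <= j <= (ell d).+1)%N -> 0 < r -> h j r vac = 0;
  fock_cyclic : forall P : V -> Prop, P vac ->
    (forall x v w, P v -> P w -> P (x *: v + w)) ->
    (forall j r v, (1 <= j <= (ell d).+1)%N -> r != 0 -> P v -> P (h j r v)) ->
    forall v, P v }.

(* A vertex operator pref * :exp(sum_{r <> 0} sum_j osc j r h^(j)_r z^{-r}):,
   with h^(ell+1) = H. The values osc j 0 are irrelevant. *)
Record vertex (R : realType) := Vertex {
  pref : R[i];
  osc : nat -> int -> R[i] }.

Section Vertices.
Variable R : realType.
Implicit Types X Y : vertex R.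

(* :X(z)Y(z): *)
Definition vmul X Y := Vertex (pref X * pref Y) (fun j r => osc X j r + osc Y j r).
(* :X(z)^{-1}: *)
Definition vinv X := Vertex (pref X)^-1 (fun j r => - osc X j r).
(* X(xz) *)
Definition vscale (x : R[i]) X :=
  Vertex (pref X) (fun j r => osc X j r * x ^ (- r)).

End Vertices.

Section Action.
Variables (R : realType) (d : datum R) (V : lmodType R[i]).
Variable h : nat -> int -> V -> V.

(* The mode a_r of X(z) = e^{a_0} :exp(sum_{r <> 0} a_r z^{-r}):. *)
Definition mode_op (X : vertex R) (r : int) (v : V) : V :=
  \sum_(1 <= j < (ell d).+2) osc X j r *: h j r v.

(* The coefficient of x^n in (sum_{r > 0} f_r x^r)^k, resp. in
   exp(sum_{r > 0} f_r x^r). *)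
Fixpoint pow_coef (f : nat -> V -> V) (k n : nat) (v : V) : V :=
  match k with
  | 0 => if n == 0%N then v else 0
  | k'.+1 => \sum_(1 <= r < n.+1) f r (pow_coef f k' (n - r)%N v)
  end.
Definition exp_coef (f : nat -> V -> V) (n : nat) (v : V) : V :=
  \sum_(0 <= k < n.+1) (k`!%:R)^-1 *: pow_coef f k n v.

(* The coefficient of z^n in X(z)v: on the Fock space the sum over the power m
   of z^{-1} coming from the positive modes has only finitely many nonzero
   terms. *)
Definition vcoef (X : vertex R) (n : int) (v : V) : V :=
  pref X *: \sum_(m \in [set: nat])
    (match n + m%:Z with
     | Posz k => exp_coef (fun r => mode_op X (- r%:Z)) k
                   (exp_coef (fun r => mode_op X r%:Z) m v)
     | Negz _ => 0
     end).

End Action.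

(* Finite linear combinations of vertex operators. *)
Definition current (R : realType) := seq (R[i] * vertex R).

Definition cur_coef (R : realType) (d : datum R) (V : lmodType R[i])
    (h : nat -> int -> V -> V) (X : current R) (n : int) (v : V) : V :=
  \sum_(x <- X) x.1 *: vcoef d h x.2 n v.

Section Currents.
Variables (R : realType) (d : datum R).
Local Notation c := (colr d).
Local Notation l := (ell d).
Local Notation kap := (kappa d).

(* Exponents of currents living in a single tensor factor: the r-th value is
   the coefficient of h_r z^{-r}. *)
Definition fac_scale (x : R[i]) (f : int -> R[i]) (r : int) : R[i] :=
  f r * x ^ (- r).
Definition fac_one (r : int) : R[i] := 0.
Definition fac_inv (f : int -> R[i]) (r : int) : R[i] := - f r.
Definition psip (r : int) : R[i] := if 0 < r then kap r else 0.
Definition psim (r : int) : R[i] := if r < 0 then kap (- r) else 0.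
(* V_x(z;u)/u *)
Definition Vf (x : color) (r : int) : R[i] :=
  if 0 < r then kap r / (1 - q_ d x ^ r) * s_ d x ^ r
  else kap (- r) / (1 - q_ d x ^ (- r)).
Definition Kp (r : int) : R[i] := if 0 < r then 1 else 0.
Definition Km (r : int) : R[i] := if r < 0 then 1 else 0.
(* \tilde K_x^-(z) and \tilde K_x^+(z), both with H_r / (1 + s_x^{-r}) *)
Definition Ktm (x : color) (r : int) : R[i] :=
  if r < 0 then (1 + s_ d x ^ (- r))^-1 else 0.
Definition Ktp (x : color) (r : int) : R[i] :=
  if 0 < r then (1 + s_ d x ^ (- r))^-1 else 0.
Definition Kt (x : color) (r : int) : R[i] :=
  Ktm x r + fac_scale (s_ d x) (Ktp x) r.

Definition Lambda (u : nat -> R[i]) (i : nat) : vertex R :=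
  Vertex (u i) (fun j =>
    if (j < i)%N then fac_one
    else if j == i then fac_scale (a_ d i) (Vf (c i))
    else if (j <= l)%N then fac_scale ((s_ d (c j))^-1 * a_ d j) psip
    else Kp).

Definition Lambdab (u : nat -> R[i]) (i : nat) : vertex R :=
  Vertex (u i)^-1 (fun j =>
    if (j < i)%N then fac_one
    else if j == i then fac_inv (fac_scale (a_ d i)^-1 (Vf (c i)))
    else if (j <= l)%N then fac_inv (fac_scale (a_ d j)^-1 psim)
    else Km).

Definition Lambda0 : vertex R :=
  Vertex 1 (fun j => if (j <= l)%N then fac_one else Kt (c l.+1)).

Definition Ecur (u : nat -> R[i]) : current R :=
  flatten [seq [:: (b_ d (c i), Lambda u i); (b_ d (c i), Lambdab u i)]
          | i <- iota 1 l]
  ++ (if ntype d is TypeB then [:: (kB d (c l.+1), Lambda0)] else [::]).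

Definition KK : vertex R :=
  Vertex 1 (fun j =>
    if (j <= l)%N then fac_scale ((s_ d (c j))^-1 * a_ d j) psip else Kp).

(* prod_{n >= 0} KK(mu^{-n} z): the infinite product is the limit of the
   partial products, i.e. of the sums of the exponents. *)
Definition KKmu : vertex R :=
  Vertex 1 (fun j r =>
    limn (fun N : nat =>
      (\sum_(0 <= n < N) osc (vscale (mu d ^- n) KK) j r) : (R[i] : numFieldType))).

(* X(z) KKmu(z)^{-1}. As KKmu has positive modes only and stands on the right,
   this product is already normally ordered. *)
Definition dress (X : vertex R) : vertex R := vmul X (vinv KKmu).
Definition dress_cur (X : current R) : current R :=
  [seq (x.1, dress x.2) | x <- X].

(* The solution of
   :A_0(s_{c_0}^{-1/2} z) A_0(s_{c_0}^{1/2} z):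
     = :bLambda_{bar 1}(mu^{-1/2} z) bLambda_1(mu^{1/2} z)^{-1}:
   with prefactor u_1^{-1}: the left-hand side multiplies the r-th mode by
   s_{c_0}^{r/2} + s_{c_0}^{-r/2} (see root0P). *)
Definition root0 (u : nat -> R[i]) : vertex R :=
  Vertex (u 1%N)^-1 (fun j r =>
    osc (vmul (vscale (muh d)^-1 (dress (Lambdab u 1)))
              (vinv (vscale (muh d) (dress (Lambda u 1))))) j r
    / (sh d (c 0) ^ r + sh d (c 0) ^ (- r))).

Definition root_current (u : nat -> R[i]) (i : nat) : vertex R :=
  if i == 0%N then root0 u
  else if (i < l)%N then
    vmul (vscale (a_ d i)^-1 (Lambda u i))
         (vinv (vscale (a_ d i)^-1 (Lambda u i.+1)))
  else match ntype d with
    | TypeB => vmul (vscale (a_ d l)^-1 (Lambda u l))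
                    (vinv (vscale (a_ d l)^-1 Lambda0))
    | TypeC => vmul (Lambda u l) (vinv (Lambdab u l))
    | TypeD => vmul (Lambda u l.-1) (vinv (Lambdab u l))
    end.

Definition Lambda0b (u : nat -> R[i]) : vertex R :=
  vmul (dress (Lambdab u 1))
       (vinv (vscale (muh d * (sh d (c 0))^-1) (root0 u))).

Definition Etilde (u : nat -> R[i]) : current R :=
  rcons (dress_cur (Ecur u)) (kB d (c 0), Lambda0b u).

(* bLambda_1(z) - bLambda_1(mu z) *)
Definition Lambda1_diff (u : nat -> R[i]) : current R :=
  [:: (1, dress (Lambda u 1)); (-1, vscale (mu d) (dress (Lambda u 1)))].

(* A transformation of the parameters is encoded by its multipliers:
   u_j |-> T j * u_j. *)
Definition change (T u : nat -> R[i]) (j : nat) : R[i] := T j * u j.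
Definition chg1 (i : nat) (x : R[i]) (j : nat) : R[i] := if j == i then x else 1.
Definition chg2 (i : nat) (x : R[i]) (i' : nat) (x' : R[i]) (j : nat) : R[i] :=
  if j == i then x else if j == i' then x' else 1.

(* For distinct colours x, y: 1 if (x, y, third colour) is cyclic, else -1.
   This sign enters the constants k at the ends of type B with distinct colours.
   It is forced: a transposition of the three colours changes the signs of all
   k^B_x and of no other coefficient of the currents, and that change is undone
   (up to an overall sign of the current) by u |-> -u, which changes the sign of
   e^{a_0} at these ends. *)
Definition orient (x y : color) : R[i] := if y == x + 1 then 1 else -1.

Inductive screening : nat -> R[i] -> R[i] -> (nat -> R[i]) -> Prop :=
| scr_mid_plus i x y of (1 <= i < l)%N & c i = c i.+1 & cycl (c i) x y :
    screening i (s_ d (c i) * s_ d (c i.+1)) (s_ d x)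
      (chg2 i (q_ d y) i.+1 (q_ d y)^-1)
| scr_mid_minus i x y of (1 <= i < l)%N & c i = c i.+1 & cycl (c i) x y :
    screening i (s_ d (c i) * s_ d (c i.+1)) (s_ d y)
      (chg2 i (q_ d x) i.+1 (q_ d x)^-1)
| scr_mid_fermi i x of (1 <= i < l)%N & all_colors (c i) (c i.+1) x :
    screening i (s_ d (c i) * s_ d (c i.+1)) (s_ d x)
      (chg2 i (q_ d (c i.+1)) i.+1 (q_ d (c i))^-1)
| scr_B_eq_plus x y of ntype d = TypeB & c l = c l.+1 & cycl (c l) x y :
    screening l (s_ d (c l) ^+ 2 * s_ d y) (s_ d x) (chg1 l (q_ d y))
| scr_B_neq_plus x of ntype d = TypeB & all_colors (c l) (c l.+1) x :
    screening l (orient (c l) (c l.+1) * (s_ d (c l) ^+ 2 * s_ d (c l.+1)))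
      (s_ d x) (chg1 l (q_ d (c l.+1)))
| scr_B_neq_minus x of ntype d = TypeB & all_colors (c l) (c l.+1) x :
    screening l (orient (c l) (c l.+1) * (s_ d (c l) ^+ 2 * s_ d (c l.+1)))
      (sh d (c l.+1)) (chg1 l (q_ d x ^+ 2))
| scr_C_plus x of ntype d = TypeC & all_colors (c l) (c l.+1) x :
    screening l (q_ d (c l) * (q_ d (c l.+1))^-1) (s_ d x)
      (chg1 l (q_ d (c l.+1) ^+ 2))
| scr_C_minus x of ntype d = TypeC & all_colors (c l) (c l.+1) x :
    screening l (q_ d (c l) * (q_ d (c l.+1))^-1) (s_ d (c l.+1) ^+ 2)
      (chg1 l (q_ d x))
| scr_D_eq_plus x y of ntype d = TypeD & c l.-1 = c l & cycl (c l) x y :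
    screening l (q_ d (c l)) (s_ d x) (chg2 l.-1 (q_ d y) l (q_ d y))
| scr_D_eq_minus x y of ntype d = TypeD & c l.-1 = c l & cycl (c l) x y :
    screening l (q_ d (c l)) (s_ d y) (chg2 l.-1 (q_ d x) l (q_ d x))
| scr_D_fermi x of ntype d = TypeD & all_colors (c l.-1) (c l) x :
    screening l (s_ d x)^-1 (s_ d x)
      (chg2 l.-1 (q_ d (c l)) l (q_ d (c l.-1)))
| scr_0_eq_plus x y of c 0 = c 1 & cycl (c 1) x y :
    screening 0 (s_ d (c 1) ^+ 2 * s_ d y) (s_ d x) (chg1 1 (q_ d y)^-1)
| scr_0_neq_plus x of all_colors (c 0) (c 1) x :
    screening 0 (orient (c 1) (c 0) * (s_ d (c 1) ^+ 2 * s_ d (c 0)))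
      (s_ d x) (chg1 1 (q_ d (c 0))^-1)
| scr_0_neq_minus x of all_colors (c 0) (c 1) x :
    screening 0 (orient (c 1) (c 0) * (s_ d (c 1) ^+ 2 * s_ d (c 0)))
      (sh d (c 0)) (chg1 1 (q_ d x ^+ 2)^-1).

(* S^osc(z) for the root current A. *)
Definition scr_osc (A : vertex R) (p : R[i]) : vertex R :=
  Vertex 1 (fun j r => osc A j r / (p ^ r - p ^ (- r))).

(* s_0 acts as the integer m on the module with parameters u:
   e^{a_0} = k p^{-2m}. *)
Definition well_defined (u : nat -> R[i]) (i : nat) (k p : R[i]) (m : int) : Prop :=
  pref (root_current u i) = k * p ^ (- (2 * m)).

Section Operators.
Variables (V : lmodType R[i]) (h : nat -> int -> V -> V).

(* The coefficient of z^{-1} in e^Q z^m S^osc(z). All the modules have the same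
   underlying Fock space, on which e^Q is the identity: it only changes the
   parameters of the module (see scr_comm). *)
Definition scr_op (A : vertex R) (p : R[i]) (m : int) : V -> V :=
  vcoef d h (scr_osc A p) (-1 - m).

(* The coefficient of z^n in [S, X(z)] on the module with parameters u, where
   S maps it to the module with parameters T(u). *)
Definition scr_comm (S : V -> V) (T u : nat -> R[i])
    (X : (nat -> R[i]) -> current R) (n : int) (v : V) : V :=
  S (cur_coef d h (X u) n v) - cur_coef d h (X (change T u)) n (S v).

(* B_{0,ell} = B_{ell,0} = 0 *)
Definition stable (u : nat -> R[i]) : Prop :=
  forall r r' v, r != 0 -> r' != 0 ->
    mode_op d h (root_current u 0) r (mode_op d h (root_current u l) r' v) =
    mode_op d h (root_current u l) r' (mode_op d h (root_current u 0) r v).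

End Operators.
End Currents.

Section Root0.
Variables (R : realType) (d : datum R).
Hypothesis lnq0 : \sum_(x < 3) lnq d x = 0.
Hypothesis gen : generic d.

Lemma cexpD (x y : R[i]) : cexp (x + y) = cexp x * cexp y.
Proof.
case: x y => [x1 x2] [y1 y2]; rewrite /cexp /=.
apply/eqP; rewrite eq_complex /= expRD cosD sinD.
by apply/andP; split; apply/eqP; ring.
Qed.

Lemma cexp0 : cexp 0 = 1 :> R[i].
Proof. by rewrite /cexp /= expR0 cos0 sin0 mulr1 mulr0. Qed.

Lemma cexp_neq0 (x : R[i]) : cexp x != 0.
Proof.
apply/eqP => x0; have /eqP := oner_neq0 R[i]; apply.
by rewrite -cexp0 -[X in cexp X](subrr x) cexpD x0 mul0r.
Qed.

Lemma sh2 x : sh d x ^+ 2 = s_ d x.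
Proof.
rewrite /sh /s_ /qpow expr2 -cexpD -mulrDl; congr (cexp (_ * _)).
by field.
Qed.

Lemma s2 x : s_ d x ^+ 2 = q_ d x.
Proof.
rewrite /s_ /q_ /qpow expr2 -cexpD -mulrDl; congr (cexp (_ * _)).
by field.
Qed.

Lemma qE x : q_ d x = cexp (lnq d x). Proof. by rewrite /q_ /qpow mul1r. Qed.

Lemma q_expz_neq1 x (r : int) : r != 0 -> q_ d x ^ r != 1.
Proof.
move=> r0; apply/eqP => qr.
have [q0 q1] : q_ d 0 != 0 /\ q_ d 1 != 0 by rewrite !qE !cexp_neq0.
have x3 : [|| x == 0, x == 1 | x == 1 + 1] by case: x {qr} => [[|[|[|]]]].
case/or3P: x3 qr => /eqP-> qr.
- by have [rz _] := @gen r 0 (etrans (mulr1 _) qr); rewrite rz eqxx in r0.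
- by have [_ rz] := @gen 0 r (etrans (mul1r _) qr); rewrite rz eqxx in r0.
have qqq : q_ d 0 * q_ d 1 * q_ d (1 + 1) = 1.
  rewrite !qE -!cexpD -cexp0 -lnq0 !big_ord_recl big_ord0 addr0 addrA.
  by congr (cexp (lnq d _ + lnq d _ + lnq d _)); apply/val_inj.
have q01 : q_ d 0 ^ r * q_ d 1 ^ r = 1.
  by rewrite -exprzMl ?unitfE // -[LHS]mulr1 -qr -exprzMl ?qqq ?exp1rz
             ?unitfE ?mulf_neq0 // qE cexp_neq0.
by have [rz _] := gen q01; rewrite rz eqxx in r0.
Qed.

Lemma sh_sum_neq0 x (r : int) : r != 0 -> sh d x ^ r + sh d x ^ (- r) != 0.
Proof.
move=> r0; apply/eqP => E0.
have sh0 : sh d x != 0 by apply: cexp_neq0.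
have /eqP := q_expz_neq1 x r0; apply.
have sr : s_ d x ^ r = -1.
  rewrite -sh2 expr2 exprzMl ?unitfE //.
  have /eqP := E0; rewrite addr_eq0 => /eqP {1}->.
  by rewrite mulNr -expfzDr // addNr expr0z.
by rewrite -s2 expr2 exprzMl ?sr ?mulrNN ?mulr1 // unitfE; apply: cexp_neq0.
Qed.

Lemma root0P u j (r : int) : r != 0 ->
  osc (vmul (vscale (sh d (colr d 0))^-1 (root0 d u))
            (vscale (sh d (colr d 0)) (root0 d u))) j r =
  osc (vmul (vscale (muh d)^-1 (dress d (Lambdab d u 1)))
            (vinv (vscale (muh d) (dress d (Lambda d u 1))))) j r.
Proof.
move=> r0; set y := sh d (colr d 0); set X := RHS.
change (X / (y ^ r + y ^ (- r)) * y^-1 ^ (- r)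
        + X / (y ^ r + y ^ (- r)) * y ^ (- r) = X).
move: X => X; rewrite exprz_inv opprK -mulrDr.
by rewrite divfK // sh_sum_neq0.
Qed.

End Root0.

(* Main.v *)
From HB Require Import structures.
Require Import Defs.
From mathcomp Require Import all_boot all_order all_algebra.
From mathcomp Require Import complex.
From mathcomp Require Import all_classical all_reals all_analysis.
From mathcomp Require Import ring zify.
Set Implicit Arguments.
Unset Strict Implicit.
Unset Printing Implicit Defensive.
Import Order.TTheory GRing.Theory Num.Theory.
Local Open Scope ring_scope.

(** All currents are finite sums of vertex operators, so everything is decided by contractions.
    Write [S(z) X(w) = F(w/z) :S(z)X(w):] and [X(w) S(z) = G(z/w) :S(z)X(w):]. Since [e^Q] changes
    the parameters [u], the prefactor of [X] on the target module is that on the source times a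
    constant [phi]. If [F(t)] and [phi G(1/t)] are the expansions at [t = 0] and [t = oo] of one
    rational function with simple poles, then [[S, X]] is a sum of delta functions: each pole
    contributes its residue times [:S(xw)X(w):]. This is [vertex_commutator], and [vcomm_eq0],
    [vcomm1], [vcomm2] are the cases of zero, one and two poles.

    The modes of [S] are those of the root current [A] divided by [p^r - p^(-r)]. The contractions
    of [A] with the terms of the current are zero or, up to monomials and factors such as [1 + q^r]
    or [(1 + s^r)^-1], equal to [kappa_r / (1 - q^r)]. As [kappa_r] is a product of three factors
    [1 - q_i^r], the division by [p^r - p^(-r)] leaves the profile of one or two simple poles.

    The terms are linked by the root current: when [A(gz)] is [:X(z)Y(z)^(-1):], the relation
    between [A] and [S] gives [:S(pgz)X(z): = :S(p^(-1)gz)Y(z):] ([scr_wave]), so that a residue of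
    [X] and a residue of [Y] are multiples of the same operator. The integrality condition
    [e^(a_0) = k p^(-2m)] makes the two multiples opposite. The linked terms are the pairs
    [Lambda_i, Lambda_(i+1)] and [Lambda_bar(i+1), Lambda_bar(i)] at a middle node, the pair
    [Lambda_l, Lambda_bar(l)] in type C, two pairs in type D ([pair_bose], [pair_fermi],
    [typeC_plus], [typeC_minus]), and the chain [Lambda_l, Lambda_0, Lambda_bar(l)] in type B
    ([typeB_eq], [typeB_plus], [typeB_minus]).

    Dressing is harmless at the nodes [i > 0]: [K^+] has the same contraction [- kappa_r] with every
    term of the current, and these root currents are ratios of two terms. The extra term
    [Lambda_bar(0)] has as contractions a weighted mean of those of [Lambda_bar(1)(z)] and
    [Lambda_1(mu z)]. At node [1 < l] the mean vanishes; at the other nodes both contributions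
    vanish as soon as the node does not involve the first factor. For the last node this is what
    stability gives: it excludes [l = 1] in types B and C, and [l = 2] in type D.

    At node 0, the terms [Lambda_bar(1)(z)], [Lambda_bar(0)(z)], [Lambda_1(mu z)] form a type B
    chain, so their commutators cancel. The current contains [Lambda_1(z)] in place of
    [Lambda_1(mu z)], and the difference is the right-hand side of the second formula. *)

Lemma exchange_big_tri (V : nmodType) n (G : nat -> nat -> V) :
  \sum_(r < n.+1) \sum_(s < (n - r).+1) G r s =
  \sum_(s < n.+1) \sum_(r < (n - s).+1) G r s.
Proof.
have E (H : nat -> nat -> V) : \sum_(r < n.+1) \sum_(s < (n - r).+1) H r s =
    \sum_(r < n.+1) \sum_(s < n.+1 | (r + s <= n)%N) H r s.
  apply: eq_bigr => r _; rewrite (big_ord_widen n.+1 (H r)); last by lia.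
  by apply: eq_bigl => s; have := ltn_ord r; lia.
rewrite E (exchange_big_dep xpredT) //= (E (fun s r => G r s)).
by apply: eq_bigr => s _; apply: eq_bigl => r; rewrite addnC.
Qed.

Lemma big_tri_diag (V : nmodType) n (G : nat -> nat -> V) :
  \sum_(k < n.+1) \sum_(r < k.+1) G r (k - r)%N =
  \sum_(r < n.+1) \sum_(s < (n - r).+1) G r s.
Proof.
transitivity (\sum_(k < n.+1) \sum_(r < n.+1 | (r <= k)%N) G r (k - r)%N).
  apply: eq_bigr => k _; rewrite (big_ord_widen n.+1 (fun r => G r (k - r)%N)) //.
rewrite (exchange_big_dep xpredT) //=; apply: eq_bigr => r _.
rewrite -(subSn (leq_ord r)) -(big_mkord xpredT (G r)).
transitivity (\sum_(r <= k < n.+1) G r (k - r)%N); first by rewrite big_geq_mkord.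
by rewrite -{1}(add0n (r : nat)) big_addn; apply: eq_bigr => s _; rewrite addnK.
Qed.

(** * Operator exponentials, characterised by a differential equation *)

Section Exponential.
Variables (R : realType) (V : lmodType R[i]).
Implicit Types (g : nat -> {linear V -> V}) (W : nat -> V).

Lemma scale_natr_inj n (v w : V) :
  n.+1%:R *: v = n.+1%:R *: w :> V -> v = w.
Proof.
move=> /(congr1 (fun x => (n.+1%:R : R[i])^-1 *: x)).
by rewrite !scalerA mulVf ?scale1r // pnatr_eq0.
Qed.

(* W is the sequence of coefficients of a solution of
   z W' = (sum_r r g_r z^r) W. *)
Definition exp_eq g W : Prop :=
  forall n, n%:R *: W n = \sum_(r < n.+1) r%:R *: g r (W (n - r)%N).

(** The coefficient [n > 0] is determined by the lower ones, because the [r = 0] summand carries the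
    factor 0 and [n] is invertible. Identities between exponentials are proved below by checking
    that both sides solve the same equation with the same initial value. *)
Lemma exp_eq_uniq g W W' : exp_eq g W -> exp_eq g W' -> W 0%N = W' 0%N ->
  forall n, W n = W' n.
Proof.
move=> eW eW' e0 n; elim: n {-2}n (leqnn n) => [|N IH] n; first by case: n.
case: n => [//|n] lenN; apply: (@scale_natr_inj n); rewrite eW eW'.
apply: eq_bigr => -[[|r] rn] _ /=; first by rewrite !scale0r.
by rewrite IH //; lia.
Qed.

Lemma pow_coef_gt g k n v : (n < k)%N -> pow_coef (fun r => g r) k n v = 0.
Proof.
elim: k n => [//|k IH] n nk /=; rewrite big_nat_cond big1 // => r.
by rewrite andbT => /andP[r1 rn]; rewrite IH ?raddf0 //; lia.
Qed.

Lemma pow_coef_ext (f g : nat -> V -> V) : (forall r v, (0 < r)%N -> f r v = g r v) ->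
  forall k n v, pow_coef f k n v = pow_coef g k n v.
Proof.
move=> fg; elim=> [//|k IH] n v /=; rewrite big_nat_cond [RHS]big_nat_cond.
by apply: eq_bigr => r /andP[/andP[r1 _] _]; rewrite IH fg.
Qed.

Lemma exp_coef_ext (f g : nat -> V -> V) : (forall r v, (0 < r)%N -> f r v = g r v) ->
  forall n v, exp_coef f n v = exp_coef g n v.
Proof.
by move=> fg n v; apply: eq_bigr => k _; rewrite (pow_coef_ext fg).
Qed.

Lemma pow_coef_linear g k n : linear (pow_coef (fun r => g r) k n).
Proof.
elim: k n => [|k IH] n x v w /=; first by case: ifP; rewrite ?scaler0 ?addr0.
rewrite scaler_sumr -big_split; apply: eq_bigr => r _.
by rewrite IH linearP.
Qed.

Definition opexp g n : V -> V := exp_coef (fun r => g r) n.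

Lemma opexp_linear g n : linear (opexp g n).
Proof.
move=> x v w; rewrite /opexp /exp_coef scaler_sumr -big_split; apply: eq_bigr => k _.
by rewrite pow_coef_linear scalerDr !scalerA mulrC.
Qed.
HB.instance Definition _ g n :=
  GRing.isLinear.Build R[i] V V _ (opexp g n) (opexp_linear g n).

Lemma opexp0 g v : opexp g 0 v = v.
Proof. by rewrite /opexp /exp_coef big_nat1 /= invr1 scale1r. Qed.

Definition commuting g := forall r s v, g r (g s v) = g s (g r v).

Section Commuting.
Variable g : nat -> {linear V -> V}.
Hypothesis g0 : forall v, g 0%N v = 0.
Hypothesis gC : commuting g.

Lemma pow_coefS k n v : pow_coef (fun r => g r) k.+1 n v =
  \sum_(r < n.+1) g r (pow_coef (fun r => g r) k (n - r)%N v).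
Proof.
rewrite /= -(big_mkord xpredT (fun r => g r (pow_coef (fun r => g r) k (n - r)%N v))).
by rewrite [RHS]big_ltn // g0 add0r.
Qed.

(** Leibniz rule, read on coefficients: for commuting [g_r], the operator [z d/dz] sends
    [g(z)^(k+1)] to [(k+1) (z g'(z)) g(z)^k]. *)
Lemma pow_coef_deriv k n v : n%:R *: pow_coef (fun r => g r) k.+1 n v =
  k.+1%:R *: \sum_(r < n.+1) r%:R *: g r (pow_coef (fun r => g r) k (n - r)%N v).
Proof.
elim: k n => [|k IH] n.
  rewrite pow_coefS scale1r scaler_sumr; apply: eq_bigr => r _ /=.
  case: eqP => [e|_]; last by rewrite raddf0 !scaler0.
  by congr (_%:R *: _); have := ltn_ord r; lia.
rewrite [in LHS]pow_coefS scaler_sumr.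
transitivity (\sum_(r < n.+1) (r%:R *: g r (pow_coef (fun r => g r) k.+1 (n - r)%N v)
   + k.+1%:R *: \sum_(s < (n - r).+1) s%:R *: g s (g r (pow_coef (fun r => g r) k (n - r - s)%N v)))).
  apply: eq_bigr => r _.
  rewrite -{1}(subnKC (leq_ord r)) natrD scalerDl; congr (_ + _).
  rewrite -linearZZ IH linearZZ linear_sum; congr (_ *: _).
  by apply: eq_bigr => s _; rewrite linearZZ gC.
rewrite big_split /= -scaler_sumr.
rewrite (exchange_big_tri n (fun r s => s%:R *: g s (g r (pow_coef (fun r => g r) k (n - r - s)%N v)))).
rewrite [X in _ + _ *: X](_ : _ = \sum_(r < n.+1) r%:R *: g r (pow_coef (fun r => g r) k.+1 (n - r)%N v)).
  by rewrite -[X in X + _]scale1r -scalerDl -[k.+2%:R]natr1 addrC.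
apply: eq_bigr => s _; rewrite pow_coefS linear_sum scaler_sumr.
by apply: eq_bigr => r _; rewrite subnAC.
Qed.

Lemma opexp_widen N n v : (n < N)%N ->
  opexp g n v = \sum_(k < N) (k`!%:R)^-1 *: pow_coef (fun r => g r) k n v.
Proof.
move=> nN; rewrite /opexp /exp_coef big_mkord.
rewrite (big_ord_widen N (fun k => (k`!%:R)^-1 *: pow_coef (fun r => g r) k n v)) //.
rewrite big_mkcond; apply: eq_bigr => k _; case: ifP => // /negbT.
by rewrite -leqNgt => nk; rewrite pow_coef_gt ?scaler0.
Qed.

Lemma opexp_exp_eq v : exp_eq g (fun n => opexp g n v).
Proof.
move=> n; rewrite (@opexp_widen n.+2) // big_ord_recl /= scalerDr scaler_sumr.
rewrite [X in X + _](_ : _ = 0) ?add0r; last first.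
  by case: n => [|n] /=; rewrite ?scale0r ?scaler0.
transitivity (\sum_(k < n.+1) \sum_(r < n.+1)
    r%:R *: g r ((k`!%:R)^-1 *: pow_coef (fun r => g r) k (n - r)%N v)).
  apply: eq_bigr => k _; rewrite scalerA mulrC -scalerA pow_coef_deriv scalerA.
  rewrite ?/bump ?leq0n ?add1n factS natrM invfM mulrC mulrA mulfV ?mul1r ?pnatr_eq0 //.
  rewrite scaler_sumr; apply: eq_bigr => r _.
  by rewrite [in RHS]linearZZ !scalerA mulrC.
rewrite exchange_big; apply: eq_bigr => r _ /=.
by rewrite -scaler_sumr -linear_sum -opexp_widen //; lia.
Qed.

End Commuting.

(** [T] is the coefficient sequence of [z^s exp(g(z)) v]; multiplication by [z^s] adds [s] to the
    eigenvalue of [z d/dz], whence the factor [n - s]. *)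
Lemma opexp_shift g s v n : exp_eq g (fun n => opexp g n v) ->
  let T k := if (s <= k)%N then opexp g (k - s) v else 0 in
  \sum_(r < n.+1) r%:R *: g r (T (n - r)%N) = (n%:R - s%:R) *: T n.
Proof.
move=> eE /=; case: leqP => [sn|ns]; last first.
  rewrite scaler0 big1 // => r _; case: leqP => [H|]; last by rewrite linear0 scaler0.
  by have := ltn_ord r; lia.
rewrite -natrB // eE (big_ord_widen n.+1 (fun r => r%:R *: g r (opexp g (n - s - r) v))) ?ltnS ?leq_subr //.
rewrite [RHS]big_mkcond; apply: eq_bigr => r _.
have -> : (r < (n - s).+1)%N = (s <= n - r)%N by have := ltn_ord r; lia.
by case: ifP; rewrite ?linear0 ?scaler0 // subnAC.
Qed.

Section Commutation.
Variable g : nat -> {linear V -> V}.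
Hypothesis g0 : forall v, g 0%N v = 0.
Hypothesis gC : commuting g.

(** The only nonzero commutator [[f, g_s] = x] is a scalar, so [[f, exp(g(z))] = x z^s exp(g(z))].
    The proof moves the correction to the left: the difference solves the equation of
    [exp(g(z)) (f v)]. *)
Lemma opexp_bracket (f : {linear V -> V}) s x : (0 < s)%N ->
  (forall r v, (0 < r)%N -> f (g r v) = g r (f v) + (if r == s then x else 0) *: v) ->
  forall k v, f (opexp g k v) =
    opexp g k (f v) + x *: (if (s <= k)%N then opexp g (k - s) v else 0).
Proof.
move=> s0 fg k v; set T := fun k => if (s <= k)%N then opexp g (k - s) v else 0.
have eE := opexp_exp_eq g0 gC.
suff: f (opexp g k v) - x *: T k = opexp g k (f v) by move=> <-; rewrite subrK.
apply: (@exp_eq_uniq g (fun k => f (opexp g k v) - x *: T k) _ _ (eE _)); last first.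
  by rewrite /T leqNgt s0 /= scaler0 subr0 !opexp0.
move=> n; rewrite scalerBr -linearZZ eE linear_sum.
transitivity (\sum_(r < n.+1) (r%:R *: g r (f (opexp g (n - r) v) - x *: T (n - r)%N)
   + (x *: (r%:R *: g r (T (n - r)%N)) + ((if (r : nat) == s then x else 0) * r%:R) *: opexp g (n - r) v))
   - n%:R *: (x *: T n)).
  congr (_ - _); apply: eq_bigr => r _; rewrite linearZZ.
  case: (posnP r) => [->|r0]; first by rewrite !scale0r mulr0 scale0r scaler0 !addr0.
  rewrite fg // linearB scalerDr scalerBr (linearZZ (g r) x) !scalerA addrA (mulrC x) subrK.
  by rewrite (mulrC r%:R).
rewrite !big_split /= -scaler_sumr opexp_shift // -addrA -[RHS]addr0; congr (_ + _).
case: (leqP s n) => sn; last first.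
  rewrite /T leqNgt sn /= !scaler0 subr0 add0r big1 // => r _.
  by case: eqP => [e|_]; [have := ltn_ord r; lia | rewrite mul0r scale0r].
rewrite (bigD1 (inord s)) //= inordK // eqxx big1 ?addr0; last first.
  move=> r rs; case: eqP => [e|_]; last by rewrite mul0r scale0r.
  by case/eqP: rs; apply: val_inj; rewrite /= inordK.
rewrite /T sn !scalerA mulrBr scalerBl subrK.
by rewrite (mulrC x) subrr.
Qed.

Lemma opexp_commute (f : {linear V -> V}) :
  (forall r v, f (g r v) = g r (f v)) -> forall k v, f (opexp g k v) = opexp g k (f v).
Proof.
move=> fg k v; rewrite (@opexp_bracket f 1 0) ?scale0r ?addr0 //.
by move=> r w _; rewrite fg if_same scale0r addr0.
Qed.

Lemma opexp_scale (g' : nat -> {linear V -> V}) (x : R[i]) :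
  (forall r v, g' r v = x ^+ r *: g r v) ->
  forall n v, opexp g' n v = x ^+ n *: opexp g n v.
Proof.
move=> gx n v; have eE := opexp_exp_eq g0 gC v.
apply: (@exp_eq_uniq g' (fun n => opexp g' n v) (fun n => x ^+ n *: opexp g n v)).
- apply: opexp_exp_eq => [w|r s w]; first by rewrite gx g0 scaler0.
  by rewrite !gx (linearZZ (g r)) (linearZZ (g s)) gC !scalerA mulrC.
- move=> k; rewrite scalerA mulrC -scalerA eE scaler_sumr; apply: eq_bigr => r _.
  rewrite gx (linearZZ (g r)) !scalerA; congr (_ *: _).
  by rewrite -[r%:R * _ * _]mulrA -exprD subnKC ?leq_ord // mulrC.
- by rewrite !opexp0 scale1r.
Qed.

End Commutation.

Section TwoFamilies.
Variables g g' : nat -> {linear V -> V}.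
Hypothesis g0 : forall v, g 0%N v = 0.
Hypothesis gC : commuting g.
Hypothesis g'0 : forall v, g' 0%N v = 0.
Hypothesis g'C : commuting g'.

Lemma opexpC : (forall r s v, g r (g' s v) = g' s (g r v)) ->
  forall k l v, opexp g k (opexp g' l v) = opexp g' l (opexp g k v).
Proof.
move=> gg' k l v; apply/esym; apply: (opexp_commute g0 gC) => r w.
by apply/esym; apply: (opexp_commute g'0 g'C).
Qed.

Lemma opexpD (g'' : nat -> {linear V -> V}) :
  (forall r s v, g r (g' s v) = g' s (g r v)) ->
  (forall r v, g'' r v = g r v + g' r v) ->
  forall n v, opexp g'' n v = \sum_(k < n.+1) opexp g k (opexp g' (n - k) v).
Proof.
move=> gg' gD n v.
apply: (@exp_eq_uniq g'' (fun n => opexp g'' n v)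
   (fun n => \sum_(k < n.+1) opexp g k (opexp g' (n - k) v))).
- apply: opexp_exp_eq => [w|r s w]; first by rewrite gD g0 g'0 addr0.
  rewrite !gD !linearD /= gC g'C -!addrA; congr (_ + _).
  by rewrite (gg' r) -(gg' s) addrCA.
- move=> k.
  transitivity (\sum_(i < k.+1) \sum_(r < i.+1) r%:R *: g r (opexp g (i - r) (opexp g' (k - i) v)) +
                \sum_(i < k.+1) \sum_(r < (k - i).+1) r%:R *: g' r (opexp g i (opexp g' (k - i - r) v))).
    rewrite scaler_sumr -big_split; apply: eq_bigr => i _ /=.
    rewrite -{1}(subnKC (leq_ord i)) natrD scalerDl; congr (_ + _).
      exact: (opexp_exp_eq g0 gC).
    rewrite -linearZZ (opexp_exp_eq g'0 g'C) linear_sum.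
    apply: eq_bigr => r _; rewrite linearZZ; congr (_ *: _).
    by apply/esym; apply: (opexp_commute g0 gC) => s w; rewrite gg'.
  rewrite (exchange_big_tri k (fun i r => r%:R *: g' r (opexp g i (opexp g' (k - i - r) v)))).
  rewrite (eq_bigr (fun i : 'I_k.+1 => \sum_(r < i.+1) r%:R *: g r (opexp g (i - r) (opexp g' (k - r - (i - r)) v)))); last first.
    move=> i _; apply: eq_bigr => r _; do 3 congr (_ _).
    by congr (opexp _ _ _); have := ltn_ord r; have := ltn_ord i; lia.
  rewrite (big_tri_diag k (fun r s => r%:R *: g r (opexp g s (opexp g' (k - r - s) v)))).
  rewrite -big_split; apply: eq_bigr => r _ /=.
  rewrite gD scalerDr !linear_sum; congr (_ + _).
  by apply: eq_bigr => s _; rewrite subnAC.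
- by rewrite big_ord1 !opexp0.
Qed.

(** Wick contraction on the vacuum. As [g_r] kills [vac], it acts on [exp(g'(w)) vac] as the scalar
    [x_r w^r]; hence [exp(g(z))] acts as the scalar series [e], the exponential of
    [sum_r x_r t^r]. *)
Lemma opexp_vac vac (x e : nat -> R[i]) :
  (forall r, g r vac = 0) ->
  (forall r s v, (0 < r)%N -> (0 < s)%N ->
    g r (g' s v) = g' s (g r v) + (if s == r then x r else 0) *: v) ->
  e 0%N = 1 ->
  (forall n, n%:R * e n = \sum_(r < n.+1) r%:R * x r * e (n - r)%N) ->
  forall m k, opexp g m (opexp g' k vac) =
    e m *: (if (m <= k)%N then opexp g' (k - m) vac else 0).
Proof.
move=> gv gg' e0 eE m k.
apply: (@exp_eq_uniq g (fun m => opexp g m (opexp g' k vac))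
  (fun m => e m *: (if (m <= k)%N then opexp g' (k - m) vac else 0))).
- exact: opexp_exp_eq.
- move=> n; rewrite scalerA eE scaler_suml; apply: eq_bigr => r _.
  case: (posnP r) => [->|r0]; first by rewrite mul0r mul0r !scale0r.
  rewrite linearZZ -mulrA -scalerA -(mulrC (e _)) -scalerA; congr (_ *: (_ *: _)).
  have gE l : g r (opexp g' l vac) = x r *: (if (r <= l)%N then opexp g' (l - r) vac else 0).
    rewrite (opexp_bracket g'0 g'C r0 (x := x r)); first by rewrite gv linear0 add0r.
    by move=> s v s0; rewrite gg'.
  have rn := leq_ord r.
  case: (leqP (n - r) k) => nrk; last by rewrite linear0 leqNgt ifN ?scaler0 //; lia.
  rewrite gE; congr (_ *: _).
  have -> : (r <= k - (n - r))%N = (n <= k)%N by lia.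
  by case: ifP => // nk; congr (opexp _ _ _); lia.
- by rewrite !opexp0 e0 scale1r subn0.
Qed.

End TwoFamilies.
End Exponential.

(** * Modes of a vertex operator on the Fock space, and finiteness of its coefficients *)

Lemma fsum_nat (V : nmodType) (g : nat -> V) M :
  (forall m, (M <= m)%N -> g m = 0) -> \sum_(m \in [set: nat]) g m = \sum_(m < M) g m.
Proof.
move=> gM; rewrite fsbig_ord; apply/esym/fsbig_widen => // m [_ /= /negP].
by rewrite -leqNgt => /gM.
Qed.

(* h_{j,r} z^{-r} on its own, so that h_{j,r} = mode_op (boson j) r *)
Definition boson (R : realType) (j : nat) : vertex R :=
  Vertex 1 (fun k _ => (k == j)%:R).

(* [x_r, y_{-r}] *)
Definition brk (R : realType) (d : datum R) (X Y : vertex R) (r : int) : R[i] :=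
  \sum_(1 <= j < (ell d).+2) osc X j r * osc Y j (- r) * boson_comm d j r.

Section Fock.
Variables (R : realType) (d : datum R) (V : lmodType R[i]).
Variables (h : nat -> int -> V -> V) (vac : V).
Hypothesis fk : is_fock d h vac.
Implicit Types (X Y S H : vertex R) (v w : V).

Lemma mode_op_linear X r : r != 0 -> linear (mode_op d h X r).
Proof.
move=> r0 x v w; rewrite /mode_op scaler_sumr -big_split !big_nat /=.
apply: eq_bigr => j jl; rewrite (fock_linear fk) //.
by rewrite scalerDr !scalerA mulrC.
Qed.

(** The value at [r = 0] is set to 0 because [h j 0] is unconstrained; this makes the map linear for
    every [r] and supplies the vanishing of [g 0] required by the lemmas on exponentials. *)
Definition lmode_fun X r v : V := if r == 0 then 0 else mode_op d h X r v.
Lemma lmode_linear X r : linear (lmode_fun X r).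
Proof.
move=> x v w; rewrite /lmode_fun; case: eqP => [_|/eqP r0]; first by rewrite scaler0 addr0.
exact: mode_op_linear.
Qed.
HB.instance Definition _ X r :=
  GRing.isLinear.Build R[i] V V _ (lmode_fun X r) (lmode_linear X r).
Definition lmode X r : {linear V -> V} := lmode_fun X r.

Lemma lmodeE X r v : r != 0 -> lmode X r v = mode_op d h X r v.
Proof. by rewrite /lmode /= /lmode_fun => /negPf ->. Qed.

Lemma lmode0 X v : lmode X 0 v = 0.
Proof. by rewrite /lmode /= /lmode_fun eqxx. Qed.

Lemma mode_boson j r v : (1 <= j <= (ell d).+1)%N -> mode_op d h (boson R j) r v = h j r v.
Proof.
move=> jl; rewrite /mode_op (bigD1_seq j) ?mem_index_iota ?iota_uniq //= eqxx scale1r.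
by rewrite big1 ?addr0 // => k /negPf kj; rewrite kj scale0r.
Qed.

Lemma mode_comm X Y r s v : r != 0 -> s != 0 ->
  lmode X r (lmode Y s v) =
    lmode Y s (lmode X r v) + (if r + s == 0 then brk d X Y r else 0) *: v.
Proof.
move=> r0 s0; rewrite !lmodeE //.
apply/eqP; rewrite addrC -subr_eq; apply/eqP.
have hlin j t : (1 <= j < (ell d).+2)%N -> t != 0 -> linear (h j t).
  by move=> ? ?; apply: (fock_linear fk).
have hZ j t x w : (1 <= j < (ell d).+2)%N -> t != 0 -> h j t (x *: w) = x *: h j t w.
  move=> jl t0; pose f : {linear V -> V} := HB.pack (h j t)
    (GRing.isLinear.Build R[i] V V _ (h j t) (hlin j t jl t0)).
  exact: (linearZZ f).
have lsum Z t F : t != 0 -> mode_op d h Z t (\sum_(1 <= j < (ell d).+2) F j) =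
    \sum_(1 <= j < (ell d).+2) mode_op d h Z t (F j).
  move=> t0; pose f : {linear V -> V} := HB.pack (mode_op d h Z t)
    (GRing.isLinear.Build R[i] V V _ (mode_op d h Z t) (mode_op_linear Z t0)).
  exact: (linear_sum f).
rewrite [in X in X - _ = _]/mode_op.
transitivity (\sum_(1 <= j < (ell d).+2) \sum_(1 <= k < (ell d).+2)
   (osc X j r * osc Y k s) *: (h j r (h k s v) - h k s (h j r v))).
  have -> : mode_op d h Y s (mode_op d h X r v) =
     \sum_(1 <= j < (ell d).+2) \sum_(1 <= k < (ell d).+2) (osc X j r * osc Y k s) *: h k s (h j r v).
    rewrite [in X in mode_op d h Y s X]/mode_op lsum // big_nat [RHS]big_nat.
    apply: eq_bigr => j jl; rewrite /mode_op big_nat [RHS]big_nat.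
    by apply: eq_bigr => k kl; rewrite hZ // scalerA mulrC.
  rewrite -sumrB big_nat [RHS]big_nat; apply: eq_bigr => j jl.
  rewrite /mode_op (_ : h j r (\sum_(1 <= k < _) _) =
     \sum_(1 <= k < (ell d).+2) osc Y k s *: h j r (h k s v)).
    rewrite scaler_sumr -sumrB; apply: eq_bigr => k _.
    by rewrite scalerA -scalerBr.
  pose f : {linear V -> V} := HB.pack (h j r)
    (GRing.isLinear.Build R[i] V V _ (h j r) (hlin j r jl r0)).
  transitivity (\sum_(1 <= k < (ell d).+2) h j r (osc Y k s *: h k s v)).
    exact: (linear_sum f).
  by rewrite big_nat [RHS]big_nat; apply: eq_bigr => k kl; rewrite hZ.
rewrite /brk; case: eqP => rs; last first.
  rewrite scale0r big_nat big1 // => j jl; rewrite big_nat big1 // => k kl.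
  by rewrite (fock_comm fk) // (introF eqP rs) andbF scale0r scaler0.
rewrite scaler_suml big_nat [RHS]big_nat; apply: eq_bigr => j jl.
rewrite (bigD1_seq j) ?mem_index_iota ?iota_uniq //= [X in _ + X]big_nat_cond big1 ?addr0; last first.
  move=> k /andP[kl kj]; rewrite (fock_comm fk) // eq_sym (negPf kj).
  by rewrite scale0r scaler0.
rewrite (fock_comm fk) // rs !eqxx scalerA; congr (_ * osc Y j _ * _ *: _).
by apply/eqP; rewrite -addr_eq0 addrC rs.
Qed.

Definition posm X (r : nat) := lmode X r%:Z.
Definition negm X (r : nat) := lmode X (- r%:Z).
Definition posexp X m v : V := opexp (posm X) m v.
Definition negexp X (k : int) v : V := if k is Posz k then opexp (negm X) k v else 0.

Lemma posm0 X v : posm X 0 v = 0. Proof. exact: lmode0. Qed.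
Lemma negm0 X v : negm X 0 v = 0. Proof. exact: lmode0. Qed.

Lemma posmC X Y r s v : posm X r (posm Y s v) = posm Y s (posm X r v).
Proof.
case: (posnP r) => [->|r0]; first by rewrite !posm0 linear0.
case: (posnP s) => [->|s0]; first by rewrite !posm0 linear0.
rewrite /posm mode_comm; try lia.
by case: eqP => [|_]; [lia | rewrite scale0r addr0].
Qed.

Lemma negmC X Y r s v : negm X r (negm Y s v) = negm Y s (negm X r v).
Proof.
case: (posnP r) => [->|r0]; first by rewrite !negm0 linear0.
case: (posnP s) => [->|s0]; first by rewrite !negm0 linear0.
rewrite /negm mode_comm; try lia.
by case: eqP => [|_]; [lia | rewrite scale0r addr0].
Qed.

Lemma posexp_linear X m : linear (posexp X m).
Proof. by move=> x v w; rewrite /posexp linearP. Qed.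
Lemma negexp_linear X k : linear (negexp X k).
Proof. by move=> x v w; case: k => k /=; rewrite ?linearP ?scaler0 ?addr0. Qed.
HB.instance Definition _ X m :=
  GRing.isLinear.Build R[i] V V _ (posexp X m) (posexp_linear X m).
HB.instance Definition _ X m :=
  GRing.isLinear.Build R[i] V V _ (negexp X m) (negexp_linear X m).

Lemma posexp_pos X H r m v : (0 < r)%N ->
  lmode H r%:Z (posexp X m v) = posexp X m (lmode H r%:Z v).
Proof. by move=> r0; apply: (opexp_commute (posm0 X) (posmC X X)) => s w; apply: posmC. Qed.

Lemma posexp_neg X H r m v : (0 < r)%N ->
  lmode H (- r%:Z) (posexp X m v) = posexp X m (lmode H (- r%:Z) v) +
    brk d H X (- r%:Z) *: (if (r <= m)%N then posexp X (m - r) v else 0).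
Proof.
move=> r0; apply: (opexp_bracket (posm0 X) (posmC X X)) => // s w s0.
rewrite mode_comm; try lia.
by congr (_ + _ *: _); rewrite addrC subr_eq0 eqz_nat.
Qed.

Lemma negexp_neg X H r k v : (0 < r)%N ->
  lmode H (- r%:Z) (negexp X k v) = negexp X k (lmode H (- r%:Z) v).
Proof.
move=> r0; case: k => k; last by rewrite /= linear0.
by apply: (opexp_commute (negm0 X) (negmC X X)) => s w; apply: negmC.
Qed.

Lemma negexp_pos X H r k v : (0 < r)%N ->
  lmode H r%:Z (negexp X k v) = negexp X k (lmode H r%:Z v) +
    brk d H X r%:Z *: negexp X (k - r%:Z) v.
Proof.
move=> r0; case: k => k; last first.
  rewrite /= linear0 add0r (_ : Negz k - r%:Z = Negz (k + r)%N) ?scaler0 //.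
  by rewrite !NegzE; lia.
rewrite /= (opexp_bracket (negm0 X) (negmC X X) (s := r) (x := brk d H X r%:Z)) //.
  congr (_ + _ *: _); case: leqP => rk; first by rewrite subzn.
  have [n ->] : exists n, (k%:Z - r%:Z) = Negz n by exists (r - k).-1; lia.
  by [].
move=> s w s0; rewrite mode_comm; try lia.
by congr (_ + _ *: _); rewrite subr_eq0 eqz_nat eq_sym.
Qed.

Lemma fock_ind (P : V -> Prop) : P vac ->
  (forall x v w, P v -> P w -> P (x *: v + w)) ->
  (forall j r v, (1 <= j <= (ell d).+1)%N -> (0 < r)%N -> P v -> P (lmode (boson R j) r%:Z v)) ->
  (forall j r v, (1 <= j <= (ell d).+1)%N -> (0 < r)%N -> P v -> P (lmode (boson R j) (- r%:Z) v)) ->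
  forall v, P v.
Proof.
move=> P0 Plin Pp Pn; apply: (fock_cyclic fk) => // j r v jl r0 Pv.
rewrite -mode_boson // -lmodeE //.
case: r r0 => [[//|r]|r] _; first exact: Pp.
by rewrite NegzE; apply: Pn.
Qed.

Lemma mode_vac X r : (0 < r)%N -> lmode X r%:Z vac = 0.
Proof.
move=> r0; rewrite lmodeE; last by lia.
rewrite /mode_op big_nat big1 // => j jl; rewrite (fock_vac fk) ?scaler0 //.
Qed.

Lemma posm_vac X r : posm X r vac = 0.
Proof. by case: (posnP r) => [->|r0]; [exact: posm0 | exact: mode_vac]. Qed.

Lemma posexp_vac X m : posexp X m vac = if m == 0%N then vac else 0.
Proof.
apply: (exp_eq_uniq (g := posm X) (W := fun m => posexp X m vac)
  (W' := fun m => if m == 0%N then vac else 0)).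
- exact: (opexp_exp_eq (posm0 X) (posmC X X)).
- move=> n; rewrite big1 => [|r _]; first by case: n => [|n] /=; rewrite ?scale0r ?scaler0.
  by case: ifP => _; rewrite ?posm_vac ?linear0 ?scaler0.
- by rewrite /posexp opexp0.
Qed.

(** By induction over the Fock space: on the vacuum nothing survives beyond degree 0, positive modes
    commute with the positive exponential, and a negative mode of degree [r] delays the vanishing by
    at most [r]. *)
Lemma posexp_fin X v : exists M, forall m, (M <= m)%N -> posexp X m v = 0.
Proof.
move: v; apply: fock_ind.
- by exists 1%N => -[//|m] _; rewrite posexp_vac.
- move=> x v w [M1 h1] [M2 h2]; exists (maxn M1 M2) => m; rewrite geq_max => /andP[m1 m2].
  by rewrite posexp_linear h1 // h2 // scaler0 addr0.
- move=> j r v jl r0 [M hM]; exists M => m /hM e.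
  by rewrite -posexp_pos // e linear0.
- move=> j r v jl r0 [M hM]; exists (M + r)%N => m mM.
  have := posexp_neg X (boson R j) m v r0.
  rewrite hM ?linear0; last by lia.
  by case: leqP => rm; rewrite ?hM ?scaler0 ?addr0 //; lia.
Qed.

Lemma vcoefE X n v M : (forall m, (M <= m)%N -> posexp X m v = 0) ->
  vcoef d h X n v = pref X *: \sum_(m < M) negexp X (n + m%:Z) (posexp X m v).
Proof.
move=> hM; rewrite /vcoef; congr (_ *: _); rewrite -(fsum_nat (g := fun m => negexp X (n + m%:Z) (posexp X m v))); last first.
  by move=> m /hM ->; rewrite linear0.
apply: eq_fsbigr => m _; rewrite /negexp; case: (n + m%:Z) => k //.
rewrite (@exp_coef_ext _ _ (fun r => mode_op d h X r%:Z) (fun r => posm X r)); last first.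
  by move=> r w r0; rewrite /posm lmodeE //; lia.
apply: exp_coef_ext => r w r0; rewrite /negm lmodeE //; lia.
Qed.

End Fock.

(** * The commutator of two vertex operators as a sum of delta functions *)

Lemma eq_big_uniq_supp (I : eqType) (V : nmodType) (s t : seq I) (f : I -> V) :
  uniq s -> uniq t -> (forall i, f i != 0 -> (i \in s) = (i \in t)) ->
  \sum_(i <- s) f i = \sum_(i <- t) f i.
Proof.
move=> us ut st.
have E (r : seq I) : \sum_(i <- r) f i = \sum_(i <- [seq i <- r | f i != 0]) f i.
  by rewrite big_filter [RHS]big_mkcond; apply: eq_bigr => i _; case: eqP.
rewrite E [RHS]E; apply: perm_big; apply: uniq_perm; rewrite ?filter_uniq // => i.
by rewrite !mem_filter; case: (boolP (f i != 0)) => // /st.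
Qed.

(** The left side is the sum of [f] over its support window from [-a] to [b], which is empty when
    [a + b < 0]. The two half-line sums on the right both contain [f 0], hence the subtraction. *)
Lemma big_int_supp (V : zmodType) (f : int -> V) (a b : int) M :
  (forall i, i < - a -> f i = 0) -> (forall i, b < i -> f i = 0) ->
  (`|a| < M)%N -> (`|b| < M)%N ->
  (if a + b is Posz N then \sum_(k < N.+1) f (k%:Z - a) else 0) =
  \sum_(m < M) f m%:Z + \sum_(m < M) f (- m%:Z) - f 0.
Proof.
move=> fa fb aM bM.
have -> : \sum_(m < M) f (- m%:Z) = f 0 + \sum_(m <- iota 1 M.-1) f (- m%:Z).
  by case: M aM {bM} => // M _; rewrite -(big_mkord xpredT (fun m => f (- m%:Z))) /index_iota /= big_cons.
rewrite [in RHS]addrCA [RHS]addrC addKr -(big_mkord xpredT (fun m => f m%:Z)) /index_iota subn0.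
rewrite -(big_map (fun m : nat => m%:Z) xpredT f) -(big_map (fun m : nat => - m%:Z) xpredT f).
rewrite -big_cat /=.
transitivity (\sum_(i <- (if a + b is Posz N then [seq k%:Z - a | k <- iota 0 N.+1] else [::])) f i).
  case: (a + b) => [N|N]; last by rewrite big_nil.
  by rewrite big_map -(big_mkord xpredT (fun k => f (k%:Z - a))).
apply: eq_big_uniq_supp.
- by case: (a + b) => [N|N] //; rewrite map_inj_uniq ?iota_uniq // => x y; lia.
- rewrite cat_uniq !map_inj_uniq ?iota_uniq ?andbT /=; [|by move=> x y; lia..].
  apply/hasPn => _ /mapP[m m1 ->]; apply/mapP => -[m' _ e].
  by move: m1; rewrite mem_iota; lia.
- move=> i fi.
  have ia : - a <= i by case: leP => // /fa f0; rewrite f0 eqxx in fi.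
  have ib : i <= b by case: leP => // /fb f0; rewrite f0 eqxx in fi.
  rewrite mem_cat; transitivity true.
    case E: (a + b) => [N|N]; last by lia.
    by apply/mapP; exists (absz (i + a)); rewrite ?mem_iota; lia.
  apply/esym; case: (lerP 0 i) => i0; apply/orP; [left|right]; apply/mapP;
   exists (absz i); rewrite ?mem_iota; lia.
Qed.

Section Vertex.
Variables (R : realType) (d : datum R).
Implicit Types (X Y S H : vertex R).

Lemma brk_vmulr H X Y r : brk d H (vmul X Y) r = brk d H X r + brk d H Y r.
Proof. by rewrite /brk -big_split; apply: eq_bigr => j _ /=; rewrite mulrDr mulrDl. Qed.

Lemma brk_vscaler H x X r : brk d H (vscale x X) r = x ^ r * brk d H X r.
Proof.
rewrite /brk mulr_sumr; apply: eq_bigr => j _ /=; rewrite opprK.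
by rewrite mulrA [in RHS]mulrA; congr (_ * _); rewrite mulrC.
Qed.

Section Fock.
Variables (V : lmodType R[i]) (h : nat -> int -> V -> V) (vac : V).
Hypothesis fk : is_fock d h vac.
Local Notation md := (lmode fk).
Local Notation vc := (vcoef d h).

Lemma vcoef_linear X n : linear (vc X n).
Proof.
move=> x v w; have [M1 h1] := posexp_fin fk X v; have [M2 h2] := posexp_fin fk X w.
have [m1 m2] := (leq_maxl M1 M2, leq_maxr M1 M2).
have k1 m : (maxn M1 M2 <= m)%N -> posexp fk X m v = 0 by move=> mM; apply: h1; lia.
have k2 m : (maxn M1 M2 <= m)%N -> posexp fk X m w = 0 by move=> mM; apply: h2; lia.
rewrite (vcoefE n k1) (vcoefE n k2) (@vcoefE _ _ _ _ _ fk X n _ (maxn M1 M2)); last first.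
  by move=> m mM; rewrite posexp_linear k1 // k2 // scaler0 addr0.
rewrite scalerA mulrC -scalerA -scalerDr; congr (_ *: _).
rewrite scaler_sumr -big_split; apply: eq_bigr => m _ /=.
by rewrite posexp_linear negexp_linear.
Qed.

Lemma vcoefZ X n x v : vc X n (x *: v) = x *: vc X n v.
Proof.
pose f : {linear V -> V} := HB.pack (vc X n)
  (GRing.isLinear.Build R[i] V V _ (vc X n) (vcoef_linear X n)).
exact: (linearZZ f).
Qed.

Lemma vcoefB X n v w : vc X n (v - w) = vc X n v - vc X n w.
Proof. by rewrite addrC -scaleN1r vcoef_linear scaleN1r addrC. Qed.

(** This is [[H_r, X(z)] = z^r brk(H, X, r) X(z)] on coefficients. Together with cyclicity it
    reduces identities between products of vertex operators to the vacuum. *)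
Lemma vcoef_mode H X n r v : r != 0 ->
  vc X n (md H r v) = md H r (vc X n v) - brk d H X r *: vc X (n - r) v.
Proof.
move=> r0; apply/eqP; rewrite eq_sym subr_eq; apply/eqP.
have [M hM] := posexp_fin fk X v.
have [r1|r1] : (exists2 s, (0 < s)%N & r = s%:Z) \/ (exists2 s, (0 < s)%N & r = - s%:Z).
  by case: r r0 => [[//|s]|s] _; [left; exists s.+1|right; exists s.+1; rewrite ?NegzE].
- case: r1 => s s0 -> {r r0}.
  have k1 m : (M <= m)%N -> posexp fk X m (md H s v) = 0.
    by move=> /hM e; rewrite -posexp_pos // e linear0.
  rewrite (vcoefE n hM) (vcoefE _ k1) (vcoefE _ hM) (linearZZ (md H _)) (linear_sum (md H _)).
  rewrite [in RHS]scalerA (mulrC (brk _ _ _ _)) -scalerA -scalerDr; congr (_ *: _).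
  rewrite scaler_sumr -big_split; apply: eq_bigr => m _ /=.
  by rewrite negexp_pos // posexp_pos // addrAC.
- case: r1 => s s0 -> {r r0}.
  have k0 m : (M + s <= m)%N -> posexp fk X m v = 0 by move=> mM; apply: hM; lia.
  have k1 m : (M + s <= m)%N -> posexp fk X m (md H (- s%:Z) v) = 0.
    move=> mM; have := posexp_neg fk X H m v s0; rewrite hM ?linear0; last by lia.
    by case: leqP => sm; rewrite ?hM ?scaler0 ?addr0 //; lia.
  rewrite (vcoefE n k0) (vcoefE _ k1) (vcoefE _ hM) (linearZZ (md H _)) (linear_sum (md H _)).
  rewrite [in RHS]scalerA (mulrC (brk _ _ _ _)) -scalerA -scalerDr; congr (_ *: _).
  transitivity (\sum_(m < M + s) (negexp fk X (n + m%:Z) (posexp fk X m (md H (- s%:Z) v)) +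
     brk d H X (- s%:Z) *: negexp fk X (n + m%:Z) (if (s <= m)%N then posexp fk X (m - s) v else 0))).
    by apply: eq_bigr => m _; rewrite negexp_neg // posexp_neg // linearD linearZZ.
  (* The correction term lives in degrees [m >= s]; the substitution [m = s + m'] turns it into the
     coefficient of index [n + s]. *)
  rewrite big_split /=; congr (_ + _); rewrite -scaler_sumr; congr (_ *: _).
  rewrite addnC big_split_ord /= big1 ?add0r => [|m _]; last first.
    by rewrite leqNgt ltn_ord /= linear0.
  by apply: eq_bigr => m _; rewrite leq_addr addKn; congr (negexp _ _ _ _); lia.
Qed.

Lemma vcoef_vac X n : vc X n vac = pref X *: negexp fk X n vac.
Proof.
rewrite (@vcoefE _ _ _ _ _ fk X n _ 1); last first.
  by move=> [//|m] _; rewrite posexp_vac.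
by rewrite big_ord1 posexp_vac /= addr0.
Qed.

Lemma negexpC X Y k l v : negexp fk X k (negexp fk Y l v) = negexp fk Y l (negexp fk X k v).
Proof.
case: k => k; case: l => l /=; rewrite ?linear0 //.
by apply: (opexpC (negm0 fk X) (negmC fk X X) (negm0 fk Y) (negmC fk Y Y)) => *; apply: negmC.
Qed.

Lemma posexp_negexp_vac S X (F : nat -> R[i]) : F 0%N = 1 ->
  (forall n, n%:R * F n = \sum_(r < n.+1) r%:R * brk d S X r%:Z * F (n - r)%N) ->
  forall m k, posexp fk S m (negexp fk X k vac) = F m *: negexp fk X (k - m%:Z) vac.
Proof.
move=> F0 FE m [k|k]; last first.
  rewrite /= linear0 (_ : Negz k - m%:Z = Negz (k + m)%N) ?scaler0 //.
  by rewrite !NegzE; lia.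
rewrite /= /posexp (opexp_vac (posm0 fk S) (posmC fk S S) (negm0 fk X) (negmC fk X X)
  (posm_vac fk S) (x := fun r => brk d S X r%:Z) _ F0 FE).
  congr (_ *: _); case: leqP => mk; first by rewrite subzn.
  have [n ->] : exists n, (k%:Z - m%:Z) = Negz n by exists (m - k).-1; lia.
  by [].
move=> r s v r0 s0; rewrite mode_comm; try lia.
by congr (_ + _ *: _); rewrite subr_eq0 eqz_nat eq_sym.
Qed.

Lemma vcoef2_vac S X (F : nat -> R[i]) : F 0%N = 1 ->
  (forall n, n%:R * F n = \sum_(r < n.+1) r%:R * brk d S X r%:Z * F (n - r)%N) ->
  forall M a b, (`|b| < M)%N -> vc S a (vc X b vac) = (pref S * pref X) *:
    \sum_(m < M) F m *: negexp fk S (a + m%:Z) (negexp fk X (b - m%:Z) vac).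
Proof.
move=> F0 FE M a b bM; rewrite vcoef_vac vcoefZ mulrC -scalerA; congr (_ *: _).
rewrite (@vcoefE _ _ _ _ _ fk S a _ M); last first.
  move=> m mM; rewrite (posexp_negexp_vac F0 FE).
  have [n ->] : exists n, (b - m%:Z) = Negz n by exists (absz (m%:Z - b)).-1; lia.
  by rewrite /= scaler0.
by congr (_ *: _); apply: eq_bigr => m _; rewrite (posexp_negexp_vac F0 FE) linearZZ.
Qed.

Lemma negexp_vmul_vac S X x n : negexp fk (vmul (vscale x S) X) n vac =
  if n is Posz N then \sum_(k < N.+1) x ^+ k *: negexp fk S k%:Z (negexp fk X (N%:Z - k%:Z) vac)
  else 0.
Proof.
case: n => //= N.
pose g := negm fk (vscale x S).
have mode_vmul Y Z r v : md (vmul Y Z) r v = md Y r v + md Z r v.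
  case: (eqVneq r 0) => [->|r0]; first by rewrite !lmode0 addr0.
  rewrite !lmodeE // /mode_op -big_split; apply: eq_bigr => j _.
  by rewrite /= scalerDl.
have gE r v : g r v = x ^+ r *: negm fk S r v.
  case: (posnP r) => [->|r0]; first by rewrite /g !negm0 scaler0.
  rewrite /g /negm !lmodeE; try lia.
  rewrite /mode_op scaler_sumr; apply: eq_bigr => j _.
  by rewrite /= opprK scalerA mulrC.
have g0 v : g 0%N v = 0 by apply: negm0.
have gC : commuting g by move=> r s v; apply: negmC.
rewrite (opexpD g0 gC (negm0 fk X) (negmC fk X X) (g'' := negm fk (vmul (vscale x S) X))).
- apply: eq_bigr => k _; rewrite (opexp_scale (negm0 fk S) (negmC fk S S) gE).
  by rewrite subzn // leq_ord.
- by move=> r s v; apply: negmC.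
- by move=> r v; apply: mode_vmul.
Qed.

Section Commutator.
Variables (S X : vertex R) (phi : R[i]) (F G : nat -> R[i]) (rs : seq (R[i] * R[i])).
Hypothesis rs0 : forall x, x \in rs -> x.2 != 0.
Hypothesis F0 : F 0%N = 1.
Hypothesis FE : forall n,
  n%:R * F n = \sum_(r < n.+1) r%:R * brk d S X r%:Z * F (n - r)%N.
Hypothesis G0 : G 0%N = 1.
Hypothesis GE : forall n,
  n%:R * G n = \sum_(r < n.+1) r%:R * brk d X S r%:Z * G (n - r)%N.
Hypothesis FR : forall n, F n = (n == 0%N)%:R * phi + \sum_(x <- rs) x.1 * x.2 ^ n.
Hypothesis GR : forall n,
  phi * G n = (n == 0%N)%:R - \sum_(x <- rs) x.1 * x.2 ^ (- n%:Z).

(** [FR] says that the contraction [F(t)] is the rational function [phi + sum c / (1 - x t)], over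
    the pairs [(c, x)] of [rs], and [GR] says that [phi G(1/t)] is its expansion at infinity. The
    two expansions differ by [sum_x c sum_i (x t)^i] over all integers [i], a combination of delta
    functions, which evaluates [S] at [x w]. *)
Lemma commutator_vac a b :
  vc S a (vc X b vac) - phi *: vc X b (vc S a vac) =
  \sum_(x <- rs) (x.1 * x.2 ^ (- a)) *: vc (vmul (vscale x.2 S) X) (a + b) vac.
Proof.
pose M := (`|a| + `|b|).+1; pose N i := negexp fk S (a + i) (negexp fk X (b - i) vac).
have [aM bM] : (`|a| < M)%N /\ (`|b| < M)%N by rewrite /M; lia.
have Na i : i < - a -> N i = 0.
  by move=> ia; rewrite /N; case E : (a + i) => [k|k] //; lia.
have Nb i : b < i -> N i = 0.
  by move=> ib; rewrite /N; case E : (b - i) => [k|k]; [lia | rewrite linear0].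
rewrite (vcoef2_vac F0 FE _ bM) (vcoef2_vac G0 GE _ aM).
rewrite [pref X * _]mulrC scalerA (mulrC phi) -[(_ * phi) *: _]scalerA -scalerBr.
transitivity ((pref S * pref X) *: \sum_(x <- rs) (x.1 *:
   (\sum_(m < M) x.2 ^ m *: N m%:Z + \sum_(m < M) x.2 ^ (- m%:Z) *: N (- m%:Z) - x.2 ^ 0 *: N 0))).
  congr (_ *: _); pose P x := \sum_(m < M) x ^ m *: N m%:Z.
  pose Q x := \sum_(m < M) x ^ (- m%:Z) *: N (- m%:Z).
  have drop (f : int -> V) y : \sum_(m < M) (((m : nat) == 0%N)%:R * y) *: f m%:Z = y *: f 0.
    rewrite big_ord_recl big1 ?addr0 => [|m _]; first by rewrite mul1r.
    by rewrite mul0r scale0r.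
  have E1 : \sum_(m < M) F m *: negexp fk S (a + m%:Z) (negexp fk X (b - m%:Z) vac) =
      phi *: N 0 + \sum_(x <- rs) x.1 *: P x.2.
    under [X in _ + X]eq_bigr do rewrite scaler_sumr.
    rewrite exchange_big -(drop N) -big_split; apply: eq_bigr => m _ /=.
    rewrite FR scalerDl scaler_suml; congr (_ + _).
    by apply: eq_bigr => x _; rewrite scalerA.
  have E2 : phi *: (\sum_(m < M) G m *: negexp fk X (b + m%:Z) (negexp fk S (a - m%:Z) vac)) =
      N 0 - \sum_(x <- rs) x.1 *: Q x.2.
    under [X in _ - X]eq_bigr do rewrite scaler_sumr.
    rewrite exchange_big -[X in X - _]scale1r -(drop (fun i => N (- i))) -sumrB scaler_sumr.
    apply: eq_bigr => m _ /=.
    rewrite negexpC scalerA GR mulr1 /N opprK scalerBl scaler_suml; congr (_ - _).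
    by apply: eq_bigr => x _; rewrite scalerA.
  (* The index 0 occurs in both expansions; [F 0 = 1] forces the coefficients [c] to add up to
     [1 - phi], which corrects the double count. *)
  have E3 : \sum_(x <- rs) x.1 *: (x.2 ^ 0 *: N 0) = N 0 - phi *: N 0.
    have sE : \sum_(x <- rs) x.1 * x.2 ^ 0 = 1 - phi.
      by rewrite -F0 FR eqxx mul1r addrC addKr.
    under eq_bigr do rewrite scalerA.
    by rewrite -scaler_suml sE scalerBl scale1r.
  under [RHS]eq_bigr do rewrite scalerBr scalerDr.
  rewrite sumrB big_split /= E3 E1 E2 !opprB [RHS]addrACA.
  by rewrite (addrC (phi *: _)).
rewrite scaler_sumr big_seq [RHS]big_seq; apply: eq_bigr => x /rs0 x0.
rewrite vcoef_vac [pref (vmul _ _)]/=.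
suff -> : \sum_(m < M) x.2 ^ m *: N m%:Z + \sum_(m < M) x.2 ^ (- m%:Z) *: N (- m%:Z) - x.2 ^ 0 *: N 0 =
    x.2 ^ (- a) *: negexp fk (vmul (vscale x.2 S) X) (a + b) vac.
  by rewrite !scalerA; congr (_ *: _); ring.
(* The full Laurent sum over [i] is reindexed by [k = i + a], the power of [z] taken from [S]; the
   shift produces the factor [x^(-a)]. *)
have Hi := @big_int_supp V (fun i => x.2 ^ i *: N i) a b M.
rewrite -{}Hi //; first last.
- by move=> i /Nb ->; rewrite scaler0.
- by move=> i /Na ->; rewrite scaler0.
rewrite negexp_vmul_vac; case E : (a + b) => [n|n]; last by rewrite scaler0.
rewrite scaler_sumr; apply: eq_bigr => k _.
rewrite scalerA exprnP -expfzDr // /N [- a + _]addrC (_ : a + (k%:Z - a) = k%:Z); last by lia.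
by rewrite (_ : b - (k%:Z - a) = n%:Z - k%:Z); last by lia.
Qed.

(** Propagation from the vacuum to the whole Fock space, one mode at a time. *)
Lemma vertex_commutator a b v :
  vc S a (vc X b v) - phi *: vc X b (vc S a v) =
  \sum_(x <- rs) (x.1 * x.2 ^ (- a)) *: vc (vmul (vscale x.2 S) X) (a + b) v.
Proof.
move: v a b.
(* Moving [H_r] to the left shifts [a] or [b] by [r] on the left side. On the right side the bracket
   with [:S(xz)X(z):] is [x^r A + B], and [x^r] is exactly what replacing [a] by [a - r] does to
   [x^(-a)]. *)
have step H r v : r != 0 ->
    (forall a b, vc S a (vc X b v) - phi *: vc X b (vc S a v) =
      \sum_(x <- rs) (x.1 * x.2 ^ (- a)) *: vc (vmul (vscale x.2 S) X) (a + b) v) ->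
    forall a b, vc S a (vc X b (md H r v)) - phi *: vc X b (vc S a (md H r v)) =
      \sum_(x <- rs) (x.1 * x.2 ^ (- a)) *: vc (vmul (vscale x.2 S) X) (a + b) (md H r v).
  move=> r0 IH a b.
  set A := brk d H S r; set B := brk d H X r.
  rewrite !vcoef_mode // -/A -/B !vcoefB (vcoefZ _ _ A) (vcoefZ _ _ B) !vcoef_mode // -/A -/B.
  have key (w1 w2 s1 s2 t1 t2 : V) :
      w1 - A *: s1 - B *: t1 - phi *: (w2 - B *: t2 - A *: s2) =
      w1 - phi *: w2 - A *: (s1 - phi *: s2) - B *: (t1 - phi *: t2).
    rewrite !scalerBr !scalerA (mulrC A) (mulrC B) [_ - _ - (phi * A) *: _]addrAC.
    by rewrite !opprD !opprK addrACA [X in X + _]addrACA.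
  have mdB w1 w2 : md H r w1 - phi *: md H r w2 = md H r (w1 - phi *: w2).
    by rewrite linearB (linearZZ (md H r)).
  rewrite key mdB.
  rewrite !IH (linear_sum (md H r)) !scaler_sumr -!sumrB big_seq [RHS]big_seq.
  apply: eq_bigr => x /rs0 x0; set Y := vmul _ _.
  rewrite (linearZZ (md H r) (x.1 * _)) vcoef_mode // [brk d H Y r]brk_vmulr brk_vscaler -/A -/B.
  have -> : a - r + b = a + b - r by lia.
  have -> : a + (b - r) = a + b - r by lia.
  move: (vc Y (a + b - r) v) (md H r (vc Y (a + b) v)) => Z W.
  rewrite opprB expfzDr // scalerBr -[LHS]addrA -opprD !scalerA -scalerDl.
  by congr (_ - _ *: _); ring.
apply: (@fock_ind _ _ _ _ _ fk (fun v => forall a b,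
  vc S a (vc X b v) - phi *: vc X b (vc S a v) =
  \sum_(x <- rs) (x.1 * x.2 ^ (- a)) *: vc (vmul (vscale x.2 S) X) (a + b) v)).
- exact: commutator_vac.
- move=> x v w hv hw a b; rewrite !vcoef_linear.
  have lin (c : R[i]) (y z : V) : c *: (x *: y + z) = x *: (c *: y) + c *: z.
    by rewrite scalerDr !scalerA mulrC.
  under eq_bigr do rewrite vcoef_linear lin.
  by rewrite big_split /= -scaler_sumr -hv -hw lin opprD addrACA -scalerBr.
- by move=> j r v jl r0; apply: step; lia.
- by move=> j r v jl r0; apply: step; lia.
Qed.

End Commutator.
End Fock.
End Vertex.

(** * Scalar exponential series and partial fractions *)

Section ExpSeq.
Variable K : fieldType.
Implicit Types (c F : nat -> K) (x y : K).

(* F is the sequence of coefficients of exp(sum_(r > 0) c_r z^r / r). *)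
Definition is_exp c F : Prop :=
  F 0%N = 1 /\ forall n, n%:R * F n = \sum_(r < n.+1) c r * F (n - r)%N.

Lemma is_expM c c' F F' : is_exp c F -> is_exp c' F' ->
  is_exp (fun r => c r + c' r) (fun n => \sum_(i < n.+1) F i * F' (n - i)%N).
Proof.
move=> [F0 FE] [F'0 F'E]; split=> [|n]; first by rewrite big_ord1 F0 mul1r.
transitivity (\sum_(i < n.+1) \sum_(r < i.+1) c r * F (i - r)%N * F' (n - r - (i - r))%N +
              \sum_(i < n.+1) \sum_(r < (n - i).+1) c' r * (F i * F' (n - i - r)%N)).
  rewrite mulr_sumr -big_split; apply: eq_bigr => i _ /=.
  rewrite -{1}(subnKC (leq_ord i)) natrD mulrDl mulrA FE mulr_suml mulrCA F'E mulr_sumr.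
  congr (_ + _); apply: eq_bigr => r _; last by rewrite mulrCA.
  by congr (_ * F' _); have := ltn_ord r; have := ltn_ord i; lia.
rewrite (exchange_big_tri n (fun i r => c' r * (F i * F' (n - i - r)%N))).
rewrite (big_tri_diag n (fun r s => c r * F s * F' (n - r - s)%N)) -big_split.
apply: eq_bigr => r _ /=; rewrite mulrDl !mulr_sumr; congr (_ + _).
  by apply: eq_bigr => s _; rewrite mulrA.
by apply: eq_bigr => s _; rewrite subnAC.
Qed.

(* (1 - x y z) / (1 - x z) = y + (1 - y) / (1 - x z) *)
Definition frac1 x y n : K := (n == 0%N)%:R * y + (1 - y) * x ^+ n.

(** This is the logarithm [log (1 - xyz) - log (1 - xz)]. A contraction of the form [x^r - (yx)^r]
    therefore means one simple pole with residue coefficient [1 - y] and value [y] at infinity. *)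
Lemma frac1_is_exp x y : is_exp (fun r => x ^+ r - (y * x) ^+ r) (frac1 x y).
Proof.
split=> [|n]; first by rewrite /frac1 mul1r mulr1 addrC subrK.
have E k : \sum_(r < k.+1) (1 - y ^+ r) * (1 - y) + y * (1 - y ^+ k) = k%:R * (1 - y).
  elim: k => [|k IH]; first by rewrite big_ord1 expr0 subrr mulr0 !mul0r addr0.
  rewrite big_ord_recr /= -[k.+1%:R]natr1 [RHS]mulrDl -IH exprS.
  by move: (\sum_(_ < _) _) => s; ring.
rewrite big_ord_recr /= subnn.
transitivity (x ^+ n * (\sum_(r < n.+1) (1 - y ^+ r) * (1 - y) + y * (1 - y ^+ n))).
  by rewrite E /frac1; case: n => [|n] /=; ring.
rewrite big_ord_recr /= mulrDr mulrDr -addrA; congr (_ + _).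
  rewrite mulr_sumr; apply: eq_bigr => r _; rewrite /frac1.
  have rn := ltn_ord r; have -> : (n - r == 0)%N = false by lia.
  rewrite -{1}(subnK (ltnW rn)) exprD exprMn mulr0n; ring.
by rewrite /frac1 /= exprMn; ring.
Qed.

(** The coefficient of [1 / (1 - x z)] in the product of the two fractions: [1 - y] times the value
    of the second fraction at [z = 1/x]. *)
Definition frac2_res x y x' y' : K := (1 - y) * (y' + (1 - y') * x / (x - x')).

Lemma frac2E x y x' y' n : x != x' ->
  \sum_(i < n.+1) frac1 x y i * frac1 x' y' (n - i)%N =
  (n == 0%N)%:R * (y * y') + frac2_res x y x' y' * x ^+ n + frac2_res x' y' x y * x' ^+ n.
Proof.
move=> xx'; have nz : x - x' != 0 by rewrite subr_eq0.
have nz' : x' - x != 0 by rewrite subr_eq0 eq_sym.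
transitivity ((n == 0%N)%:R * (y * y') + y * (1 - y') * x' ^+ n + (1 - y) * y' * x ^+ n +
   (1 - y) * (1 - y') * \sum_(i < n.+1) x ^+ i * x' ^+ (n - i)).
  rewrite mulr_sumr.
  case: n => [|n]; first by rewrite !big_ord1 /frac1 /=; ring.
  rewrite big_ord_recl big_ord_recr [in RHS]big_ord_recl [in RHS]big_ord_recr /=.
  rewrite (eq_bigr (fun i : 'I_n => (1 - y) * (1 - y') * (x ^+ bump 0 i * x' ^+ (n.+1 - bump 0 i)))).
    by rewrite /frac1 /bump add1n !subnn !subn0 /=; move: (\sum_(_ < _) _) => s; ring.
  move=> i _; rewrite /frac1 /bump /= (_ : (n.+1 - (1 + i) == 0)%N = false); last by have := ltn_ord i; lia.
  by rewrite !mulr0n; ring.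
have -> : \sum_(i < n.+1) x ^+ i * x' ^+ (n - i) = (x ^+ n.+1 - x' ^+ n.+1) / (x - x').
  apply: (canRL (mulfK nz)); rewrite mulrC subrXX; congr (_ * _).
  by rewrite (reindex_inj rev_ord_inj) /=; apply: eq_bigr => i _; rewrite subSS subKn ?leq_ord.
by rewrite /frac2_res !exprS; field; rewrite nz nz'.
Qed.


End ExpSeq.

(** The factor [r] removes the [1/r] of the boson brackets, so that [cc] is the sequence fed to
    [is_exp]. It is locked because only its algebraic rules are used from here on. *)
HB.lock Definition cc (R : realType) (d : datum R) (X Y : vertex R) (r : int) : R[i] :=
  r%:~R * brk d X Y r.

Lemma ccE (R : realType) (d : datum R) (X Y : vertex R) r :
  cc d X Y r = r%:~R * brk d X Y r.
Proof. by rewrite cc.unlock. Qed.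

(** * Colours and the consequences of [q_1 q_2 q_3 = 1] *)

Section Colors.
Variables (R : realType) (d : datum R).
Hypothesis lnq0 : \sum_(x < 3) lnq d x = 0.

Lemma all_colors_perm x y z : all_colors x y z -> perm_eq [:: x; y; z] (enum 'I_3).
Proof.
move=> xyz; have /= [] := @uniq_min_size _ [:: x; y; z] (enum 'I_3) xyz.
- by move=> w _; rewrite mem_enum.
- by rewrite size_enum_ord.
- by move=> _ H; apply: uniq_perm; rewrite ?enum_uniq.
Qed.

Lemma prod_colors (K : comNzRingType) (f : color -> K) x y z : all_colors x y z ->
  \prod_(w < 3) f w = f x * f y * f z.
Proof.
move=> /all_colors_perm xyz; rewrite -big_enum /= -(perm_big _ xyz) /=.
by rewrite !big_cons big_nil mulr1 mulrA.
Qed.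

Lemma sum_colors x y z : all_colors x y z -> lnq d x + lnq d y + lnq d z = 0.
Proof.
move=> /all_colors_perm xyz; rewrite -lnq0 -[RHS]big_enum /= -(perm_big _ xyz) /=.
by rewrite !big_cons big_nil addr0 addrA.
Qed.

Lemma cycl_colors x y z : cycl x y z -> all_colors x y z.
Proof.
by case/andP=> /eqP-> /eqP->; rewrite /all_colors; case: x => [[|[|[|]]]].
Qed.

Lemma sh_neq0 x : sh d x != 0. Proof. exact: cexp_neq0. Qed.
Lemma s_sh x : s_ d x = sh d x ^+ 2. Proof. by rewrite sh2. Qed.
Lemma q_sh x : q_ d x = sh d x ^+ 4. Proof. by rewrite -s2 -sh2 -exprM. Qed.
Lemma s_neq0 x : s_ d x != 0. Proof. exact: cexp_neq0. Qed.
Lemma q_neq0 x : q_ d x != 0. Proof. exact: cexp_neq0. Qed.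

Lemma sh_colors x y z : all_colors x y z -> sh d x * sh d y * sh d z = 1.
Proof.
move=> /sum_colors xyz; rewrite /sh /qpow -!cexpD -!mulrDr xyz mulr0; exact: cexp0.
Qed.

Lemma exprz_AC (K : fieldType) (x : K) n r : (x ^+ n) ^ r = (x ^ r) ^+ n.
Proof. by rewrite exprnP exprz_exp mulrC -exprz_exp. Qed.

Lemma sh_colorsX x y z r : all_colors x y z -> sh d x ^ r * sh d y ^ r * sh d z ^ r = 1.
Proof.
move=> xyz; rewrite -!exprzMl ?unitfE ?mulf_neq0 ?sh_neq0 // sh_colors //.
exact: exp1rz.
Qed.

Lemma kappaE x y z r : all_colors x y z ->
  kappa d r = (1 - (sh d x ^ r) ^+ 4) * (1 - (sh d y ^ r) ^+ 4) * (1 - (sh d z ^ r) ^+ 4).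
Proof. by move=> xyz; rewrite /kappa (prod_colors _ xyz) !q_sh !exprz_AC. Qed.

Lemma colors_shift x : all_colors x (x + 1) (x + 1 + 1).
Proof. by apply: cycl_colors; rewrite /cycl !eqxx. Qed.

(** Each factor is [1 - q^(-r) = - (1 - q^r) / q^r]; there are three of them and the denominators
    multiply to 1. *)
Lemma kappaN r : kappa d (- r) = - kappa d r.
Proof.
rewrite !(kappaE _ (colors_shift 0)) -!invr_expz.
have := sh_colorsX r (colors_shift 0).
have nz x : sh d x ^ r != 0 by rewrite expfz_neq0 // sh_neq0.
move: (nz 0) (nz (0 + 1)) (nz (0 + 1 + 1)) => {nz}.
move: (sh d (0 + 1 + 1) ^ r) (sh d (0 + 1) ^ r) (sh d 0 ^ r) => z y x x0 y0 z0 xyz.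
transitivity (- ((1 - x ^+ 4) * (1 - y ^+ 4) * (1 - z ^+ 4)) / (x * y * z) ^+ 4).
  by field; rewrite x0 y0 z0.
by rewrite xyz expr1n divr1.
Qed.

Lemma boson_commN j r : boson_comm d j (- r) = - boson_comm d j r.
Proof.
rewrite /boson_comm; case: ifP => _; last first.
  by rewrite !normrN mulrNz invrN mulrN.
rewrite kappaN mulrNz !invrN opprK mulNr; congr (- (_ * _)).
by rewrite mulrN -mulNr opprB.
Qed.

(** One function of [r != 0] thus encodes both orders of contraction: its positive part gives [F],
    its negative part gives [G]. *)
Lemma ccC X Y r : cc d X Y (- r) = cc d Y X r.
Proof.
rewrite !ccE /brk mulrNz mulNr -mulrN -sumrN; congr (_ * _); apply: eq_bigr => j _.
by rewrite opprK boson_commN mulrN opprK mulrAC [osc Y j r * _]mulrC mulrAC.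
Qed.

End Colors.

Lemma big_pair (I : Type) (V : nmodType) (x y : I) (f : I -> V) :
  \sum_(i <- [:: x; y]) f i = f x + f y.
Proof. by rewrite !big_cons big_nil addr0. Qed.

(** * Commutators with zero, one or two poles *)

Section Commute.
Variables (R : realType) (d : datum R).
Hypothesis lnq0 : \sum_(x < 3) lnq d x = 0.
Variables (V : lmodType R[i]) (h : nat -> int -> V -> V) (vac : V).
Hypothesis fk : is_fock d h vac.
Implicit Types (X Y S A : vertex R).
Local Notation vc := (vcoef d h).

Definition eq_osc X Y := forall j r, (1 <= j <= (ell d).+1)%N -> r != 0 ->
  osc X j r = osc Y j r.

Lemma vcoef_eq_osc X Y n v : eq_osc X Y ->
  pref Y *: vc X n v = pref X *: vc Y n v.
Proof.
move=> XY.
have mE r w : r != 0 -> mode_op d h X r w = mode_op d h Y r w.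
  move=> r0; rewrite /mode_op big_nat [RHS]big_nat; apply: eq_bigr => j jl.
  by rewrite XY.
rewrite /vcoef scalerA mulrC -scalerA; congr (_ *: (_ *: _)).
apply: eq_fsbigr => m _; case: (n + m%:Z) => // k.
rewrite (@exp_coef_ext _ _ (fun r => mode_op d h X r%:Z) (fun r => mode_op d h Y r%:Z)); last by move=> r w r0; apply: mE; lia.
by apply: exp_coef_ext => r w r0; apply: mE; lia.
Qed.

Lemma vcoef_pref X Y x n v : osc Y = osc X -> pref Y = x * pref X ->
  vc Y n v = x *: vc X n v.
Proof. by move=> e p; rewrite /vcoef /mode_op e p scalerA. Qed.

(* [S_a, X_b] with X on the source and X' on the target module *)
Definition vcomm S a X X' b v : V := vc S a (vc X b v) - vc X' b (vc S a v).

Lemma posz_neq0 (r : nat) : (0 < r)%N -> r%:Z != 0. Proof. by lia. Qed.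

Lemma natr_cc_is_exp X Y (F : nat -> R[i]) (c : nat -> R[i]) :
  c 0%N = 0 -> (forall r, (0 < r)%N -> cc d X Y r%:Z = c r) -> is_exp c F ->
  F 0%N = 1 /\ forall n, n%:R * F n = \sum_(r < n.+1) r%:R * brk d X Y r%:Z * F (n - r)%N.
Proof.
move=> c0 cE [F0 FE]; split=> // n; rewrite FE; apply: eq_bigr => r _.
case: (posnP r) => [->|/cE <-]; first by rewrite c0 !mul0r.
by rewrite ccE.
Qed.

Lemma vcomm_eq0 S X X' a b v : osc X' = osc X -> pref X' = pref X ->
  (forall r, r != 0 -> cc d S X r = 0) -> vcomm S a X X' b v = 0.
Proof.
move=> oX pX SX; pose F (n : nat) : R[i] := (n == 0%N)%:R.
have eF : is_exp (fun _ => 0) F.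
  by split=> // n; rewrite big1 => [|r _]; rewrite ?mul0r //; case: n => [|n]; rewrite ?mul0r ?mulr0.
have [F0 FE] := natr_cc_is_exp (X := S) (Y := X) erefl (fun r r0 => SX r%:Z (posz_neq0 r0)) eF.
have XS r : (0 < r)%N -> cc d X S r%:Z = 0 by move=> r0; rewrite -ccC // SX //; lia.
have [_ GE] := natr_cc_is_exp (X := X) (Y := S) erefl XS eF.
have H := @vertex_commutator _ d _ _ _ fk S X 1 F F [::].
rewrite /vcomm (vcoef_pref (x := 1) _ _ oX) ?mul1r //.
by rewrite H ?big_nil // => n; rewrite big_nil ?mul1r ?mulr1 ?addr0 ?subr0.
Qed.

(** The two orders contract to [(1 - xyt) / (1 - xt)] and to the same fraction with [x], [y], [t]
    inverted. They are expansions of one rational function up to the factor [y], and this is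
    precisely the factor by which the prefactor of [X] changes under the screening. *)
Lemma vcomm1 S X X' x y a b v : x != 0 -> y != 0 ->
  osc X' = osc X -> pref X' = y * pref X ->
  (forall r, r != 0 -> cc d S X r = x ^ r - (y * x) ^ r) ->
  vcomm S a X X' b v = ((1 - y) * x ^ (- a)) *: vc (vmul (vscale x S) X) (a + b) v.
Proof.
move=> x0 y0 oX pX SX.
have [F0 FE] := natr_cc_is_exp (X := S) (Y := X) (c := fun r => x ^+ r - (y * x) ^+ r) (subrr _) (fun r r0 => SX r%:Z (posz_neq0 r0)) (frac1_is_exp x y).
have XS r : (0 < r)%N -> cc d X S r%:Z = x^-1 ^+ r - (y^-1 * x^-1) ^+ r.
  move=> r0; rewrite -ccC // SX; last by lia.
  by rewrite -!exprz_inv invfM.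
have [G0 GE] := natr_cc_is_exp (X := X) (Y := S) (c := fun r => x^-1 ^+ r - (y^-1 * x^-1) ^+ r) (subrr _) XS (frac1_is_exp x^-1 y^-1).
rewrite /vcomm (vcoef_pref _ _ oX pX).
rewrite (@vertex_commutator _ d _ _ _ fk S X y (frac1 x y) (frac1 x^-1 y^-1) [:: (1 - y, x)]) ?big_seq1 //.
- by move=> z; rewrite inE => /eqP->.
- by move=> n; rewrite big_seq1 /frac1.
- move=> n; rewrite big_seq1 /frac1 /= -exprz_inv -exprnP.
  by move: (_ ^+ n) (_%:R) => w e; field.
Qed.

(** Product of two profiles of the previous kind; [x != x'] keeps the poles simple, and the
    prefactor now changes by [y y']. *)
Lemma vcomm2 S X X' x y x' y' a b v : x != 0 -> y != 0 -> x' != 0 -> y' != 0 -> x != x' ->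
  osc X' = osc X -> pref X' = y * y' * pref X ->
  (forall r, r != 0 -> cc d S X r = x ^ r - (y * x) ^ r + (x' ^ r - (y' * x') ^ r)) ->
  vcomm S a X X' b v =
    (frac2_res x y x' y' * x ^ (- a)) *: vc (vmul (vscale x S) X) (a + b) v +
    (frac2_res x' y' x y * x' ^ (- a)) *: vc (vmul (vscale x' S) X) (a + b) v.
Proof.
move=> x0 y0 x'0 y'0 xx' oX pX SX.
have xxV : x^-1 != x'^-1 by rewrite (inj_eq invr_inj).
have z0 (z w : R[i]) : z ^+ 0 - (w * z) ^+ 0 = 0 by rewrite subrr.
pose F n := \sum_(i < n.+1) frac1 x y i * frac1 x' y' (n - i)%N.
pose G n := \sum_(i < n.+1) frac1 x^-1 y^-1 i * frac1 x'^-1 y'^-1 (n - i)%N.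
have [F0 FE] := natr_cc_is_exp (X := S) (Y := X) (F := F)
  (c := fun r => x ^+ r - (y * x) ^+ r + (x' ^+ r - (y' * x') ^+ r)) (etrans (congr2 +%R (z0 _ _) (z0 _ _)) (addr0 0))
  (fun r r0 => SX r%:Z (posz_neq0 r0)) (is_expM (frac1_is_exp x y) (frac1_is_exp x' y')).
have XS r : (0 < r)%N -> cc d X S r%:Z = x^-1 ^+ r - (y^-1 * x^-1) ^+ r + (x'^-1 ^+ r - (y'^-1 * x'^-1) ^+ r).
  move=> r0; rewrite -ccC // SX; last by lia.
  by rewrite -!exprz_inv !invfM.
have [G0 GE] := natr_cc_is_exp (X := X) (Y := S) (F := G)
  (c := fun r => x^-1 ^+ r - (y^-1 * x^-1) ^+ r + (x'^-1 ^+ r - (y'^-1 * x'^-1) ^+ r)) (etrans (congr2 +%R (z0 _ _) (z0 _ _)) (addr0 0))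
  XS (is_expM (frac1_is_exp x^-1 y^-1) (frac1_is_exp x'^-1 y'^-1)).
pose rs := [:: (frac2_res x y x' y', x); (frac2_res x' y' x y, x')].
have FR n : F n = (n == 0%N)%:R * (y * y') + \sum_(z <- rs) z.1 * z.2 ^ n.
  by rewrite /F frac2E // !big_cons big_nil addr0 addrA.
have GR n : y * y' * G n = (n == 0%N)%:R - \sum_(z <- rs) z.1 * z.2 ^ (- n%:Z).
  rewrite /G frac2E // !big_cons big_nil addr0 /= -!exprz_inv /frac2_res -!exprnP.
  have nz : x - x' != 0 by rewrite subr_eq0.
  have nz' : x' - x != 0 by rewrite subr_eq0 eq_sym.
  by move: (x^-1 ^+ n) (x'^-1 ^+ n) (_%:R) => w w' e; field; rewrite ?x0 ?x'0 ?y0 ?y'0 ?nz ?nz'.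
have rs0 z : z \in rs -> z.2 != 0 by rewrite !inE => /orP[] /eqP->.
rewrite /vcomm (vcoef_pref _ _ oX pX).
apply: etrans (vertex_commutator fk rs0 F0 FE G0 GE FR GR a b v) _.
exact: big_pair.
Qed.

End Commute.

(** * Nonvanishing of denominators for generic parameters *)

Section Generic.
Variables (R : realType) (d : datum R).
Hypothesis lnq0 : \sum_(x < 3) lnq d x = 0.
Hypothesis gen : generic d.

Lemma sh_expz_neq0 x (r : int) : sh d x ^ r != 0.
Proof. by rewrite expfz_neq0 // sh_neq0. Qed.

Lemma sh_expz4_neq1 x (r : int) : r != 0 -> 1 - (sh d x ^ r) ^+ 4 != 0.
Proof.
by move=> r0; rewrite -exprz_AC -q_sh subr_eq0 eq_sym q_expz_neq1.
Qed.

Lemma sh_expz8_neq1 x (r : int) : r != 0 -> 1 - (sh d x ^ r) ^+ 8 != 0.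
Proof.
move=> r0; have r0' : r * 2 != 0 by lia.
by have := sh_expz4_neq1 x r0'; rewrite -exprz_exp -exprnP -exprM.
Qed.

Lemma sh_expz2_neq1 x (r : int) : r != 0 -> 1 - (sh d x ^ r) ^+ 2 != 0.
Proof.
move=> /(sh_expz4_neq1 x); apply: contraNN; rewrite !subr_eq0 => /eqP e.
by rewrite -[4%N]/(2 * 2)%N exprM -e expr1n.
Qed.

Lemma sh_expz2_neqN1 x (r : int) : r != 0 -> 1 + (sh d x ^ r) ^+ 2 != 0.
Proof.
move=> /(sh_expz4_neq1 x); apply: contraNN; rewrite addr_eq0 => /eqP e.
by rewrite -[4%N]/(2 * 2)%N exprM -[X in X ^+ 2]opprK -e sqrrN expr1n subrr.
Qed.

(** After elimination of the third one, an equality between two of the [q] becomes a nontrivial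
    monomial relation between [q_1] and [q_2]. *)
Lemma q_inj x y : x != y -> q_ d x != q_ d y.
Proof.
have q3 : q_ d 0 * q_ d 1 * q_ d (1 + 1) = 1.
  have := sh_colors lnq0 (colors_shift 0); rewrite !add0r !q_sh -!exprMn => ->.
  exact: expr1n.
have q0 z : q_ d z != 0 by exact: q_neq0.
have n01 : q_ d 0 != q_ d 1.
  apply/eqP => e; suff: 1 = 0 :> int /\ -1 = 0 :> int by case.
  apply: gen.
  by rewrite expr1z exprN1 e mulfV.
have n02 : q_ d 0 != q_ d (1 + 1).
  apply/eqP => e; suff: 2 = 0 :> int /\ 1 = 0 :> int by case.
  apply: gen.
  by rewrite expr1z -exprnP expr2 -mulrA mulrC -q3 -e.
have n12 : q_ d 1 != q_ d (1 + 1).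
  apply/eqP => e; suff: 1 = 0 :> int /\ 2 = 0 :> int by case.
  apply: gen.
  by rewrite expr1z -exprnP expr2 mulrA -q3 -e.
have c3 (z : color) : [|| z == 0, z == 1 | z == 1 + 1] by case: z => [[|[|[|]]]].
by case/or3P: (c3 x) => /eqP->; case/or3P: (c3 y) => /eqP->; rewrite ?eqxx // => _; rewrite eq_sym.
Qed.

Lemma s_inj x y : x != y -> s_ d x != s_ d y.
Proof. by move=> /q_inj; apply: contraNN => /eqP e; rewrite -!s2 e. Qed.

Lemma s_diff_expz x (r : int) : r != 0 ->
  s_ d x ^ r - s_ d x ^ (- r) = ((sh d x ^ r) ^+ 4 - 1) / (sh d x ^ r) ^+ 2.
Proof.
move=> r0; rewrite s_sh -invr_expz exprz_AC; field; exact: sh_expz_neq0.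
Qed.

End Generic.

(** * Cancellation between two terms linked by a root current *)

Section Cancel.
Variables (R : realType) (d : datum R).
Hypothesis lnq0 : \sum_(x < 3) lnq d x = 0.
Variables (V : lmodType R[i]) (h : nat -> int -> V -> V) (vac : V).
Hypothesis fk : is_fock d h vac.
Implicit Types (X Y S A : vertex R).
Local Notation vc := (vcoef d h).

Lemma cc_scr A X p r : cc d (scr_osc A p) X r = cc d A X r / (p ^ r - p ^ (- r)).
Proof.
rewrite !ccE /brk -mulrA mulr_suml; congr (_ * _); apply: eq_bigr => j _ /=.
by rewrite -!mulrA; congr (_ * _); rewrite mulrCA; congr (_ * _); rewrite mulrC.
Qed.

(* the vertex operator :S(x z) X(z): without its prefactor *)
Definition wave S x X := Vertex 1 (osc (vmul (vscale x S) X)).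

Lemma vcoef_wave S x X n v : pref S = 1 ->
  vc (vmul (vscale x S) X) n v = pref X *: vc (wave S x X) n v.
Proof.
move=> S1; rewrite -[LHS]scale1r -[1]/(pref (wave S x X)).
by rewrite (@vcoef_eq_osc _ d _ h _ (wave S x X)) //= S1 mul1r.
Qed.

Lemma vcomm1_wave S X X' x y a b v : pref S = 1 -> x != 0 -> y != 0 ->
  osc X' = osc X -> pref X' = y * pref X ->
  (forall r, r != 0 -> cc d S X r = x ^ r - (y * x) ^ r) ->
  vcomm d h S a X X' b v = ((1 - y) * x ^ (- a) * pref X) *: vc (wave S x X) (a + b) v.
Proof.
move=> S1 x0 y0 oX pX SX; rewrite (vcomm1 lnq0 fk a b v x0 y0 oX pX SX).
by rewrite (vcoef_wave x X _ _ S1) scalerA.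
Qed.

Lemma vcomm2_wave S X X' x y x' y' a b v : pref S = 1 ->
  x != 0 -> y != 0 -> x' != 0 -> y' != 0 -> x != x' ->
  osc X' = osc X -> pref X' = y * y' * pref X ->
  (forall r, r != 0 -> cc d S X r = x ^ r - (y * x) ^ r + (x' ^ r - (y' * x') ^ r)) ->
  vcomm d h S a X X' b v =
    (frac2_res x y x' y' * x ^ (- a) * pref X) *: vc (wave S x X) (a + b) v +
    (frac2_res x' y' x y * x' ^ (- a) * pref X) *: vc (wave S x' X) (a + b) v.
Proof.
move=> S1 x0 y0 x'0 y'0 xx' oX pX SX.
rewrite (vcomm2 lnq0 fk a b v x0 y0 x'0 y'0 xx' oX pX SX).
by congr (_ + _); rewrite vcoef_wave // scalerA.
Qed.

Lemma vcoef_wave_eq S x X x' X' n v :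
  eq_osc d (vmul (vscale x S) X) (vmul (vscale x' S) X') ->
  vc (wave S x X) n v = vc (wave S x' X') n v.
Proof.
by move=> e; have := @vcoef_eq_osc _ d _ h (wave S x X) (wave S x' X') n v e; rewrite !scale1r.
Qed.

(** On oscillators, [A(gz)] is [:X(z)Y(z)^(-1):]; [g] records the shift at which the root current
    links the two terms. *)
Definition root_of A g X Y := forall j (r : int), (1 <= j <= (ell d).+1)%N -> r != 0 ->
  osc A j r * g ^ (- r) = osc X j r - osc Y j r.

(** From [A(gz) = k :S(p^(-1)gz) S(pgz)^(-1):] and [A(gz) = :X(z)Y(z)^(-1):] up to scalars,
    [:S(pgz)X(z):] and [:S(p^(-1)gz)Y(z):] have the same oscillators. This identifies the residues
    of neighbouring terms. *)
Lemma scr_wave A p g X Y : p != 0 -> g != 0 ->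
  (forall r : int, r != 0 -> p ^ r - p ^ (- r) != 0) -> root_of A g X Y ->
  eq_osc d (vmul (vscale (p * g) (scr_osc A p)) X) (vmul (vscale (p^-1 * g) (scr_osc A p)) Y).
Proof.
move=> p0 g0 Dp AXY j r jl r0 /=; have /eqP := AXY j r jl r0.
rewrite eq_sym subr_eq => /eqP ->; rewrite !exprzMl ?unitfE ?invr_neq0 // exprz_inv opprK.
have := Dp r r0; move: (osc A j r) (osc Y j r) (g ^ (- r)) (p ^ r) (p ^ (- r)) => a y g' P P' D.
by field.
Qed.

Section Pair.
Variables (A X Y X' Y' : vertex R) (p g x y : R[i]) (k1 k2 : R[i]) (m : int).
Hypotheses (p0 : p != 0) (g0 : g != 0) (x0 : x != 0) (y0 : y != 0).
Hypothesis Dp : forall r : int, r != 0 -> p ^ r - p ^ (- r) != 0.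
Hypothesis AXY : root_of A g X Y.
Hypotheses (oX : osc X' = osc X) (pX : pref X' = x * pref X).
Hypotheses (oY : osc Y' = osc Y) (pY : pref Y' = y * pref Y).
Hypothesis AX : forall r : int, r != 0 ->
  cc d A X r / (p ^ r - p ^ (- r)) = (p * g) ^ r - (x * (p * g)) ^ r.
Hypothesis AY : forall r : int, r != 0 ->
  cc d A Y r / (p ^ r - p ^ (- r)) = (p^-1 * g) ^ r - (y * (p^-1 * g)) ^ r.
Hypothesis cancel : k1 * pref X * (1 - x) * p ^ (m + 1) +
  k2 * pref Y * (1 - y) * p ^ (- (m + 1)) = 0.

(** [X] has its pole at [pg] and [Y] at [p^(-1)g], where the residues are multiples of one operator
    by [scr_wave]. For the mode [-1 - m] of [S] the pole enters to the power [m + 1], which leaves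
    the scalar identity [cancel] up to a power of [g]. *)
Lemma pair_cancel b v :
  k1 *: vcomm d h (scr_osc A p) (-1 - m) X X' b v +
  k2 *: vcomm d h (scr_osc A p) (-1 - m) Y Y' b v = 0.
Proof.
have pV0 : p^-1 != 0 by rewrite invr_neq0.
have [pg0 pVg0] : p * g != 0 /\ p^-1 * g != 0 by rewrite !mulf_neq0.
have S1 : pref (scr_osc A p) = 1 by [].
have SX r : r != 0 -> cc d (scr_osc A p) X r = (p * g) ^ r - (x * (p * g)) ^ r.
  by move=> r0; rewrite cc_scr AX.
have SY r : r != 0 -> cc d (scr_osc A p) Y r = (p^-1 * g) ^ r - (y * (p^-1 * g)) ^ r.
  by move=> r0; rewrite cc_scr AY.
have HX := vcomm1_wave (-1 - m) b v S1 pg0 x0 oX pX SX.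
have HY := vcomm1_wave (-1 - m) b v S1 pVg0 y0 oY pY SY.
have HW := vcoef_wave_eq (-1 - m + b) v (scr_wave p0 g0 Dp AXY).
rewrite HX HY HW !scalerA -scalerDl.
rewrite [X in X *: _](_ : _ = 0) ?scale0r //.
have -> : - (-1 - m) = m + 1 by lia.
rewrite !exprzMl ?unitfE // exprz_inv -[RHS](mul0r (g ^ (m + 1))) -cancel.
by move: (p ^ (m + 1)) (p ^ (- (m + 1))) (g ^ (m + 1)) => P P' G; ring.
Qed.
End Pair.


End Cancel.

Section Pairs.
Variables (R : realType) (d : datum R).
Hypothesis lnq0 : \sum_(x < 3) lnq d x = 0.
Hypothesis gen : generic d.
Variables (V : lmodType R[i]) (h : nat -> int -> V -> V) (vac : V).
Hypothesis fk : is_fock d h vac.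
Implicit Types (X Y S A : vertex R).
Local Notation vc := (vcoef d h).

Lemma s_diff_neq0 x (r : int) : r != 0 -> s_ d x ^ r - s_ d x ^ (- r) != 0.
Proof.
move=> r0; rewrite s_diff_expz // mulf_neq0 //.
  by rewrite -opprB oppr_eq0 sh_expz4_neq1.
by rewrite invr_neq0 // expf_neq0 // sh_expz_neq0.
Qed.

Lemma expz_m (p : R[i]) (m : int) : p != 0 ->
  (p ^ (m + 1) = p ^ m * p) * (p ^ (- (m + 1)) = (p ^ m)^-1 / p) * (p ^ (- (2 * m)) = (p ^ m) ^- 2).
Proof.
move=> p0; split; [split|]; first by rewrite expfzDr.
  by rewrite -invr_expz expfzDr // invfM.
by rewrite -invr_expz mulrC -exprz_exp.
Qed.

Lemma s_expz x (r : int) : s_ d x ^ r = (sh d x ^ r) ^+ 2.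
Proof. by rewrite s_sh exprz_AC. Qed.

Lemma q_expz x (r : int) : q_ d x ^ r = (sh d x ^ r) ^+ 4.
Proof. by rewrite q_sh exprz_AC. Qed.

Lemma mul_expz (x y : R[i]) (r : int) : x != 0 -> y != 0 -> (x * y) ^ r = x ^ r * y ^ r.
Proof. by move=> x0 y0; rewrite exprzMl ?unitfE. Qed.

Lemma expzV (x : R[i]) (r : int) : x^-1 ^ r = (x ^ r)^-1.
Proof. by rewrite exprz_inv invr_expz. Qed.

Lemma prod3_inv (x y z : R[i]) : x * y * z = 1 -> z = (x * y)^-1.
Proof.
move=> xyz; have xy0 : x * y != 0.
  by apply: contra_eq_neq xyz => e; rewrite e mul0r eq_sym oner_neq0.
by apply: (mulfI xy0); rewrite mulfV.
Qed.

(** [kB d f] involves the two colours following [f] in cyclic order; naming them [e] and [x] costs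
    the sign [orient R e f]. *)
Lemma kB_orient e f x : all_colors e f x ->
  kB d f = orient R e f * (1 + s_ d f) * (s_ d x - s_ d e) / kappa d 1.
Proof.
move=> efx; have : (f == e + 1) && (x == f + 1) && (e == f + 1 + 1) || (f != e + 1) && (e == f + 1) && (x == f + 1 + 1).
  by move: efx; case: e f x => [[|[|[|//]]] ?] [[|[|[|//]]] ?] [[|[|[|//]]] ?].
rewrite /kB /orient => /orP[/andP[/andP[/[dup] fe -> /eqP->] /eqP<-] | /andP[/andP[/negPf-> /eqP<-] /eqP<-]].
  by rewrite mul1r.
by rewrite mulN1r mulNr -mulrN opprB.
Qed.

Section PairScreening.
Variables (A X Y X' Y' : vertex R) (g : R[i]) (e f : color) (m : int).
Hypotheses (g0 : g != 0) (AXY : root_of d A g X Y).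
Hypotheses (oX : osc X' = osc X) (oY : osc Y' = osc Y).
Hypothesis AX : forall r : int, r != 0 ->
  cc d A X r = - g ^ r * kappa d r / (1 - q_ d e ^ r).
Hypothesis AY : forall r : int, r != 0 ->
  cc d A Y r = g ^ r * q_ d f ^ r * kappa d r / (1 - q_ d f ^ r).

(** In [kappa_r] the factor of [e] is cancelled by [1 - q_e^r] and that of [x] by [p^r - p^(-r)]
    with [p = s_x]; the factor [1 - q_y^r] remains, so the pole has multiplier [q_y]. The colours
    [x] and [y] may be exchanged, which covers both screenings. *)
Lemma pair_bose x y b v : e = f -> all_colors e x y ->
  pref X' = q_ d y * pref X -> pref Y' = (q_ d y)^-1 * pref Y ->
  pref X = q_ d e * s_ d x ^ (- (2 * m)) * pref Y ->
  vcomm d h (scr_osc A (s_ d x)) (-1 - m) X X' b v +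
  vcomm d h (scr_osc A (s_ d x)) (-1 - m) Y Y' b v = 0.
Proof.
move=> ef exy pX pY XY; subst f.
have sx0 := s_neq0 d x.
have H := @pair_cancel _ d lnq0 _ h _ fk A X Y X' Y' (s_ d x) g (q_ d y) (q_ d y)^-1 1 1 m
  sx0 g0 (q_neq0 d y) _ (fun r r0 => s_diff_neq0 x r0) AXY oX pX oY pY.
rewrite -[X in X + _]scale1r -[X in _ + X]scale1r; apply: H; rewrite ?invr_neq0 ?q_neq0 //.
- move=> r r0; rewrite AX // (kappaE d r exy) s_diff_expz //.
  rewrite [(q_ d y * _) ^ r]mul_expz ?mulf_neq0 ?q_neq0 ?s_neq0 // mul_expz ?s_neq0 // s_expz !q_expz.
  have := sh_expz4_neq1 lnq0 gen e r0; have := sh_expz4_neq1 lnq0 gen x r0.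
  have := sh_colorsX lnq0 r exy; have := sh_expz_neq0 d x r.
  move: (sh d e ^ r) (sh d x ^ r) (sh d y ^ r) (g ^ r) => E F B G F0 EFB nF nE.
  have nF' : F ^+ 4 - 1 != 0 by rewrite -opprB oppr_eq0.
  by field; rewrite ?F0 ?nE ?nF'.
- move=> r r0; rewrite AY // (kappaE d r exy) s_diff_expz //.
  rewrite [((q_ d y)^-1 * _) ^ r]mul_expz ?mulf_neq0 ?invr_neq0 ?q_neq0 ?s_neq0 // mul_expz ?invr_neq0 ?s_neq0 // !expzV s_expz !q_expz.
  have := sh_expz4_neq1 lnq0 gen e r0; have := sh_expz4_neq1 lnq0 gen x r0.
  have := sh_colorsX lnq0 r exy; have := sh_expz_neq0 d x r; have := sh_expz_neq0 d e r.
  move: (sh d e ^ r) (sh d x ^ r) (sh d y ^ r) (g ^ r) => E F B G E0 F0 EFB nF nE.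
  have nF' : F ^+ 4 - 1 != 0 by rewrite -opprB oppr_eq0.
  by rewrite (prod3_inv EFB); field; rewrite ?F0 ?E0 ?nE ?nF'.
- rewrite XY !expz_m // !s_sh !q_sh.
  have := sh_colors lnq0 exy; have := sh_neq0 d x; have := sh_neq0 d e.
  have := expfz_neq0 m sx0; rewrite s_sh.
  move: (sh d e) (sh d x) (sh d y) (pref Y) ((_ ^+ 2) ^ m) => E F B w P P0 E0 F0 EFB.
  by rewrite (prod3_inv EFB); field; rewrite ?P0 ?F0 ?E0.
Qed.

(** Here [p = s_x] belongs to the third colour, so [X] keeps the factor of [f] and [Y] that of [e].
    The multipliers differ, and the unequal coefficients [b_e], [b_f] compensate for it. *)
Lemma pair_fermi x b v : all_colors e f x ->
  pref X' = q_ d f * pref X -> pref Y' = (q_ d e)^-1 * pref Y ->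
  pref X = s_ d e * s_ d f * s_ d x ^ (- (2 * m)) * pref Y ->
  b_ d e *: vcomm d h (scr_osc A (s_ d x)) (-1 - m) X X' b v +
  b_ d f *: vcomm d h (scr_osc A (s_ d x)) (-1 - m) Y Y' b v = 0.
Proof.
move=> efx pX pY XY.
have sx0 := s_neq0 d x.
have H := @pair_cancel _ d lnq0 _ h _ fk A X Y X' Y' (s_ d x) g (q_ d f) (q_ d e)^-1 (b_ d e) (b_ d f) m
  sx0 g0 (q_neq0 d f) _ (fun r r0 => s_diff_neq0 x r0) AXY oX pX oY pY.
apply: H; rewrite ?invr_neq0 ?q_neq0 //.
- move=> r r0; rewrite AX // (kappaE d r efx) s_diff_expz //.
  rewrite [(q_ d f * _) ^ r]mul_expz ?mulf_neq0 ?q_neq0 ?s_neq0 // mul_expz ?s_neq0 // s_expz !q_expz.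
  have := sh_expz4_neq1 lnq0 gen e r0; have := sh_expz4_neq1 lnq0 gen x r0.
  have := sh_colorsX lnq0 r efx; have := sh_expz_neq0 d x r.
  move: (sh d e ^ r) (sh d f ^ r) (sh d x ^ r) (g ^ r) => E F B G B0 EFB nB nE.
  have nB' : B ^+ 4 - 1 != 0 by rewrite -opprB oppr_eq0.
  by field; rewrite ?B0 ?nE ?nB'.
- move=> r r0; rewrite AY // (kappaE d r efx) s_diff_expz //.
  rewrite [((q_ d e)^-1 * _) ^ r]mul_expz ?mulf_neq0 ?invr_neq0 ?q_neq0 ?s_neq0 // mul_expz ?invr_neq0 ?s_neq0 // !expzV s_expz !q_expz.
  have := sh_expz4_neq1 lnq0 gen f r0; have := sh_expz4_neq1 lnq0 gen x r0.
  have := sh_colorsX lnq0 r efx; have := sh_expz_neq0 d f r; have := sh_expz_neq0 d x r.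
  move: (sh d e ^ r) (sh d f ^ r) (sh d x ^ r) (g ^ r) => E F B G B0 F0 EFB nB nF.
  have nB' : B ^+ 4 - 1 != 0 by rewrite -opprB oppr_eq0.
  have EE : E = (F * B)^-1 by apply: prod3_inv; rewrite mulrC mulrA.
  by rewrite EE; field; rewrite ?F0 ?B0 ?nF ?nB'.
- rewrite /b_ XY !expz_m // /t_ !s_sh !q_sh.
  have := sh_colors lnq0 efx; have := sh_neq0 d e; have := sh_neq0 d f.
  have := expfz_neq0 m sx0; rewrite s_sh.
  move: (\prod_(y < 3) _)^-1 (sh d e) (sh d f) (sh d x) (pref Y) ((_ ^+ 2) ^ m) => Q E F B w P P0 F0 E0 EFB.
  by rewrite (prod3_inv EFB); field; rewrite ?P0 ?F0 ?E0.
Qed.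

End PairScreening.
End Pairs.

(** * The linked pair of type C *)

Section Chains.
Variables (R : realType) (d : datum R).
Hypothesis lnq0 : \sum_(x < 3) lnq d x = 0.
Hypothesis gen : generic d.
Variables (V : lmodType R[i]) (h : nat -> int -> V -> V) (vac : V).
Hypothesis fk : is_fock d h vac.
Implicit Types (X Y S A : vertex R).
Local Notation vc := (vcoef d h).

Section TypeC.
Variables (A X Y X' Y' : vertex R) (e f x : color) (m : int).
Hypotheses (efx : all_colors e f x) (AXY : root_of d A 1 X Y).
Hypotheses (oX : osc X' = osc X) (oY : osc Y' = osc Y).
Hypothesis AX : forall r : int, r != 0 ->
  cc d A X r = - kappa d r * (1 + q_ d f ^ r) / (1 - q_ d e ^ r).
Hypothesis AY : forall r : int, r != 0 ->
  cc d A Y r = kappa d r * q_ d e ^ r * (1 + (q_ d f ^ r)^-1) / (1 - q_ d e ^ r).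

(** Division by [s_x^r - s_x^(-r)] leaves [(1 - q_f^r)(1 + q_f^r) = 1 - q_f^(2r)]: a single pole
    with multiplier [q_f^2]. *)
Lemma typeC_plus b v :
  pref X' = q_ d f ^+ 2 * pref X -> pref Y' = (q_ d f ^+ 2)^-1 * pref Y ->
  pref X = q_ d e * (q_ d f)^-1 * s_ d x ^ (- (2 * m)) * pref Y ->
  vcomm d h (scr_osc A (s_ d x)) (-1 - m) X X' b v +
  vcomm d h (scr_osc A (s_ d x)) (-1 - m) Y Y' b v = 0.
Proof.
move=> pX pY XY.
have sx0 := s_neq0 d x; have q0 := expf_neq0 2 (q_neq0 d f).
have H := @pair_cancel _ d lnq0 _ h _ fk A X Y X' Y' (s_ d x) 1 _ _ 1 1 m
  sx0 (oner_neq0 _) q0 _ (fun r r0 => s_diff_neq0 lnq0 gen x r0) AXY oX pX oY pY.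
rewrite -[X in X + _]scale1r -[X in _ + X]scale1r; apply: H; rewrite ?invr_neq0 //.
- move=> r r0; rewrite AX // (kappaE d r efx) s_diff_expz // mulr1.
  rewrite [(q_ d f ^+ 2 * _) ^ r]mul_expz // exprz_AC s_expz !q_expz.
  have := sh_expz4_neq1 lnq0 gen e r0; have := sh_expz4_neq1 lnq0 gen x r0.
  have := sh_expz_neq0 d x r.
  move: (sh d e ^ r) (sh d f ^ r) (sh d x ^ r) => E F B B0 nB nE.
  have nB' : B ^+ 4 - 1 != 0 by rewrite -opprB oppr_eq0.
  by field; rewrite ?B0 ?nE ?nB'.
- move=> r r0; rewrite AY // (kappaE d r efx) s_diff_expz // mulr1.
  rewrite [((q_ d f ^+ 2)^-1 * _) ^ r]mul_expz ?invr_neq0 // !expzV exprz_AC s_expz !q_expz.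
  have := sh_colorsX lnq0 r efx.
  have := sh_expz4_neq1 lnq0 gen e r0; have := sh_expz4_neq1 lnq0 gen x r0.
  have := sh_expz_neq0 d x r; have := sh_expz_neq0 d e r.
  move: (sh d e ^ r) (sh d f ^ r) (sh d x ^ r) => E F B E0 B0 nB nE EFB.
  have nB' : B ^+ 4 - 1 != 0 by rewrite -opprB oppr_eq0.
  have -> : F = (B * E)^-1 by apply: prod3_inv; rewrite -mulrA mulrC.
  by field; rewrite ?B0 ?E0 ?nE ?nB'.
- rewrite XY !expz_m // !s_sh !q_sh.
  have := sh_colors lnq0 efx; have := sh_neq0 d f; have := sh_neq0 d e.
  have := expfz_neq0 m sx0; rewrite s_sh.
  move: (sh d e) (sh d f) (sh d x) (pref Y) ((_ ^+ 2) ^ m) => E F B w P P0 E0 F0 EFB.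
  by rewrite (prod3_inv EFB); field; rewrite ?P0 ?F0 ?E0.
Qed.

(** With [p = s_f^2] the division removes the whole factor [(1 - q_f^r)(1 + q_f^r)] and leaves
    [1 - q_x^r]. *)
Lemma typeC_minus b v :
  pref X' = q_ d x * pref X -> pref Y' = (q_ d x)^-1 * pref Y ->
  pref X = q_ d e * (q_ d f)^-1 * (s_ d f ^+ 2) ^ (- (2 * m)) * pref Y ->
  vcomm d h (scr_osc A (s_ d f ^+ 2)) (-1 - m) X X' b v +
  vcomm d h (scr_osc A (s_ d f ^+ 2)) (-1 - m) Y Y' b v = 0.
Proof.
move=> pX pY XY.
have sf0 := expf_neq0 2 (s_neq0 d f).
have Dp (r : int) : r != 0 -> (s_ d f ^+ 2) ^ r - (s_ d f ^+ 2) ^ (- r) = ((sh d f ^ r) ^+ 8 - 1) / (sh d f ^ r) ^+ 4.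
  by move=> r0; rewrite -invr_expz s2 q_expz; field; exact: sh_expz_neq0.
have n8 (r : int) : r != 0 -> (sh d f ^ r) ^+ 8 - 1 != 0.
  by move=> r0; rewrite -opprB oppr_eq0 sh_expz8_neq1.
have Dp0 (r : int) : r != 0 -> (s_ d f ^+ 2) ^ r - (s_ d f ^+ 2) ^ (- r) != 0.
  by move=> r0; rewrite Dp // mulf_neq0 ?n8 // invr_neq0 // expf_neq0 // sh_expz_neq0.
have H := @pair_cancel _ d lnq0 _ h _ fk A X Y X' Y' (s_ d f ^+ 2) 1 _ _ 1 1 m
  sf0 (oner_neq0 _) (q_neq0 d x) _ Dp0 AXY oX pX oY pY.
rewrite -[X in X + _]scale1r -[X in _ + X]scale1r; apply: H; rewrite ?invr_neq0 ?q_neq0 //.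
- move=> r r0; rewrite AX // (kappaE d r efx) Dp // mulr1.
  rewrite [(q_ d x * _) ^ r]mul_expz ?q_neq0 // s2 !q_expz.
  have := sh_expz4_neq1 lnq0 gen e r0; have := n8 r r0.
  have := sh_expz_neq0 d f r.
  move: (sh d e ^ r) (sh d f ^ r) (sh d x ^ r) => E F B F0 nF nE.
  by field; rewrite ?F0 ?nE ?nF.
- move=> r r0; rewrite AY // (kappaE d r efx) Dp // mulr1.
  rewrite [((q_ d x)^-1 * _) ^ r]mul_expz ?invr_neq0 ?q_neq0 // s2 !expzV !q_expz.
  have := sh_colorsX lnq0 r efx.
  have := sh_expz4_neq1 lnq0 gen e r0; have := n8 r r0.
  have := sh_expz_neq0 d f r; have := sh_expz_neq0 d e r.
  move: (sh d e ^ r) (sh d f ^ r) (sh d x ^ r) => E F B E0 F0 nF nE EFB.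
  by rewrite (prod3_inv EFB); field; rewrite ?F0 ?E0 ?nE ?nF.
- rewrite XY !expz_m // !s_sh !q_sh.
  have := sh_colors lnq0 efx; have := sh_neq0 d f; have := sh_neq0 d e.
  have := expfz_neq0 m sf0; rewrite s_sh.
  move: (sh d e) (sh d f) (sh d x) (pref Y) (((_ ^+ 2) ^+ 2) ^ m) => E F B w P P0 E0 F0 EFB.
  by rewrite (prod3_inv EFB); field; rewrite ?P0 ?F0 ?E0.
Qed.
End TypeC.

End Chains.

(** Since [1 - q_i = - s_i t_i] and the [s_i] multiply to 1, [kappa_1 = - t_1 t_2 t_3]. This gives
    [b] the denominator of [kB]. *)
Lemma bE_kappa (R : realType) (d : datum R) x : \sum_(x < 3) lnq d x = 0 ->
  b_ d x = - t_ d x / kappa d 1.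
Proof.
move=> lnq0; have c := colors_shift 0.
rewrite /b_ mulNr -mulrN -invrN; congr (_ / _).
rewrite (prod_colors _ c) (kappaE d 1 c) !expr1z /t_ !s_sh.
have := sh_colors lnq0 c; have := sh_neq0 d 0; have := sh_neq0 d (0 + 1).
move: (sh d 0) (sh d (0 + 1)) (sh d (0 + 1 + 1)) => E F B F0 E0 EFB.
by rewrite (prod3_inv EFB); field; rewrite E0 F0.
Qed.

Lemma all_colorsC x y z : all_colors x y z -> all_colors y x z.
Proof.
rewrite /all_colors /= !inE !negb_or !andbT => /andP[/andP[xy xz] yz].
by rewrite eq_sym xy yz xz.
Qed.

(** The product is [s_x / s_z], and distinct colours have distinct [s]. It is the condition that the
    two poles of the middle term of a type B chain be distinct. *)
Lemma s_pole (R : realType) (d : datum R) x y z :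
  \sum_(x < 3) lnq d x = 0 -> generic d -> all_colors x y z ->
  s_ d x ^+ 2 * s_ d y - 1 != 0.
Proof.
move=> lnq0 gen xyz.
have : s_ d x - s_ d z != 0.
  rewrite subr_eq0 s_inj //; move: xyz; rewrite /all_colors /= !inE negb_or.
  by case/and3P=> /andP[].
have := sh_colors lnq0 xyz; rewrite !s_sh.
move: (sh d x) (sh d y) (sh d z) (sh_neq0 d x) (sh_neq0 d z) => E F B E0 B0 EFB nz.
have -> : F = (B * E)^-1 by apply: prod3_inv; rewrite -mulrA mulrC.
rewrite (_ : _ - 1 = (E ^+ 2 - B ^+ 2) / B ^+ 2) ?mulf_neq0 ?invr_neq0 ?expf_neq0 //.
by field; rewrite E0 B0.
Qed.

Lemma opp_pred (m : int) : - (-1 - m) = m + 1. Proof. by lia. Qed.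

Section Cancellation.
Variables (K : fieldType) (V : lmodType K).

Lemma cancel_plus (T M B wT w1 w2 wB : V) (b k ct c1 c2 cb : K) :
  T = ct *: wT -> M = c1 *: w1 + c2 *: w2 -> B = cb *: wB ->
  wT = w1 -> w2 = wB -> b * ct + k * c1 = 0 -> k * c2 + b * cb = 0 ->
  b *: T + k *: M + b *: B = 0.
Proof.
move=> -> -> -> -> -> E1 E2.
by rewrite scalerDr !scalerA addrA -scalerDl E1 scale0r add0r -scalerDl E2 scale0r.
Qed.

Lemma cancel_minus (T M B t1 t2 w1 w2 b1 b2 : V) (b k ct ct' c1 c2 cb cb' : K) :
  T = ct *: t1 + ct' *: t2 -> M = c1 *: w1 + c2 *: w2 -> B = cb *: b1 + cb' *: b2 ->
  t1 = w1 -> w2 = b2 -> t2 = b1 ->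
  b * ct + k * c1 = 0 -> k * c2 + b * cb' = 0 -> b * ct' + b * cb = 0 ->
  b *: T + k *: M + b *: B = 0.
Proof.
move=> -> -> -> -> -> -> E1 E2 E3.
rewrite !scalerDr !scalerA [X in X + _]addrACA -scalerDl E1 scale0r add0r.
by rewrite addrACA -scalerDl E3 scale0r add0r -scalerDl E2 scale0r.
Qed.

End Cancellation.

(** * Cancellation along the chain of three terms of type B *)

Section TypeB.
Variables (R : realType) (d : datum R).
Hypothesis lnq0 : \sum_(x < 3) lnq d x = 0.
Hypothesis gen : generic d.
Variables (V : lmodType R[i]) (h : nat -> int -> V -> V) (vac : V).
Hypothesis fk : is_fock d h vac.
Local Notation vc := (vcoef d h).
Variables (A T M B T' M' B' : vertex R) (al : R[i]) (e f : color) (m : int).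
Hypothesis al0 : al != 0.
Hypotheses (ATM : root_of d A al T M) (AMB : root_of d A (al * s_ d f) M B).
Hypotheses (oT : osc T' = osc T) (oM : osc M' = osc M) (oB : osc B' = osc B).
Hypotheses (pM : pref M = 1) (pM' : pref M' = 1) (pB : pref B = (pref T)^-1).
Hypothesis AT : forall r : int, r != 0 ->
  cc d A T r = - al ^ r * kappa d r / (1 - q_ d e ^ r).
Hypothesis AM : forall r : int, r != 0 ->
  cc d A M r = - al ^ r * kappa d r * s_ d f ^ r / (1 + s_ d f ^ r).
Hypothesis AB : forall r : int, r != 0 ->
  cc d A B r = al ^ r * s_ d f ^ r * q_ d e ^ r * kappa d r / (1 - q_ d e ^ r).

Lemma pM1 y : y != 0 -> pref M' = y^-1 * y * pref M.
Proof. by move=> y0; rewrite pM pM' mulVf ?mulr1. Qed.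

Section Plus.
Variables (p t b k : R[i]).
Hypotheses (p0 : p != 0) (t0 : t != 0).
Hypothesis Dp : forall r : int, r != 0 -> p ^ r - p ^ (- r) != 0.
Local Notation s := (s_ d f).
Hypothesis pT : pref T' = t * pref T.
Hypothesis pB' : pref B' = t^-1 * pref B.
Hypothesis ST : forall r : int, r != 0 ->
  cc d A T r / (p ^ r - p ^ (- r)) = (p * al) ^ r - (t * (p * al)) ^ r.
Hypothesis SM : forall r : int, r != 0 ->
  cc d A M r / (p ^ r - p ^ (- r)) =
  (p^-1 * al) ^ r - (s^-1 * (p^-1 * al)) ^ r + ((p * (al * s)) ^ r - (s * (p * (al * s))) ^ r).
Hypothesis SB : forall r : int, r != 0 ->
  cc d A B r / (p ^ r - p ^ (- r)) = (p^-1 * (al * s)) ^ r - (t^-1 * (p^-1 * (al * s))) ^ r.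
Hypothesis poles : p^-1 * al != p * (al * s).
Hypothesis c1 : b * pref T * (1 - t) * p ^ (m + 1) +
  k * frac2_res (p^-1 * al) s^-1 (p * (al * s)) s * p ^ (- (m + 1)) = 0.
Hypothesis c2 : k * frac2_res (p * (al * s)) s (p^-1 * al) s^-1 * p ^ (m + 1) +
  b * pref B * (1 - t^-1) * p ^ (- (m + 1)) = 0.

(** The end terms [T] and [B] have one pole, the middle term [M] has two. The first pole of [M]
    cancels against [T], the second against [B]; the prefactor of [M] is constant because its two
    multipliers [s^-1] and [s] are inverse to each other. *)
Lemma chain_plus n v :
  b *: vcomm d h (scr_osc A p) (-1 - m) T T' n v +
  k *: vcomm d h (scr_osc A p) (-1 - m) M M' n v +
  b *: vcomm d h (scr_osc A p) (-1 - m) B B' n v = 0.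
Proof.
have pV0 : p^-1 != 0 by rewrite invr_neq0.
have s0 : s != 0 by apply: s_neq0.
have sV0 : s^-1 != 0 by rewrite invr_neq0.
have tV0 : t^-1 != 0 by rewrite invr_neq0.
have als0 : al * s != 0 by rewrite mulf_neq0.
have S1 : pref (scr_osc A p) = 1 by [].
have ST' r : r != 0 -> cc d (scr_osc A p) T r = (p * al) ^ r - (t * (p * al)) ^ r.
  by move=> r0; rewrite cc_scr ST.
have SB' r : r != 0 -> cc d (scr_osc A p) B r = (p^-1 * (al * s)) ^ r - (t^-1 * (p^-1 * (al * s))) ^ r.
  by move=> r0; rewrite cc_scr SB.
have SM' r : r != 0 -> cc d (scr_osc A p) M r =
    (p^-1 * al) ^ r - (s^-1 * (p^-1 * al)) ^ r + ((p * (al * s)) ^ r - (s * (p * (al * s))) ^ r).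
  by move=> r0; rewrite cc_scr SM.
have HT := vcomm1_wave lnq0 fk (-1 - m) n v S1 (mulf_neq0 p0 al0) t0 oT pT ST'.
have HB := vcomm1_wave lnq0 fk (-1 - m) n v S1 (mulf_neq0 pV0 als0) tV0 oB pB' SB'.
have HM := vcomm2_wave lnq0 fk (-1 - m) n v S1 (mulf_neq0 pV0 al0) sV0 (mulf_neq0 p0 als0) s0 poles oM (pM1 s0) SM'.
have W1 := vcoef_wave_eq h (-1 - m + n) v (scr_wave p0 al0 Dp ATM).
have W2 := vcoef_wave_eq h (-1 - m + n) v (scr_wave p0 als0 Dp AMB).
rewrite opp_pred in HT HM HB.
apply: (cancel_plus HT HM HB W1 W2).
all: rewrite ?pM ?mulr1.
  rewrite (mul_expz _ p0) // (mul_expz _ pV0) // expzV invr_expz.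
  rewrite -[RHS](mul0r (al ^ (m + 1))) -c1.
  by move: (frac2_res _ _ _ _) (p ^ (m + 1)) (p ^ (- (m + 1))) (_ ^ (m + 1)) => F P P' g; ring.
rewrite (mul_expz _ p0) // (mul_expz _ pV0) // expzV invr_expz.
rewrite -[RHS](mul0r ((al * s) ^ (m + 1))) -c2.
by move: (frac2_res _ _ _ _) (p ^ (m + 1)) (p ^ (- (m + 1))) (_ ^ (m + 1)) => F P P' g; ring.
Qed.
End Plus.


Lemma frac2_res1 (p s : R[i]) : p != 0 -> s != 0 -> p ^+ 2 * s - 1 != 0 ->
  frac2_res (p^-1 * al) s^-1 (p * (al * s)) s = (1 - s^-1) * (p ^+ 2 * s ^+ 2 - 1) / (p ^+ 2 * s - 1).
Proof.
move=> p0 s0 n0; rewrite /frac2_res.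
rewrite (_ : p^-1 * al - p * (al * s) = - al * (p ^+ 2 * s - 1) / p); last by field.
by field; rewrite p0 s0 al0 n0.
Qed.

Lemma frac2_res2 (p s : R[i]) : p != 0 -> s != 0 -> p ^+ 2 * s - 1 != 0 ->
  frac2_res (p * (al * s)) s (p^-1 * al) s^-1 = (1 - s) * (p ^+ 2 * s - s^-1) / (p ^+ 2 * s - 1).
Proof.
move=> p0 s0 n0; rewrite /frac2_res.
rewrite (_ : p * (al * s) - p^-1 * al = al * (p ^+ 2 * s - 1) / p); last by field.
by field; rewrite p0 s0 al0 n0.
Qed.

Lemma poles_neq (p s : R[i]) : p != 0 -> p ^+ 2 * s - 1 != 0 ->
  p^-1 * al != p * (al * s).
Proof.
move=> p0 n0; rewrite -subr_eq0 (_ : _ - _ = - al * (p ^+ 2 * s - 1) / p); last by field.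
by rewrite !mulf_neq0 ?invr_neq0 // oppr_eq0.
Qed.

Lemma typeB_eq x y n v : e = f -> cycl e x y ->
  pref T' = q_ d y * pref T -> pref B' = (q_ d y)^-1 * pref B ->
  pref T = s_ d e ^+ 2 * s_ d y * s_ d x ^ (- (2 * m)) ->
  b_ d e *: vcomm d h (scr_osc A (s_ d x)) (-1 - m) T T' n v +
  kB d f *: vcomm d h (scr_osc A (s_ d x)) (-1 - m) M M' n v +
  b_ d e *: vcomm d h (scr_osc A (s_ d x)) (-1 - m) B B' n v = 0.
Proof.
move=> ef cy pT pB' kT; have exy := cycl_colors cy.
have sx0 := s_neq0 d x; have se0 := s_neq0 d e.
have kBE : kB d f = (1 + s_ d e) * (s_ d x - s_ d y) / kappa d 1.
  by rewrite -ef; case/andP: cy => /eqP-> /eqP->.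
have np : s_ d x ^+ 2 * s_ d e - 1 != 0 by exact: (s_pole lnq0 gen (all_colorsC exy)).
have nx := sh_neq0 d x; have ny := sh_neq0 d y.
apply: (chain_plus (t := q_ d y)) => //.
- exact: q_neq0.
- by move=> r r0; apply: s_diff_neq0.
- move=> r r0; rewrite AT // (kappaE d r exy) s_diff_expz //.
  rewrite [(q_ d y * _) ^ r]mul_expz ?mulf_neq0 ?q_neq0 ?s_neq0 // mul_expz ?s_neq0 // s_expz !q_expz.
  have := sh_expz4_neq1 lnq0 gen e r0; have := sh_expz4_neq1 lnq0 gen x r0.
  have := sh_expz_neq0 d x r.
  move: (sh d e ^ r) (sh d x ^ r) (sh d y ^ r) (al ^ r) => E F B1 G F0 nF nE.
  have nF' : F ^+ 4 - 1 != 0 by rewrite -opprB oppr_eq0.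
  by field; rewrite ?F0 ?nE ?nF'.
(* Here [1 - q_e^r = (1 - s_e^r)(1 + s_e^r)] absorbs the denominator; the remaining product
   [(1 - s_e^r)(1 - q_y^r)] expands into the four monomials of a two-pole profile. *)
- move=> r r0; rewrite AM // -!ef (kappaE d r exy) s_diff_expz //.
  rewrite [((s_ d e)^-1 * _) ^ r]mul_expz ?mulf_neq0 ?invr_neq0 //.
  rewrite [(s_ d e * _) ^ r]mul_expz ?mulf_neq0 //.
  rewrite [(_^-1 * al) ^ r]mul_expz ?invr_neq0 // [(s_ d x * _) ^ r]mul_expz ?mulf_neq0 //.
  rewrite [(al * _) ^ r]mul_expz // !expzV !s_expz.
  have := sh_expz2_neqN1 lnq0 gen e r0; have := sh_expz4_neq1 lnq0 gen x r0.
  have := sh_expz_neq0 d x r; have := sh_expz_neq0 d e r; have := sh_colorsX lnq0 r exy.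
  move: (sh d e ^ r) (sh d x ^ r) (sh d y ^ r) (al ^ r) => E F B1 G EFB E0 F0 nF nE.
  have nF' : F ^+ 4 - 1 != 0 by rewrite -opprB oppr_eq0.
  by rewrite (prod3_inv EFB); field; rewrite ?F0 ?nE ?nF' ?E0.
- move=> r r0; rewrite AB // -!ef (kappaE d r exy) s_diff_expz //.
  rewrite [((q_ d y)^-1 * _) ^ r]mul_expz ?mulf_neq0 ?invr_neq0 ?q_neq0 //.
  rewrite [(_^-1 * _) ^ r]mul_expz ?invr_neq0 ?mulf_neq0 //.
  rewrite [(al * _) ^ r]mul_expz // !expzV !q_expz !s_expz.
  have := sh_expz4_neq1 lnq0 gen e r0; have := sh_expz4_neq1 lnq0 gen x r0.
  have := sh_expz_neq0 d x r; have := sh_expz_neq0 d e r; have := sh_colorsX lnq0 r exy.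
  move: (sh d e ^ r) (sh d x ^ r) (sh d y ^ r) (al ^ r) => E F B1 G EFB E0 F0 nF nE.
  have nF' : F ^+ 4 - 1 != 0 by rewrite -opprB oppr_eq0.
  by rewrite (prod3_inv EFB); field; rewrite ?F0 ?nE ?nF' ?E0.
- by rewrite -ef; apply: poles_neq.
- rewrite kT kBE -!ef !frac2_res1 // ?s_neq0 // !expz_m // (bE_kappa _ lnq0) /t_ !s_sh !q_sh.
  have := sh_colors lnq0 exy; move: (sh_neq0 d e) nx np.
  have := expfz_neq0 m sx0; rewrite !s_sh.
  move: (kappa d 1)^-1 (sh d e) (sh d x) (sh d y) ((_ ^+ 2) ^ m) => K E F B1 P P0 E0 F0 np' EFB.
  by rewrite -exprM in np'; rewrite (prod3_inv EFB); field; rewrite ?P0 ?F0 ?E0 ?np'.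
- rewrite pB kT kBE -!ef !frac2_res2 // ?s_neq0 // !expz_m // (bE_kappa _ lnq0) /t_ !s_sh !q_sh.
  have := sh_colors lnq0 exy; move: (sh_neq0 d e) nx np.
  have := expfz_neq0 m sx0; rewrite !s_sh.
  move: (kappa d 1)^-1 (sh d e) (sh d x) (sh d y) ((_ ^+ 2) ^ m) => K E F B1 P P0 E0 F0 np' EFB.
  by rewrite -exprM in np'; rewrite (prod3_inv EFB); field; rewrite ?P0 ?F0 ?E0 ?np'.
Qed.

Lemma orient_pm x y : orient R x y = 1 \/ orient R x y = -1.
Proof. by rewrite /orient; case: ifP; [left|right]. Qed.

Lemma typeB_plus x n v : all_colors e f x ->
  pref T' = q_ d f * pref T -> pref B' = (q_ d f)^-1 * pref B ->
  pref T = orient R e f * (s_ d e ^+ 2 * s_ d f) * s_ d x ^ (- (2 * m)) ->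
  b_ d e *: vcomm d h (scr_osc A (s_ d x)) (-1 - m) T T' n v +
  kB d f *: vcomm d h (scr_osc A (s_ d x)) (-1 - m) M M' n v +
  b_ d e *: vcomm d h (scr_osc A (s_ d x)) (-1 - m) B B' n v = 0.
Proof.
move=> efx pT pB' kT.
have sx0 := s_neq0 d x; have se0 := s_neq0 d e; have sf0 := s_neq0 d f.
have fxe : all_colors f x e.
  move: efx; rewrite /all_colors /= !inE !negb_or !andbT => /andP[/andP[ef ex] fx].
  by rewrite fx eq_sym ef eq_sym ex.
have np := s_pole lnq0 gen (all_colorsC fxe).
have kBE := kB_orient d efx.
apply: (chain_plus (t := q_ d f)) => //.
- exact: q_neq0.
- by move=> r r0; apply: s_diff_neq0.
- move=> r r0; rewrite AT // (kappaE d r efx) s_diff_expz //.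
  rewrite [(q_ d f * _) ^ r]mul_expz ?mulf_neq0 ?q_neq0 ?s_neq0 // mul_expz ?s_neq0 // s_expz !q_expz.
  have := sh_expz4_neq1 lnq0 gen e r0; have := sh_expz4_neq1 lnq0 gen x r0.
  have := sh_expz_neq0 d x r.
  move: (sh d e ^ r) (sh d f ^ r) (sh d x ^ r) (al ^ r) => E F X G X0 nX nE.
  have nX' : X ^+ 4 - 1 != 0 by rewrite -opprB oppr_eq0.
  by field; rewrite ?X0 ?nE ?nX'.
- move=> r r0; rewrite AM // (kappaE d r efx) s_diff_expz //.
  rewrite [((s_ d f)^-1 * _) ^ r]mul_expz ?mulf_neq0 ?invr_neq0 //.
  rewrite [(s_ d f * _) ^ r]mul_expz ?mulf_neq0 //.
  rewrite [(_^-1 * al) ^ r]mul_expz ?invr_neq0 // [(s_ d x * _) ^ r]mul_expz ?mulf_neq0 //.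
  rewrite [(al * _) ^ r]mul_expz // !expzV !s_expz.
  have := sh_expz2_neqN1 lnq0 gen f r0; have := sh_expz4_neq1 lnq0 gen x r0.
  have := sh_expz_neq0 d x r; have := sh_expz_neq0 d f r; have := sh_colorsX lnq0 r fxe.
  move: (sh d e ^ r) (sh d f ^ r) (sh d x ^ r) (al ^ r) => E F X G EFB F0 X0 nX nF.
  have nX' : X ^+ 4 - 1 != 0 by rewrite -opprB oppr_eq0.
  by rewrite (prod3_inv EFB); field; rewrite ?F0 ?nF ?nX' ?X0.
- move=> r r0; rewrite AB // (kappaE d r efx) s_diff_expz //.
  rewrite [((q_ d f)^-1 * _) ^ r]mul_expz ?mulf_neq0 ?invr_neq0 ?q_neq0 //.
  rewrite [(_^-1 * _) ^ r]mul_expz ?invr_neq0 ?mulf_neq0 //.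
  rewrite [(al * _) ^ r]mul_expz // !expzV !q_expz !s_expz.
  have := sh_expz4_neq1 lnq0 gen e r0; have := sh_expz4_neq1 lnq0 gen x r0.
  have := sh_expz_neq0 d x r; have := sh_expz_neq0 d e r; have := sh_colorsX lnq0 r (all_colorsC fxe).
  move: (sh d e ^ r) (sh d f ^ r) (sh d x ^ r) (al ^ r) => E F X G EFB E0 X0 nX nE.
  have nX' : X ^+ 4 - 1 != 0 by rewrite -opprB oppr_eq0.
  have -> : F = (E * X)^-1 by apply: prod3_inv; rewrite mulrAC mulrC mulrA mulrAC.
  by field; rewrite ?X0 ?nE ?nX' ?E0.
- exact: poles_neq.
- rewrite kT kBE !frac2_res1 // !expz_m // (bE_kappa _ lnq0) /t_ !s_sh !q_sh.
  have := sh_colors lnq0 fxe; have := sh_neq0 d x; have := sh_neq0 d f; move: np.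
  have := expfz_neq0 m sx0; rewrite !s_sh.
  move: (kappa d 1)^-1 (orient R e f) (sh d e) (sh d f) (sh d x) ((_ ^+ 2) ^ m) => K O E F X P P0 np F0 X0 EFB.
  by rewrite -exprM in np; rewrite (prod3_inv EFB); field; rewrite ?P0 ?F0 ?X0 ?np.
- rewrite pB kT kBE !frac2_res2 // !expz_m // (bE_kappa _ lnq0) /t_ !s_sh !q_sh.
  have := sh_colors lnq0 fxe; have := sh_neq0 d x; have := sh_neq0 d f; move: np.
  (* The prefactor of [B] is the inverse of that of [T], so the sign appears inverted; being 1 or
     -1, it equals its inverse. *)
  have := expfz_neq0 m sx0; rewrite !s_sh; have := orient_pm e f.
  move: (kappa d 1)^-1 (orient R e f) (sh d e) (sh d f) (sh d x) ((_ ^+ 2) ^ m) => K O E F X P OE P0 np F0 X0 EFB.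
  rewrite -exprM in np; rewrite (prod3_inv EFB).
  by case: OE => ->; field; rewrite ?P0 ?F0 ?X0 ?np ?oner_neq0.
Qed.

Lemma frac2_resZ (c z y y' : R[i]) : z != 0 -> 1 - c != 0 ->
  frac2_res z y (c * z) y' = (1 - y) * (1 - y' * c) / (1 - c).
Proof.
move=> z0 c0; rewrite /frac2_res (_ : z - c * z = (1 - c) * z); last by ring.
by field; rewrite z0 c0.
Qed.

Lemma frac2_resZr (c z y y' : R[i]) : z != 0 -> 1 - c != 0 ->
  frac2_res (c * z) y z y' = (1 - y) * (y' - c) / (1 - c).
Proof.
move=> z0 c0; rewrite /frac2_res (_ : c * z - z = - (1 - c) * z); last by ring.
by field; rewrite z0 c0.
Qed.

(** With [p = s_f^(1/2)], every term of the chain has two poles: the division by [p^r - p^(-r)]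
    consumes only a square root of the factor of [f], namely [1 - s_f^r]. The six residues cancel
    two by two: [T] with [M], [M] with [B], and [T] with [B]. *)
Lemma typeB_minus x n v : all_colors e f x ->
  pref T' = q_ d x ^+ 2 * pref T -> pref B' = (q_ d x ^+ 2)^-1 * pref B ->
  pref T = orient R e f * (s_ d e ^+ 2 * s_ d f) * sh d f ^ (- (2 * m)) ->
  b_ d e *: vcomm d h (scr_osc A (sh d f)) (-1 - m) T T' n v +
  kB d f *: vcomm d h (scr_osc A (sh d f)) (-1 - m) M M' n v +
  b_ d e *: vcomm d h (scr_osc A (sh d f)) (-1 - m) B B' n v = 0.
Proof.
move=> efx pT pB' kT.
set p := sh d f; set s := s_ d f.
have p0 : p != 0 := sh_neq0 d f; have s0 : s != 0 := s_neq0 d f.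
have pV0 : p^-1 != 0 by rewrite invr_neq0.
have sp : s = p ^+ 2 by rewrite /s s_sh.
have als0 : al * s != 0 by rewrite mulf_neq0.
have qx0 := q_neq0 d x; have qe0 := q_neq0 d e.
have n2 : 1 - s != 0 by rewrite sp -[p]expr1z sh_expz2_neq1.
have n4 : 1 - s ^+ 2 != 0 by rewrite sp -exprM -[p]expr1z sh_expz4_neq1.
have DpE (r : int) : r != 0 -> p ^ r - p ^ (- r) = ((p ^ r) ^+ 2 - 1) / p ^ r.
  by move=> r0; rewrite -invr_expz; field; exact: sh_expz_neq0.
have nF (r : int) : r != 0 -> (p ^ r) ^+ 2 - 1 != 0.
  by move=> r0; rewrite -opprB oppr_eq0 sh_expz2_neq1.
have Dp (r : int) : r != 0 -> p ^ r - p ^ (- r) != 0.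
  by move=> r0; rewrite DpE // mulf_neq0 ?nF // invr_neq0 // sh_expz_neq0.
have kBE := kB_orient d efx.
have ns (z : R[i]) : z != 0 -> z != s * z.
  by move=> z0; rewrite -subr_eq0 -{1}[z]mul1r -mulrBl mulf_neq0.
have [z0 w0] : p * al != 0 /\ p^-1 * al != 0 by rewrite !mulf_neq0.
have [sz0 sw0] : s * (p * al) != 0 /\ s * (p^-1 * al) != 0 by rewrite !(mulf_neq0 s0).
have s2w0 : s ^+ 2 * (p^-1 * al) != 0 by rewrite mulf_neq0 // expf_neq0.
have qxV0 : (q_ d x)^-1 != 0 by rewrite invr_neq0.
have qeV0 : (q_ d e)^-1 != 0 by rewrite invr_neq0.
have ST r : r != 0 -> cc d (scr_osc A p) T r =
    (p * al) ^ r - (q_ d x * (p * al)) ^ r + ((s * (p * al)) ^ r - (q_ d x * (s * (p * al))) ^ r).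
  move=> r0; rewrite cc_scr AT // (kappaE d r efx) DpE //.
  rewrite (mul_expz r qx0 sz0) (mul_expz r qx0 z0) (mul_expz r s0 z0) (mul_expz r p0 al0) s_expz !q_expz.
  have := sh_expz4_neq1 lnq0 gen e r0; have := nF r r0; have := sh_expz_neq0 d f r.
  rewrite -/p; move: (sh d e ^ r) (p ^ r) (sh d x ^ r) (al ^ r) => E F X G F0 n1 nE.
  by field; rewrite F0 nE n1.
have SM r : r != 0 -> cc d (scr_osc A p) M r =
    (p^-1 * al) ^ r - ((q_ d e)^-1 * (p^-1 * al)) ^ r +
    ((s ^+ 2 * (p^-1 * al)) ^ r - (q_ d e * (s ^+ 2 * (p^-1 * al))) ^ r).
  move=> r0; rewrite cc_scr AM // (kappaE d r efx) DpE //.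
  rewrite (mul_expz r qeV0 w0) (mul_expz r qe0 s2w0) (mul_expz r (expf_neq0 2 s0) w0) (mul_expz r pV0 al0).
  rewrite exprz_AC !expzV !s_expz !q_expz.
  have := sh_colorsX lnq0 r efx; have := sh_expz2_neqN1 lnq0 gen f r0.
  have := nF r r0; have := sh_expz_neq0 d f r; have := sh_expz_neq0 d e r.
  rewrite -/p; move: (sh d e ^ r) (p ^ r) (sh d x ^ r) (al ^ r) => E F X G E0 F0 n1 nF' EFX.
  by rewrite (prod3_inv EFX); field; rewrite F0 nF' n1 E0.
have SB r : r != 0 -> cc d (scr_osc A p) B r =
    (p^-1 * al) ^ r - ((q_ d x)^-1 * (p^-1 * al)) ^ r +
    ((s * (p^-1 * al)) ^ r - ((q_ d x)^-1 * (s * (p^-1 * al))) ^ r).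
  move=> r0; rewrite cc_scr AB // (kappaE d r efx) DpE //.
  rewrite (mul_expz r qxV0 sw0) (mul_expz r qxV0 w0) (mul_expz r s0 w0) (mul_expz r pV0 al0).
  rewrite !expzV !s_expz !q_expz.
  have := sh_colorsX lnq0 r efx; have := sh_expz4_neq1 lnq0 gen e r0; have := nF r r0.
  have := sh_expz_neq0 d f r; have := sh_expz_neq0 d e r.
  rewrite -/p; move: (sh d e ^ r) (p ^ r) (sh d x ^ r) (al ^ r) => E F X G E0 F0 n1 nE EFX.
  by rewrite (prod3_inv EFX); field; rewrite F0 nE n1 E0.
have pT2 : pref T' = q_ d x * q_ d x * pref T by rewrite -expr2.
have pM2 : pref M' = (q_ d e)^-1 * q_ d e * pref M by apply: pM1.
have pB2 : pref B' = (q_ d x)^-1 * (q_ d x)^-1 * pref B by rewrite -invfM -expr2.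
have ns2 : p^-1 * al != s ^+ 2 * (p^-1 * al).
  by rewrite -subr_eq0 -{1}[_ * al]mul1r -mulrBl mulf_neq0.
have S1 : pref (scr_osc A p) = 1 by [].
have HT := vcomm2_wave lnq0 fk (-1 - m) n v S1 z0 qx0 sz0 qx0 (ns _ z0) oT pT2 ST.
have HM := vcomm2_wave lnq0 fk (-1 - m) n v S1 w0 qeV0 s2w0 qe0 ns2 oM pM2 SM.
have HB := vcomm2_wave lnq0 fk (-1 - m) n v S1 w0 qxV0 sw0 qxV0 (ns _ w0) oB pB2 SB.
have W1 := vcoef_wave_eq h (-1 - m + n) v (scr_wave p0 al0 Dp ATM).
have W2 := vcoef_wave_eq h (-1 - m + n) v (scr_wave p0 als0 Dp AMB).
(* The direct link between the two ends: the links through [M] add up to [a_r al^(-r) (1 + s^(-r))],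
   and for [s = p^2] this is the mode of [:S(p^(-1) al z) S(p^3 al z)^(-1):]. *)
have W3 : eq_osc d (vmul (vscale (s * (p * al)) (scr_osc A p)) T)
    (vmul (vscale (p^-1 * al) (scr_osc A p)) B).
  move=> j r jl r0 /=; have := AMB jl r0; have := ATM jl r0.
  rewrite !(mul_expz (- r) al0) // (mul_expz (- r) s0 z0) (mul_expz (- r) p0 al0) (mul_expz (- r) pV0 al0).
  rewrite s_expz DpE // !expzV -!invr_expz -/p !invrK.
  have := nF r r0; have := sh_expz_neq0 d f r; rewrite -/p.
  move: (osc A j r) (osc T j r) (osc M j r) (osc B j r) (p ^ r) (al ^ r)^-1 => a y1 y2 y3 P g P0 n1 E1 E2.
  have -> : y1 = a * g + a * (g * P^-1 ^+ 2) + y3 by rewrite E1 E2; ring.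
  by field; rewrite P0 n1.
have {}W3 := vcoef_wave_eq h (-1 - m + n) v W3.
have e1 : p * (al * s) = s ^+ 2 * (p^-1 * al) by rewrite sp; field.
have e2 : p^-1 * (al * s) = s * (p^-1 * al) by ring.
rewrite {}e1 {}e2 in W2.
rewrite opp_pred in HT HM HB.
apply: (cancel_minus HT HM HB W1 W2 W3).
- rewrite !frac2_resZ // (mul_expz _ p0 al0) (mul_expz _ pV0 al0) kT pM kBE (bE_kappa _ lnq0) expzV.
  rewrite !(expz_m _ p0) /t_ /s !q_sh !s_sh -/p; move: n2 n4; rewrite sp.
  have := sh_colors lnq0 efx; have := sh_neq0 d e; have := expfz_neq0 m p0; rewrite -/p.
  move: (kappa d 1)^-1 (orient R e f) (sh d e) (sh d x) (p ^ m) (al ^ (m + 1)) => K O E X P G P0 E0 EFX.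
  rewrite -exprM => n2 n4.
  by rewrite (prod3_inv EFX); field; rewrite ?P0 ?p0 ?E0 ?n2 ?n4.
- rewrite !frac2_resZr // (mul_expz _ (expf_neq0 2 s0) w0) (mul_expz _ s0 w0) (mul_expz _ pV0 al0).
  rewrite pM pB kT kBE (bE_kappa _ lnq0) exprz_AC s_expz expzV -/p.
  rewrite !(expz_m _ p0) /t_ /s !q_sh !s_sh -/p; move: n2 n4; rewrite sp.
  have := sh_colors lnq0 efx; have := sh_neq0 d e; have := expfz_neq0 m p0; rewrite -/p; have := orient_pm e f.
  move: (kappa d 1)^-1 (orient R e f) (sh d e) (sh d x) (p ^ m) (al ^ (m + 1)) => K O E X P G OE P0 E0 EFX.
  rewrite -exprM => n2 n4; rewrite (prod3_inv EFX).
  by case: OE => ->; field; rewrite ?P0 ?p0 ?E0 ?n2 ?n4 ?oner_neq0.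
- rewrite frac2_resZr // frac2_resZ // (mul_expz _ s0 z0) (mul_expz _ p0 al0) (mul_expz _ pV0 al0).
  rewrite pB kT (bE_kappa _ lnq0) s_expz expzV -/p.
  rewrite !(expz_m _ p0) /t_ /s !q_sh !s_sh -/p; move: n2 n4; rewrite sp.
  have := sh_colors lnq0 efx; have := sh_neq0 d e; have := expfz_neq0 m p0; rewrite -/p; have := orient_pm e f.
  move: (kappa d 1)^-1 (orient R e f) (sh d e) (sh d x) (p ^ m) (al ^ (m + 1)) => K O E X P G OE P0 E0 EFX.
  rewrite -exprM => n2 n4; rewrite (prod3_inv EFX).
  by case: OE => ->; field; rewrite ?P0 ?p0 ?E0 ?n2 ?n4 ?oner_neq0.
Qed.

End TypeB.

Lemma big_nat_single (V : nmodType) (F : nat -> V) j n : (1 <= j <= n)%N ->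
  \sum_(1 <= i < n.+1) (if i == j then F i else 0) = F j.
Proof.
move=> jn; rewrite (bigD1_seq j) ?mem_index_iota ?iota_uniq //= eqxx.
by rewrite big1 ?addr0 // => i /negPf->.
Qed.

Lemma big_nat_from (V : nmodType) (F : nat -> V) x j n : (1 <= j <= n)%N ->
  \sum_(1 <= i < n.+1) (if (i < j)%N then 0 else if i == j then x else F i) =
  x + \sum_(j.+1 <= i < n.+1) F i.
Proof.
move=> /andP[j1 jn]; rewrite (big_cat_nat _ (n := j)) ?leqW //= big_nat big1 ?add0r; last first.
  by move=> i /andP[_ ->].
rewrite big_ltn ?ltnS // ltnn eqxx; congr (_ + _).
rewrite big_nat [RHS]big_nat; apply: eq_bigr => i /andP[ji _].
by rewrite ltnNge (ltnW ji) gtn_eqF.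
Qed.

Lemma big_nat_drop (V : nmodType) (F : nat -> V) j i n : (j < i <= n)%N ->
  (forall m, (m < i)%N -> F m = 0) ->
  \sum_(j.+1 <= m < n.+1) F m = F i + \sum_(i.+1 <= m < n.+1) F m.
Proof.
move=> /andP[ji iln] F0; rewrite (big_cat_nat _ (n := i)) ?leqW //= big_nat big1 ?add0r; last first.
  by move=> m /andP[_ /F0].
by rewrite big_ltn ?ltnS.
Qed.

(** * Contractions between the undressed terms *)

Section Table.
Variables (R : realType) (d : datum R).
Hypothesis lnq0 : \sum_(x < 3) lnq d x = 0.
Hypothesis gen : generic d.
Local Notation c := (colr d).
Local Notation l := (ell d).
Implicit Types (X Y Z : vertex R) (r : int) (u : nat -> R[i]).

Lemma brkDl X Y Z r : brk d (vmul X Y) Z r = brk d X Z r + brk d Y Z r.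
Proof. by rewrite /brk -big_split; apply: eq_bigr => j _ /=; rewrite !mulrDl. Qed.

Lemma ccDl X Y Z r : cc d (vmul X Y) Z r = cc d X Z r + cc d Y Z r.
Proof. by rewrite !ccE brkDl mulrDr. Qed.

Lemma ccDr X Y Z r : cc d Z (vmul X Y) r = cc d Z X r + cc d Z Y r.
Proof. by rewrite -(ccC lnq0 (vmul X Y)) -(ccC lnq0 X) -(ccC lnq0 Y) ccDl. Qed.

Lemma ccNl X Z r : cc d (vinv X) Z r = - cc d X Z r.
Proof.
rewrite !ccE /brk -mulrN -sumrN; congr (_ * _); apply: eq_bigr => j _ /=.
by rewrite !mulNr.
Qed.

Lemma ccNr X Z r : cc d Z (vinv X) r = - cc d Z X r.
Proof. by rewrite -(ccC lnq0 (vinv X)) -(ccC lnq0 X) ccNl. Qed.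

Lemma ccZr x X Z r : cc d Z (vscale x X) r = x ^ r * cc d Z X r.
Proof. by rewrite !ccE brk_vscaler mulrCA. Qed.

Lemma ccZl x X Z r : cc d (vscale x X) Z r = x ^ (- r) * cc d X Z r.
Proof. by rewrite -(ccC lnq0 Z) -(ccC lnq0 Z X) ccZr. Qed.

Lemma kappa_neq0 r : r != 0 -> kappa d r != 0.
Proof.
move=> r0; rewrite (kappaE d r (colors_shift 0)) !mulf_neq0 //; exact: sh_expz4_neq1.
Qed.

Lemma Clast_neq0 : Clast d != 0.
Proof. by rewrite /Clast; case: lastf; rewrite ?invr_neq0 ?sh_neq0 ?s_neq0. Qed.

Lemma a_neq0 i : a_ d i != 0.
Proof.
rewrite mulf_neq0 ?invr_neq0 ?Clast_neq0 //  prodf_seq_neq0; apply/allP => j _.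
by rewrite /= invr_neq0 // s_neq0.
Qed.

Lemma a_ell : a_ d l = (Clast d)^-1.
Proof. by rewrite /a_ big_geq ?mulr1. Qed.

Lemma a_rec i : (i < l)%N -> a_ d i = a_ d i.+1 / s_ d (c i.+1).
Proof. by move=> il; rewrite /a_ big_ltn // mulrCA mulrC. Qed.

Section Positive.
Variable r : int.
Hypothesis r_gt0 : 0 < r.
Let r0 : r != 0. Proof. by rewrite gt_eqF. Qed.
Local Notation A i := (a_ d i ^ r).
Local Notation S j := (s_ d (c j) ^ r).
Local Notation Q j := (q_ d (c j) ^ r).
Local Notation k := (kappa d r).
Local Notation D := (Clast d ^ r).

Lemma a_expz_neq0 i : A i != 0. Proof. by rewrite expfz_neq0 // a_neq0. Qed.
Lemma s_expz_neq0 x : s_ d x ^ r != 0. Proof. by rewrite expfz_neq0 // s_neq0. Qed.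
Lemma q_s_expz x : q_ d x ^ r = (s_ d x ^ r) ^+ 2.
Proof. by rewrite -s2 exprz_AC. Qed.
Lemma q_expz_neq0 x : 1 - q_ d x ^ r != 0.
Proof. by rewrite q_expz sh_expz4_neq1. Qed.

Lemma boson_commE j : r%:~R * boson_comm d j r =
  if (j <= l)%N then (S j - (S j)^-1) / k else - k * (1 + D ^+ 2).
Proof.
have rr : r%:~R != 0 :> R[i] by rewrite intr_eq0.
rewrite /boson_comm; case: ifP => _.
  by rewrite -invr_expz; field; rewrite rr kappa_neq0 // s_expz_neq0.
rewrite gtr0_norm // (_ : Clast d ^ (2 * r) = D ^+ 2); last by rewrite mulrC -exprz_exp.
by field.
Qed.

Lemma cc_split X Y : cc d X Y r =
  \sum_(1 <= j < l.+1) osc X j r * osc Y j (- r) * ((S j - (S j)^-1) / k) -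
  osc X l.+1 r * osc Y l.+1 (- r) * (k * (1 + D ^+ 2)).
Proof.
have E (x y : R[i]) j : r%:~R * (x * y * boson_comm d j r) =
    x * y * (if (j <= l)%N then (S j - (S j)^-1) / k else - k * (1 + D ^+ 2)).
  by rewrite -boson_commE mulrCA.
rewrite !ccE /brk mulr_sumr big_nat_recr //=; congr (_ + _).
  by rewrite big_nat [RHS]big_nat; apply: eq_bigr => j /andP[_ jl]; rewrite E -ltnS jl.
by rewrite E ltnn mulNr mulrN.
Qed.

Lemma Nr_lt0 : (0 < - r) = false. Proof. by rewrite oppr_gt0 lt_gtF. Qed.
Lemma Nr_lt : (- r < 0) = true. Proof. by rewrite oppr_lt0. Qed.
Lemma r_lt0 : (r < 0) = false. Proof. exact: lt_gtF. Qed.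

Section Osc.
Variables (u : nat -> R[i]) (j : nat).
Hypothesis jl : (1 <= j <= l)%N.

Lemma Lambda_neg i : (i <= l)%N ->
  osc (Lambda d u j) i (- r) = if i == j then k / (1 - Q j) * A j else 0.
Proof.
move=> il; rewrite /Lambda /=; case: (ltngtP i j) => ij //=.
  by rewrite il /fac_scale /psip Nr_lt0 mul0r.
by rewrite /fac_scale /Vf Nr_lt0 opprK.
Qed.

Lemma Lambda_neg_last : osc (Lambda d u j) l.+1 (- r) = 0.
Proof.
case/andP: jl => _ jl'; rewrite /Lambda /= ltnNge (leqW jl') /= gtn_eqF // ltnn.
by rewrite /Kp Nr_lt0.
Qed.

Lemma Lambda_pos i : (i <= l)%N ->
  osc (Lambda d u j) i r =
  if (i < j)%N then 0 else if i == j then k / (1 - Q j) * S j / A j else k * S i / A i.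
Proof.
move=> il; rewrite /Lambda /=; case: (ltngtP i j) => ij //=.
  rewrite il /fac_scale /psip r_gt0 exprzMl ?unitfE ?invr_neq0 ?s_neq0 ?a_neq0 //.
  by rewrite exprz_inv opprK -invr_expz mulrA.
by rewrite /fac_scale /Vf r_gt0 -invr_expz.
Qed.

Lemma Lambda_pos_last : osc (Lambda d u j) l.+1 r = 1.
Proof.
case/andP: jl => _ jl'; rewrite /Lambda /= ltnNge (leqW jl') /= gtn_eqF // ltnn.
by rewrite /Kp r_gt0.
Qed.

Lemma Lambdab_neg i : (i <= l)%N ->
  osc (Lambdab d u j) i (- r) =
  if (i < j)%N then 0 else if i == j then - (k / (1 - Q j) / A j) else - (k / A i).
Proof.
move=> il; rewrite /Lambdab /=; case: (ltngtP i j) => ij //=.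
  by rewrite il /fac_inv /fac_scale /psim Nr_lt !opprK expzV.
by rewrite /fac_inv /fac_scale /Vf Nr_lt0 !opprK expzV.
Qed.

Lemma Lambdab_neg_last : osc (Lambdab d u j) l.+1 (- r) = 1.
Proof.
case/andP: jl => _ jl'; rewrite /Lambdab /= ltnNge (leqW jl') /= gtn_eqF // ltnn.
by rewrite /Km Nr_lt.
Qed.

Lemma Lambdab_pos i : (i <= l)%N ->
  osc (Lambdab d u j) i r = if i == j then - (k / (1 - Q j) * S j * A j) else 0.
Proof.
move=> il; rewrite /Lambdab /=; case: (ltngtP i j) => ij //=.
  by rewrite il /fac_inv /fac_scale /psim r_lt0 mul0r oppr0.
by rewrite /fac_inv /fac_scale /Vf r_gt0 exprz_inv opprK.
Qed.

Lemma Lambdab_pos_last : osc (Lambdab d u j) l.+1 r = 0.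
Proof.
case/andP: jl => _ jl'; rewrite /Lambdab /= ltnNge (leqW jl') /= gtn_eqF // ltnn.
by rewrite /Km r_lt0.
Qed.

(** The negative modes of [Lambda_j] sit in the factor [j] alone, so the sum over factors has one
    term. *)
Lemma cc_Lambda X : cc d X (Lambda d u j) r = - osc X j r * A j / S j.
Proof.
rewrite cc_split Lambda_neg_last mulr0 mul0r subr0.
have [K0 n] := (kappa_neq0 r0, q_expz_neq0 (c j)).
rewrite -(big_nat_single (fun _ => - osc X j r * A j / S j) jl).
rewrite big_nat [RHS]big_nat; apply: eq_bigr => i /andP[_ il].
rewrite Lambda_neg //; case: eqP => [->|_]; last by rewrite mulr0 mul0r.
move: n; rewrite q_s_expz.
move: (osc X j r) k (S j) (A j) (s_expz_neq0 (c j)) K0 => x K s a s0 K0 n.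
by field; rewrite K0 s0 n.
Qed.

Lemma cc_Lambdab X : cc d X (Lambdab d u j) r =
  osc X j r / (A j * S j) -
  \sum_(j.+1 <= i < l.+1) osc X i r * ((S i - (S i)^-1) / A i) -
  osc X l.+1 r * (k * (1 + D ^+ 2)).
Proof.
rewrite cc_split Lambdab_neg_last mulr1; congr (_ - _).
have [K0 n] := (kappa_neq0 r0, q_expz_neq0 (c j)).
rewrite -sumrN -(big_nat_from (fun i => - (osc X i r * ((S i - (S i)^-1) / A i))) _ jl).
rewrite big_nat [RHS]big_nat; apply: eq_bigr => i /andP[_ il].
rewrite Lambdab_neg //; case: ltngtP => ij; first by rewrite mulr0 mul0r.
  move: (osc X i r) k (S i) (A i) (s_expz_neq0 (c i)) (a_expz_neq0 i) K0 => x K s a s0 a0 K0.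
  by field; rewrite K0 s0 a0.
rewrite ij; move: n; rewrite q_s_expz.
move: (osc X j r) k (S j) (A j) (s_expz_neq0 (c j)) (a_expz_neq0 j) K0 => x K s a s0 a0 K0 n.
by field; rewrite K0 s0 n a0.
Qed.

(** The recursion [a_(i-1) = a_i / s_i] makes the sum telescope; the upper boundary term is
    [C_(l+1)^(2r)]. *)
Lemma tail_sum : \sum_(j.+1 <= i < l.+1) k * S i / A i * ((S i - (S i)^-1) / A i) =
  k * ((A j) ^- 2 - D ^+ 2).
Proof.
case/andP: jl => _ jl'.
have -> : D ^+ 2 = (A l) ^- 2 by rewrite a_ell expzV exprVn invrK.
pose f i := - (k * (A i) ^- 2).
rewrite big_add1 /= (_ : k * _ = f l - f j); last by rewrite /f; ring.
rewrite -(telescope_sumr f jl') big_nat [RHS]big_nat; apply: eq_bigr => i /andP[_ il].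
rewrite /f (a_rec il) mul_expz ?a_neq0 ?invr_neq0 ?s_neq0 // expzV.
move: k (S i.+1) (A i.+1) (s_expz_neq0 (c i.+1)) (a_expz_neq0 i.+1) => K s a s0 a0.
by field; rewrite s0 a0.
Qed.

(* X has the positive modes of K^+ in the factors j+1, ..., l+1 *)
Definition Ktail X := (forall i, (j < i <= l)%N -> osc X i r = k * S i / A i) /\ osc X l.+1 r = 1.

(** The boundary term of [tail_sum] cancels the summand [C_(l+1)^(2r)] of the commutator of the last
    boson [H], so the result does not depend on the last factor. *)
Lemma cc_Lambdab_tail X : Ktail X ->
  cc d X (Lambdab d u j) r = osc X j r / (A j * S j) - k / (A j) ^+ 2 - k.
Proof.
move=> [Xi Xl]; rewrite cc_Lambdab Xl mul1r.
rewrite (_ : \sum_(_ <= i < _) _ = k * ((A j) ^- 2 - D ^+ 2)); first by ring.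
rewrite -tail_sum big_nat [RHS]big_nat; apply: eq_bigr => i il.
by rewrite Xi.
Qed.

End Osc.

Section Pairs.
Variables (u w : nat -> R[i]) (i j : nat).
Hypotheses (il : (1 <= i <= l)%N) (jl : (1 <= j <= l)%N).

Lemma ccLL : cc d (Lambda d u i) (Lambda d w j) r =
  if (j < i)%N then 0 else if j == i then - k / (1 - Q i) else - k.
Proof.
have [j1 jl'] := andP jl; rewrite cc_Lambda // Lambda_pos //.
case: ltngtP => ij; first by rewrite oppr0 !mul0r.
  move: k (S j) (A j) (s_expz_neq0 (c j)) (a_expz_neq0 j) => K s a s0 a0.
  by field; rewrite s0 a0.
have := q_expz_neq0 (c i); rewrite ij.
move: k (Q i) (S i) (A i) (s_expz_neq0 (c i)) (a_expz_neq0 i) => K q s a s0 a0 n.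
by field; rewrite s0 a0 n.
Qed.

Lemma ccBL : cc d (Lambdab d u i) (Lambda d w j) r =
  if j == i then k * (A i) ^+ 2 / (1 - Q i) else 0.
Proof.
have [j1 jl'] := andP jl; rewrite cc_Lambda // Lambdab_pos //.
case: eqP => [->|_]; last by rewrite oppr0 !mul0r.
have := q_expz_neq0 (c i).
move: k (Q i) (S i) (A i) (s_expz_neq0 (c i)) => K q s a s0 n.
by field; rewrite s0 n.
Qed.

Lemma ccLB : cc d (Lambda d u i) (Lambdab d w j) r =
  - k + if j == i then k * Q i / (A i) ^+ 2 / (1 - Q i) else 0.
Proof.
have [j1 jl'] := andP jl; have [i1 il'] := andP il.
have Kt n : (i <= n)%N -> Ktail n (Lambda d u i).
  move=> ni; split=> [m /andP[nm ml]|]; last exact: Lambda_pos_last.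
  have im := leq_ltn_trans ni nm.
  by rewrite Lambda_pos // ltnNge (ltnW im) gtn_eqF.
case: (ltngtP j i) => ij; last 2 first.
- rewrite cc_Lambdab_tail; [|done|by apply: Kt; apply: ltnW].
  rewrite Lambda_pos // ltnNge (ltnW ij) gtn_eqF //=.
  move: k (S j) (A j) (s_expz_neq0 (c j)) (a_expz_neq0 j) => K s a s0 a0.
  by field; rewrite s0 a0.
- rewrite ij cc_Lambdab_tail; [|done|exact: Kt].
  rewrite Lambda_pos // ltnn eqxx; have := q_expz_neq0 (c i).
  move: k (Q i) (S i) (A i) (s_expz_neq0 (c i)) (a_expz_neq0 i) => K q s a s0 a0 n.
  by field; rewrite s0 a0 n.
rewrite cc_Lambdab // Lambda_pos // ij mul0r sub0r addr0 Lambda_pos_last // mul1r.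
rewrite (@big_nat_drop _ _ _ i) ?ij //; last first.
  by move=> n ni; rewrite Lambda_pos ?ni ?mul0r // (leq_trans (ltnW ni)).
(* For [j < i] the factors between [j] and [i] contribute nothing, so the telescoping sum starts
   after [i], whose own contribution is computed separately. *)
rewrite (_ : \sum_(_ <= n < _) _ = k * ((A i) ^- 2 - D ^+ 2)).
  rewrite Lambda_pos // ltnn eqxx.
  have := q_expz_neq0 (c i); rewrite q_s_expz.
  move: k D (S i) (A i) (s_expz_neq0 (c i)) (a_expz_neq0 i) => K D s a s0 a0 n.
  by field; rewrite s0 a0 n.
rewrite -(tail_sum il) big_nat [RHS]big_nat; apply: eq_bigr => n /andP[ni nl].
by rewrite Lambda_pos // ltnNge (ltnW ni) gtn_eqF.
Qed.

Lemma ccBB : cc d (Lambdab d u i) (Lambdab d w j) r =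
  if (i < j)%N then 0 else if j == i then - k / (1 - Q i) else - k.
Proof.
have [j1 jl'] := andP jl; have [i1 il'] := andP il.
rewrite cc_Lambdab // Lambdab_pos_last // mul0r subr0 Lambdab_pos //.
have z n : (n <= l)%N -> n != i -> osc (Lambdab d u i) n r = 0.
  by move=> nl /negPf ni; rewrite Lambdab_pos // ni.
case: (ltngtP i j) => ij.
- rewrite mul0r sub0r big_nat big1 ?oppr0 // => n /andP[jn nl].
  by rewrite z ?mul0r // gtn_eqF // (ltn_trans ij).
- rewrite (@big_nat_drop _ _ _ i) ?ij //; last first.
    by move=> n ni; rewrite z ?mul0r ?ltn_eqF // (leq_trans (ltnW ni)).
  rewrite big_nat big1 ?addr0 => [|n /andP[ni nl]]; last first.
    by rewrite z ?mul0r // gtn_eqF.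
  rewrite mul0r sub0r Lambdab_pos // eqxx.
  have := q_expz_neq0 (c i); rewrite q_s_expz.
  move: k (S i) (A i) (s_expz_neq0 (c i)) (a_expz_neq0 i) => K s a s0 a0 n.
  by field; rewrite s0 a0 n.
- rewrite -ij big_nat big1 ?subr0 => [|n /andP[ni nl]]; last first.
    by rewrite z ?mul0r // gtn_eqF.
  have := q_expz_neq0 (c i).
  move: k (Q i) (S i) (A i) (s_expz_neq0 (c i)) (a_expz_neq0 i) => K q s a s0 a0 n.
  by field; rewrite s0 a0 n.
Qed.

End Pairs.
End Positive.
End Table.

(** * The infinite product defining the dressing *)

Section Limits.
Import numFieldNormedType.Exports.
Local Open Scope classical_set_scope.
Local Open Scope complex_scope.

Lemma norm_complexE (R : realType) (x : R[i]) : exists2 t : R, 0 <= t & `|x| = t%:C.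
Proof.
by rewrite normc_def; eexists; last reflexivity; apply: sqrtr_ge0.
Qed.

Lemma limn_geometric (R : realType) (q x : R[i]) : `|q| < 1 ->
  limn (fun N : nat => (\sum_(0 <= n < N) x * q ^+ n) : (R[i] : numFieldType)) = x / (1 - q).
Proof.
move=> q1; have q0 : 1 - q != 0.
  by rewrite subr_eq0 eq_sym; apply: contraTneq q1 => ->; rewrite normr1 ltxx.
have E N : \sum_(0 <= n < N) x * q ^+ n = x / (1 - q) - x / (1 - q) * q ^+ N.
  elim: N => [|N IH]; first by rewrite big_geq // expr0 mulr1 subrr.
  by rewrite big_nat_recr //= IH exprS; field.
apply: cvg_lim; first exact: norm_hausdorff.
rewrite (funext E) /=; move: (x / (1 - q)) => y.
have [t t0 qt] := norm_complexE q; have [z z0 yz] := norm_complexE y.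
have t1 : `|t| < 1 by rewrite ger0_norm // -ltcR -qt.
apply/(@cvgrPdist_lt (R[i] : numFieldType) ((R[i] : numFieldType)^o)) => -[e e'] e0.
(* A positive element of [R[i]] is real, so the estimate reduces to the real geometric sequence of
   absolute values. *)
have [e'0 {}e0] : e' = 0 /\ 0 < e.
  by move: e0; rewrite ltcE /= => /andP[/eqP-> ->].
have /cvgr0Pnorm_lt/(_ e e0) := cvg_geometric z t1.
apply: filterS => N; rewrite /geometric /= => H.
rewrite opprB addrC subrK normrM normrX qt yz e'0 -rmorphXn -rmorphM /= ltcR.
by move: H; rewrite ger0_norm // mulr_ge0 // exprn_ge0.
Qed.

Variables (R : realType) (d : datum R).
Hypothesis mu1 : `|mu d| < 1.
Local Notation c := (colr d).
Local Notation l := (ell d).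

Lemma KKmu_pos j (r : int) : 0 < r ->
  osc (KKmu d) j r = osc (KK d) j r / (1 - mu d ^ r).
Proof.
case: r => // -[//|r] _.
have E : (fun N : nat => (\sum_(0 <= n < N) osc (vscale (mu d ^- n) (KK d)) j r.+1) : (R[i] : numFieldType)) =
    (fun N : nat => \sum_(0 <= n < N) osc (KK d) j r.+1 * (mu d ^ r.+1) ^+ n).
  apply/funext => N; apply: eq_bigr => n _; rewrite [LHS]/=; congr (_ * _).
  by rewrite exprz_inv opprK -!exprnP -!exprM mulnC.
rewrite [LHS]/= E; apply: limn_geometric.
by rewrite -exprnP normrX exprn_ilt1.
Qed.

Lemma KKmu_neg j (r : int) : r < 0 -> osc (KKmu d) j r = 0.
Proof.
move=> r0; have r1 : (0 < r) = false by apply: lt_gtF.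
have E : (fun N : nat => (\sum_(0 <= n < N) osc (vscale (mu d ^- n) (KK d)) j r) : (R[i] : numFieldType)) =
    (fun N : nat => \sum_(0 <= n < N) 0 * 0 ^+ n).
  apply/funext => N; apply: eq_bigr => n _; rewrite [LHS]/= mul0r.
  rewrite (_ : (if (j <= l)%N then _ else _) r = 0) ?mul0r //.
  by case: ifP => _; rewrite /fac_scale /psip /Kp r1 ?mul0r.
by rewrite [LHS]/= E limn_geometric ?mul0r // normr0.
Qed.

End Limits.

(** * The effect of the dressing on contractions *)

Section Dressing.
Variables (R : realType) (d : datum R).
Hypothesis lnq0 : \sum_(x < 3) lnq d x = 0.
Hypothesis gen : generic d.
Hypothesis mu1 : `|mu d| < 1.
Local Notation c := (colr d).
Local Notation l := (ell d).
Implicit Types (X Y Z : vertex R) (u : nat -> R[i]).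

Variable r : int.
Hypothesis r_gt0 : 0 < r.
Let r0 : r != 0. Proof. by rewrite gt_eqF. Qed.
Local Notation A i := (a_ d i ^ r).
Local Notation S j := (s_ d (c j) ^ r).
Local Notation k := (kappa d r).
Local Notation D := (Clast d ^ r).

Lemma KK_neg i : osc (KK d) i (- r) = 0.
Proof.
rewrite /KK /=; case: ifP => _; rewrite /fac_scale /psip /Kp (Nr_lt0 r_gt0) ?mul0r //.
Qed.

Lemma KK_pos i : (i <= l)%N -> osc (KK d) i r = k * S i / A i.
Proof.
move=> il; rewrite /KK /= il /fac_scale /psip r_gt0 mul_expz ?invr_neq0 ?s_neq0 ?a_neq0 //.
by rewrite expzV -!invr_expz invrK mulrA.
Qed.

Lemma KK_pos_last : osc (KK d) l.+1 r = 1.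
Proof. by rewrite /KK /= ltnn /Kp r_gt0. Qed.

Lemma KK_Ktail j : Ktail d r j (KK d).
Proof. by split=> [i /andP[_ /KK_pos]|] //; apply: KK_pos_last. Qed.

(** The dressing factor has positive modes only; for [r > 0] it contributes when it stands on the
    left, never on the right. *)
Lemma cc_KKmur X : cc d X (KKmu d) r = 0.
Proof.
rewrite !ccE /brk big1 ?mulr0 // => j _.
by rewrite KKmu_neg ?mulr0 ?mul0r // oppr_lt0.
Qed.

Lemma cc_KKmul X : cc d (KKmu d) X r = cc d (KK d) X r / (1 - mu d ^ r).
Proof.
rewrite !ccE /brk -mulrA mulr_suml; congr (_ * _); apply: eq_bigr => j _.
by rewrite (KKmu_pos mu1) //; move: (1 - _)^-1 => w; ring.
Qed.

Lemma cc_dressl X Z : cc d (dress d X) Z r = cc d X Z r - cc d (KK d) Z r / (1 - mu d ^ r).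
Proof. by rewrite /dress ccDl ccNl cc_KKmul. Qed.

Lemma cc_dressr X Z : cc d Z (dress d X) r = cc d Z X r.
Proof. by rewrite /dress (ccDr lnq0) (ccNr lnq0) cc_KKmur subr0. Qed.

(** The value is independent of [j] and is found again in [ccKB] and [ccK0]. Ratios of two terms
    therefore have trivial contraction with [KK], which is why the root currents of the nodes
    [i > 0] do not see the dressing. *)
Lemma ccKL u j : (1 <= j <= l)%N -> cc d (KK d) (Lambda d u j) r = - k.
Proof.
move=> jl; rewrite (cc_Lambda lnq0 gen r_gt0) // KK_pos; last by case/andP: jl.
move: k (S j) (A j) (s_expz_neq0 d r (c j)) (a_expz_neq0 d r j) => K s a s0 a0.
by field; rewrite s0 a0.
Qed.

Lemma ccKB u j : (1 <= j <= l)%N -> cc d (KK d) (Lambdab d u j) r = - k.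
Proof.
move=> jl; rewrite (cc_Lambdab_tail lnq0 gen r_gt0 u jl (KK_Ktail _)) KK_pos; last by case/andP: jl.
move: k (S j) (A j) (s_expz_neq0 d r (c j)) (a_expz_neq0 d r j) => K s a s0 a0.
by field; rewrite s0 a0.
Qed.

Section FockB.
Hypothesis lB : lastf d = FockB.
Local Notation s := (s_ d (c l.+1) ^ r).

Lemma D2 : D ^+ 2 = s.
Proof. by rewrite /Clast lB s_expz. Qed.

Lemma s1_neq0 : 1 + s != 0.
Proof. by rewrite s_expz sh_expz2_neqN1. Qed.

Lemma Lambda0_neg i : (i <= l)%N -> osc (Lambda0 d) i (- r) = 0.
Proof. by move=> il; rewrite /Lambda0 /= il. Qed.
Lemma Lambda0_pos i : (i <= l)%N -> osc (Lambda0 d) i r = 0.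
Proof. by move=> il; rewrite /Lambda0 /= il. Qed.
Lemma Lambda0_neg_last : osc (Lambda0 d) l.+1 (- r) = (1 + s)^-1.
Proof.
rewrite /Lambda0 /= ltnn /Kt /Ktm /Ktp /fac_scale (Nr_lt r_gt0) (Nr_lt0 r_gt0).
by rewrite mul0r addr0 opprK.
Qed.
Lemma Lambda0_pos_last : osc (Lambda0 d) l.+1 r = (1 + s)^-1.
Proof.
rewrite /Lambda0 /= ltnn /Kt /Ktm /Ktp /fac_scale (r_lt0 r_gt0) r_gt0.
rewrite add0r -invr_expz; have := s1_neq0; move: s (s_expz_neq0 d r (c l.+1)) => s s0 s1.
have s1' : s + 1 != 0 by rewrite addrC.
by field; rewrite ?s0 ?s1 ?s1'.
Qed.

(** In type B, [1 + C_(l+1)^(2r)] equals [1 + s^r] and cancels the denominator in the modes of the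
    current [Kt]. *)
Lemma cc_Lambda0 X : cc d X (Lambda0 d) r = - (osc X l.+1 r * k).
Proof.
rewrite (cc_split lnq0 gen r_gt0) Lambda0_neg_last D2 big_nat big1 => [|i /andP[_ il]]; last first.
  by rewrite Lambda0_neg // mulr0 mul0r.
by rewrite sub0r; congr (- _); field; exact: s1_neq0.
Qed.

Lemma ccL0 u i : (1 <= i <= l)%N -> cc d (Lambda d u i) (Lambda0 d) r = - k.
Proof. by move=> il; rewrite cc_Lambda0 Lambda_pos_last // mul1r. Qed.
Lemma ccB0 u i : (1 <= i <= l)%N -> cc d (Lambdab d u i) (Lambda0 d) r = 0.
Proof. by move=> il; rewrite cc_Lambda0 Lambdab_pos_last // mul0r oppr0. Qed.
Lemma ccK0 : cc d (KK d) (Lambda0 d) r = - k.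
Proof. by rewrite cc_Lambda0 KK_pos_last mul1r. Qed.
Lemma cc00 : cc d (Lambda0 d) (Lambda0 d) r = - k / (1 + s).
Proof. by rewrite cc_Lambda0 Lambda0_pos_last mulrC mulNr. Qed.
Lemma cc0L u j : (1 <= j <= l)%N -> cc d (Lambda0 d) (Lambda d u j) r = 0.
Proof.
move=> jl; rewrite (cc_Lambda lnq0 gen r_gt0) // Lambda0_pos ?oppr0 ?mul0r //.
by case/andP: jl.
Qed.
Lemma cc0B u j : (1 <= j <= l)%N -> cc d (Lambda0 d) (Lambdab d u j) r = - k.
Proof.
move=> jl; rewrite (cc_Lambdab lnq0 gen r_gt0) // Lambda0_pos_last Lambda0_pos; last by case/andP: jl.
rewrite mul0r sub0r D2 big_nat big1 => [|i /andP[_ il]]; last first.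
  by rewrite Lambda0_pos ?mul0r.
by rewrite oppr0 sub0r; congr (- _); field; exact: s1_neq0.
Qed.

End FockB.
End Dressing.

Lemma int_neq0_ind (P : int -> Prop) : (forall n, 0 < n -> P n) -> (forall n, 0 < n -> P (- n)) ->
  forall r, r != 0 -> P r.
Proof.
move=> Pp Pn r r0; case: (ltrgt0P r) => [/Pp //|rl|e]; last by rewrite e eqxx in r0.
by rewrite -(opprK r); apply: Pn; rewrite oppr_gt0.
Qed.

(** * Contractions of the root currents of the nodes [i > 0] with each dressed term *)

Section Profiles.
#[local] Opaque cc kappa q_ s_ sh a_ Lambda Lambdab Lambda0 KK KKmu.
Variables (R : realType) (d : datum R).
Hypothesis lnq0 : \sum_(x < 3) lnq d x = 0.
Hypothesis gen : generic d.
Hypothesis mu1 : `|mu d| < 1.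
Local Notation c := (colr d).
Local Notation l := (ell d).
Implicit Types (X Y Z : vertex R).
Variable u : nat -> R[i].
Local Notation L i := (Lambda d u i).
Local Notation B i := (Lambdab d u i).
Local Notation dr := (dress d).

(** Negative indices are read from the opposite order of contraction by [ccC]. There the dressed
    term stands on the left, so its dressing meets [A]; the third hypothesis says that this
    contributes nothing. *)
Lemma profile_split A Z (e : int -> R[i]) :
  (forall n, 0 < n -> cc d A Z n = e n) -> (forall n, 0 < n -> cc d Z A n = e (- n)) ->
  (forall n, 0 < n -> cc d (KK d) A n = 0) ->
  forall r, r != 0 -> cc d A (dr Z) r = e r.
Proof.
move=> Hp Hn HK; apply: int_neq0_ind => n n0; first by rewrite cc_dressr // Hp.
by rewrite ccC // cc_dressl // HK // mul0r subr0 Hn.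
Qed.

Definition rootv x X Y := vmul (vscale x X) (vinv (vscale x Y)).

Lemma cc_rootl x X Y Z r : cc d (rootv x X Y) Z r = x ^ (- r) * (cc d X Z r - cc d Y Z r).
Proof. by rewrite /rootv ccDl ccNl !(ccZl lnq0) mulrBr. Qed.

Lemma cc_rootr x X Y Z r : cc d Z (rootv x X Y) r = x ^ r * (cc d Z X r - cc d Z Y r).
Proof. by rewrite /rootv (ccDr lnq0) (ccNr lnq0) !ccZr mulrBr. Qed.

Lemma root_profile x X Y Z (a b a' b' e : int -> R[i]) :
  (forall n, 0 < n -> cc d X Z n = a n) -> (forall n, 0 < n -> cc d Y Z n = b n) ->
  (forall n, 0 < n -> cc d Z X n = a' n) -> (forall n, 0 < n -> cc d Z Y n = b' n) ->
  (forall n, 0 < n -> cc d (KK d) X n = cc d (KK d) Y n) ->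
  (forall n, 0 < n -> x ^ (- n) * (a n - b n) = e n) ->
  (forall n, 0 < n -> x ^ n * (a' n - b' n) = e (- n)) ->
  forall r, r != 0 -> cc d (rootv x X Y) (dr Z) r = e r.
Proof.
move=> Ha Hb Ha' Hb' HK He He'; apply: profile_split => n n0.
- by rewrite cc_rootl Ha // Hb // He.
- by rewrite cc_rootr Ha' // Hb' // He'.
- by rewrite cc_rootr HK // subrr mulr0.
Qed.

Lemma qexp1 x (n : int) : 0 < n -> 1 - q_ d x ^ n != 0.
Proof. by move=> n0; apply: q_expz_neq0. Qed.

Lemma q_expz_nz x (n : int) : q_ d x ^ n != 0.
Proof. by rewrite expfz_neq0 // q_neq0. Qed.


Let LL i j (jl : (1 <= j <= l)%N) n n0 := @ccLL _ d lnq0 gen n n0 u u i j jl.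
Let BL i j (jl : (1 <= j <= l)%N) n n0 := @ccBL _ d lnq0 gen n n0 u u i j jl.
Let LB i j (il : (1 <= i <= l)%N) (jl : (1 <= j <= l)%N) n n0 := @ccLB _ d lnq0 gen n n0 u u i j il jl.
Let BB i j (il : (1 <= i <= l)%N) (jl : (1 <= j <= l)%N) n n0 := @ccBB _ d lnq0 gen n n0 u u i j il jl.

Lemma cc_KLK i j n : (1 <= i <= l)%N -> (1 <= j <= l)%N -> 0 < n ->
  cc d (KK d) (L i) n = cc d (KK d) (L j) n.
Proof.
move=> il jl n0; have e1 := ccKL lnq0 gen n0 u il; have e2 := ccKL lnq0 gen n0 u jl.
exact: (etrans e1 (esym e2)).
Qed.

Lemma diff_profile X Y Z (a b a' b' e : int -> R[i]) :
  (forall n, 0 < n -> cc d X Z n = a n) -> (forall n, 0 < n -> cc d Y Z n = b n) ->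
  (forall n, 0 < n -> cc d Z X n = a' n) -> (forall n, 0 < n -> cc d Z Y n = b' n) ->
  (forall n, 0 < n -> cc d (KK d) X n = cc d (KK d) Y n) ->
  (forall n, 0 < n -> a n - b n = e n) ->
  (forall n, 0 < n -> a' n - b' n = e (- n)) ->
  forall r, r != 0 -> cc d (vmul X (vinv Y)) (dr Z) r = e r.
Proof.
move=> Ha Hb Ha' Hb' HK He He'; apply: profile_split => n n0.
- by rewrite ccDl ccNl Ha // Hb // He.
- by rewrite (ccDr lnq0) (ccNr lnq0) Ha' // Hb' // He'.
- by rewrite (ccDr lnq0) (ccNr lnq0) HK // subrr.
Qed.

Lemma cc_KLB i j n : (1 <= i <= l)%N -> (1 <= j <= l)%N -> 0 < n ->
  cc d (KK d) (L i) n = cc d (KK d) (B j) n.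
Proof.
move=> il jl n0; have e1 := ccKL lnq0 gen n0 u il; have e2 := ccKB lnq0 gen n0 u jl.
exact: (etrans e1 (esym e2)).
Qed.

Lemma qs1 x (n : int) : 0 < n -> 1 - (s_ d x ^ n) ^+ 2 != 0.
Proof. by move=> n0; rewrite -q_s_expz; apply: qexp1. Qed.

Lemma qs1' x (n : int) : 0 < n -> (s_ d x ^ n) ^+ 2 - 1 != 0.
Proof. by move=> n0; rewrite -opprB oppr_eq0 qs1. Qed.

Section Mid.
Variable i : nat.
Hypothesis il : (1 <= i < l)%N.
Let i1 : (1 <= i <= l)%N. Proof. by case/andP: il => -> /ltnW. Qed.
Let i2 : (1 <= i.+1 <= l)%N. Proof. by case/andP: il. Qed.
Let x := (a_ d i)^-1.
Local Notation A := (rootv x (L i) (L i.+1)).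

Lemma xV n : x ^ (- n) = a_ d i ^ n.
Proof. by rewrite /x expzV -invr_expz invrK. Qed.
Lemma xE n : x ^ n = (a_ d i ^ n)^-1.
Proof. by rewrite /x expzV. Qed.

Lemma midK n : 0 < n -> cc d (KK d) (L i) n = cc d (KK d) (L i.+1) n.
Proof. exact: cc_KLK. Qed.

Lemma midL r : r != 0 -> cc d A (dr (L i)) r = - a_ d i ^ r * kappa d r / (1 - q_ d (c i) ^ r).
Proof.
move: r; apply: (root_profile (LL i i1) (LL i.+1 i1) (LL i i1) (LL i i2) midK) => n n0.
  rewrite xV ltnn eqxx ltnSn.
  by move: (a_ d i ^ n) (kappa d n) (1 - _) => a k q; ring.
rewrite xE ltnn eqxx ltnNge leqnSn gtn_eqF //= (kappaN lnq0) -!invr_expz q_s_expz.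
have := qs1 (c i) n0; have := qs1' (c i) n0.
move: (kappa d n) (a_ d i ^ n) (s_ d (c i) ^ n) (a_expz_neq0 d n i) (s_expz_neq0 d n (c i)) => k a q a0 q0 n1 n2.
by field; rewrite ?a0 ?q0 ?n1 ?n2.
Qed.

Lemma midL1 r : r != 0 -> cc d A (dr (L i.+1)) r =
  a_ d i ^ r * q_ d (c i.+1) ^ r * kappa d r / (1 - q_ d (c i.+1) ^ r).
Proof.
move: r; apply: (root_profile (LL i i2) (LL i.+1 i2) (LL i.+1 i1) (LL i.+1 i2) midK) => n n0.
  rewrite xV ltnn eqxx ltnNge leqnSn gtn_eqF //= q_s_expz.
  have := qs1 (c i.+1) n0.
  by move: (a_ d i ^ n) (kappa d n) (s_ d (c i.+1) ^ n) => a k q n1; field.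
rewrite xE ltnn eqxx ltnSn (kappaN lnq0) -!invr_expz q_s_expz.
have := qs1 (c i.+1) n0; have := qs1' (c i.+1) n0.
move: (kappa d n) (a_ d i ^ n) (s_ d (c i.+1) ^ n) (a_expz_neq0 d n i) (s_expz_neq0 d n (c i.+1)) => k a q a0 q0 n1 n2.
by field; rewrite ?a0 ?q0 ?n1 ?n2.
Qed.

Lemma a_next n : a_ d i.+1 ^ n = a_ d i ^ n * s_ d (c i.+1) ^ n.
Proof.
rewrite (@a_rec _ d i); last by case/andP: il.
by rewrite mul_expz ?a_neq0 ?invr_neq0 ?s_neq0 // expzV divfK // s_expz_neq0.
Qed.

(** With [midB], this is the profile of [midL] and [midL1] with [a_i] inverted and the roles of [i]
    and [i+1] exchanged, so the barred terms form a pair of the same kind. *)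
Lemma midB1 r : r != 0 -> cc d A (dr (B i.+1)) r =
  - (a_ d i)^-1 ^ r * kappa d r / (1 - q_ d (c i.+1) ^ r).
Proof.
move: r; apply: (root_profile (LB i1 i2) (LB i2 i2) (BL i.+1 i1) (BL i.+1 i2) midK) => n n0.
  rewrite xV eqxx gtn_eqF //= q_s_expz a_next expzV.
  have := qs1 (c i.+1) n0; have := qs1' (c i.+1) n0.
  move: (kappa d n) (a_ d i ^ n) (s_ d (c i.+1) ^ n) (a_expz_neq0 d n i) (s_expz_neq0 d n (c i.+1)) => k a q a0 q0 n1 n2.
  by field; rewrite ?a0 ?q0 ?n1 ?n2.
rewrite xE eqxx ltn_eqF //= q_s_expz a_next expzV (kappaN lnq0) -!invr_expz q_s_expz.
have := qs1 (c i.+1) n0; have := qs1' (c i.+1) n0.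
move: (kappa d n) (a_ d i ^ n) (s_ d (c i.+1) ^ n) (a_expz_neq0 d n i) (s_expz_neq0 d n (c i.+1)) => k a q a0 q0 n1 n2.
by field; rewrite ?a0 ?q0 ?n1 ?n2.
Qed.

Lemma midB r : r != 0 -> cc d A (dr (B i)) r =
  (a_ d i)^-1 ^ r * q_ d (c i) ^ r * kappa d r / (1 - q_ d (c i) ^ r).
Proof.
move: r; apply: (root_profile (LB i1 i1) (LB i2 i1) (BL i i1) (BL i i2) midK) => n n0.
  rewrite xV eqxx ltn_eqF //= q_s_expz expzV.
  have := qs1 (c i) n0; have := qs1' (c i) n0.
  move: (kappa d n) (a_ d i ^ n) (s_ d (c i) ^ n) (a_expz_neq0 d n i) (s_expz_neq0 d n (c i)) => k a q a0 q0 n1 n2.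
  by field; rewrite ?a0 ?q0 ?n1 ?n2.
rewrite xE eqxx gtn_eqF //= expzV (kappaN lnq0) -!invr_expz q_s_expz.
have := qs1 (c i) n0; have := qs1' (c i) n0.
move: (kappa d n) (a_ d i ^ n) (s_ d (c i) ^ n) (a_expz_neq0 d n i) (s_expz_neq0 d n (c i)) => k a q a0 q0 n1 n2.
by field; rewrite ?a0 ?q0 ?n1 ?n2.
Qed.

Section Zero.
Variable j : nat.
Hypotheses (jl : (1 <= j <= l)%N) (ji : j != i) (ji1 : j != i.+1).

Lemma midL_eq0 r : r != 0 -> cc d A (dr (L j)) r = 0.
Proof.
move: r; apply: (root_profile (e := fun _ => 0) (LL i jl) (LL i.+1 jl) (LL j i1) (LL j i2) midK) => n n0.
  rewrite (negPf ji) (negPf ji1).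
  have -> : (j < i.+1)%N = (j < i)%N by move: ji; clear; lia.
  by case: ifP => _; rewrite subrr mulr0.
rewrite (eq_sym i) (eq_sym i.+1) (negPf ji) (negPf ji1).
have -> : (i.+1 < j)%N = (i < j)%N by move: ji ji1; clear; lia.
by case: ifP => _; rewrite subrr mulr0.
Qed.

Lemma midB_eq0 r : r != 0 -> cc d A (dr (B j)) r = 0.
Proof.
move: r; apply: (root_profile (e := fun _ => 0) (LB i1 jl) (LB i2 jl) (BL j i1) (BL j i2) midK) => n n0.
  by rewrite (negPf ji) (negPf ji1) subrr mulr0.
by rewrite (eq_sym i) (eq_sym i.+1) (negPf ji) (negPf ji1) subrr mulr0.
Qed.
End Zero.

Lemma mid0_eq0 r : lastf d = FockB -> r != 0 -> cc d A (dr (Lambda0 d)) r = 0.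
Proof.
move=> lB; move: r; apply: (root_profile (e := fun _ => 0)
  (fun n n0 => @ccL0 _ d lnq0 gen n n0 lB u i i1) (fun n n0 => @ccL0 _ d lnq0 gen n n0 lB u i.+1 i2)
  (fun n n0 => @cc0L _ d lnq0 gen n n0 u i i1) (fun n n0 => @cc0L _ d lnq0 gen n n0 u i.+1 i2) midK) => n n0;
  by rewrite subrr mulr0.
Qed.

End Mid.
Section LastB.
Hypotheses (lB : lastf d = FockB) (l1 : (1 <= l)%N).
Let ll : (1 <= l <= l)%N. Proof. by rewrite l1 leqnn. Qed.
Let x := (a_ d l)^-1.
Local Notation A := (rootv x (L l) (Lambda0 d)).
Local Notation s := (s_ d (c l.+1)).
Let L0 i (il : (1 <= i <= l)%N) n n0 := @ccL0 _ d lnq0 gen n n0 lB u i il.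
Let B0 i (il : (1 <= i <= l)%N) n n0 := @ccB0 _ d lnq0 gen n n0 lB u i il.
Let OL i (il : (1 <= i <= l)%N) n n0 := @cc0L _ d lnq0 gen n n0 u i il.
Let OB i (il : (1 <= i <= l)%N) n n0 := @cc0B _ d lnq0 gen n n0 lB u i il.
Let O0 n n0 := @cc00 _ d lnq0 gen n n0 lB.

Lemma lastB_K n : 0 < n -> cc d (KK d) (L l) n = cc d (KK d) (Lambda0 d) n.
Proof.
move=> n0; have e1 := ccKL lnq0 gen n0 u ll; have e2 := ccK0 lnq0 gen n0 lB.
exact: (etrans e1 (esym e2)).
Qed.

Lemma a_ell2 n : (a_ d l ^ n) ^+ 2 = (s ^ n)^-1.
Proof. by rewrite a_ell expzV exprVn /Clast lB s_expz. Qed.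

Lemma lastB_xV n : x ^ (- n) = a_ d l ^ n.
Proof. by rewrite /x expzV -invr_expz invrK. Qed.
Lemma lastB_xE n : x ^ n = (a_ d l ^ n)^-1.
Proof. by rewrite /x expzV. Qed.

Lemma lastB_L r : r != 0 -> cc d A (dr (L l)) r = - a_ d l ^ r * kappa d r / (1 - q_ d (c l) ^ r).
Proof.
move: r; apply: (root_profile (LL l ll) (OL ll) (LL l ll) (L0 ll) lastB_K) => n n0.
  rewrite lastB_xV ltnn eqxx.
  by move: (a_ d l ^ n) (kappa d n) (1 - _) => a k q; ring.
rewrite lastB_xE ltnn eqxx (kappaN lnq0) -!invr_expz q_s_expz.
have := qs1 (c l) n0; have := qs1' (c l) n0.
move: (kappa d n) (a_ d l ^ n) (s_ d (c l) ^ n) (a_expz_neq0 d n l) (s_expz_neq0 d n (c l)) => k a q a0 q0 n1 n2.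
by field; rewrite ?a0 ?q0 ?n1 ?n2.
Qed.

Lemma lastB_0 r : r != 0 -> cc d A (dr (Lambda0 d)) r = - a_ d l ^ r * kappa d r * s ^ r / (1 + s ^ r).
Proof.
move: r; apply: (root_profile (L0 ll) O0 (OL ll) O0 lastB_K) => n n0.
  rewrite lastB_xV; have := s1_neq0 lnq0 gen n0.
  by move: (a_ d l ^ n) (kappa d n) (s ^ n) => a k q q0; field.
rewrite lastB_xE (kappaN lnq0) -!invr_expz.
have s1 := s1_neq0 lnq0 gen n0; have s2 : s ^ n + 1 != 0 by rewrite addrC.
move: (kappa d n) (a_ d l ^ n) (s ^ n) (a_expz_neq0 d n l) (s_expz_neq0 d n (c l.+1)) s1 s2 => k a q a0 q0 n1 n2.
by field; rewrite ?a0 ?q0 ?n1 ?n2.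
Qed.

Lemma lastB_B r : r != 0 ->
  cc d A (dr (B l)) r = a_ d l ^ r * s ^ r * q_ d (c l) ^ r * kappa d r / (1 - q_ d (c l) ^ r).
Proof.
have aE n : s ^ n = (a_ d l ^ n) ^- 2 by rewrite a_ell2 invrK.
move: r; apply: (root_profile (LB ll ll) (OB ll) (BL l ll) (B0 ll) lastB_K) => n n0.
  rewrite lastB_xV eqxx aE q_s_expz.
  have := qs1 (c l) n0; have := qs1' (c l) n0.
  move: (kappa d n) (a_ d l ^ n) (s_ d (c l) ^ n) (a_expz_neq0 d n l) (s_expz_neq0 d n (c l)) => k a q a0 q0 n1 n2.
  by field; rewrite ?a0 ?q0 ?n1 ?n2.
rewrite lastB_xE eqxx aE (kappaN lnq0) -!invr_expz q_s_expz.
have := qs1 (c l) n0; have := qs1' (c l) n0.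
move: (kappa d n) (a_ d l ^ n) (s_ d (c l) ^ n) (a_expz_neq0 d n l) (s_expz_neq0 d n (c l)) => k a q a0 q0 n1 n2.
by field; rewrite ?a0 ?q0 ?n1 ?n2.
Qed.

Section Zero.
Variable j : nat.
Hypothesis jl : (1 <= j < l)%N.
Let jl' : (1 <= j <= l)%N. Proof. by case/andP: jl => -> /ltnW. Qed.
Let jlt : (j < l)%N. Proof. by case/andP: jl. Qed.

Lemma lastB_L_eq0 r : r != 0 -> cc d A (dr (L j)) r = 0.
Proof.
move: r; apply: (root_profile (e := fun _ => 0) (LL l jl') (OL jl') (LL j ll) (L0 jl') lastB_K) => n n0.
  by rewrite jlt subrr mulr0.
by rewrite ltnNge ltnW // gtn_eqF //= subrr mulr0.
Qed.

Lemma lastB_B_eq0 r : r != 0 -> cc d A (dr (B j)) r = 0.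
Proof.
move: r; apply: (root_profile (e := fun _ => 0) (LB ll jl') (OB jl') (BL j ll) (B0 jl') lastB_K) => n n0.
  by rewrite ltn_eqF // addr0 subrr mulr0.
by rewrite gtn_eqF // subrr mulr0.
Qed.
End Zero.
End LastB.

Section LastCD.
Hypotheses (lC : lastf d = FockCD) (l1 : (1 <= l)%N).
Let ll : (1 <= l <= l)%N. Proof. by rewrite l1 leqnn. Qed.
Local Notation s := (s_ d (c l.+1)).

Lemma a_ell_CD n : a_ d l ^ n = s ^ n.
Proof. by rewrite a_ell /Clast lC invrK. Qed.

Section TypeC.
Local Notation A := (vmul (L l) (vinv (B l))).

Lemma typeC_K n : 0 < n -> cc d (KK d) (L l) n = cc d (KK d) (B l) n.
Proof. exact: cc_KLB. Qed.

Lemma typeC_L r : r != 0 -> cc d A (dr (L l)) r =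
  - kappa d r * (1 + q_ d (c l.+1) ^ r) / (1 - q_ d (c l) ^ r).
Proof.
move: r; apply: (diff_profile (LL l ll) (BL l ll) (LL l ll) (LB ll ll) typeC_K) => n n0.
  rewrite ltnn eqxx a_ell_CD !q_s_expz; have := qs1 (c l) n0.
  by move: (s ^ n) (s_ d (c l) ^ n) (kappa d n) => t q k n1; field.
rewrite ltnn eqxx a_ell_CD (kappaN lnq0) -!invr_expz !q_s_expz.
have := qs1 (c l) n0; have := qs1' (c l) n0.
move: (kappa d n) (s ^ n) (s_ d (c l) ^ n) (s_expz_neq0 d n (c l.+1)) (s_expz_neq0 d n (c l)) => k t q t0 q0 n1 n2.
by field; rewrite ?t0 ?q0 ?n1 ?n2.
Qed.

Lemma typeC_B r : r != 0 -> cc d A (dr (B l)) r =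
  kappa d r * q_ d (c l) ^ r * (1 + (q_ d (c l.+1) ^ r)^-1) / (1 - q_ d (c l) ^ r).
Proof.
move: r; apply: (diff_profile (LB ll ll) (BB ll ll) (BL l ll) (BB ll ll) typeC_K) => n n0.
  rewrite ltnn eqxx a_ell_CD !q_s_expz; have := qs1 (c l) n0.
  move: (s ^ n) (s_ d (c l) ^ n) (kappa d n) (s_expz_neq0 d n (c l.+1)) => t q k t0 n1.
  by field; rewrite ?t0 ?n1.
rewrite ltnn eqxx a_ell_CD (kappaN lnq0) -!invr_expz !q_s_expz.
have := qs1 (c l) n0; have := qs1' (c l) n0.
move: (kappa d n) (s ^ n) (s_ d (c l) ^ n) (s_expz_neq0 d n (c l.+1)) (s_expz_neq0 d n (c l)) => k t q t0 q0 n1 n2.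
by field; rewrite ?t0 ?q0 ?n1 ?n2.
Qed.

Section Zero.
Variable j : nat.
Hypothesis jl : (1 <= j < l)%N.
Let jl' : (1 <= j <= l)%N. Proof. by case/andP: jl => -> /ltnW. Qed.
Let jlt : (j < l)%N. Proof. by case/andP: jl. Qed.

Lemma typeC_L_eq0 r : r != 0 -> cc d A (dr (L j)) r = 0.
Proof.
move: r; apply: (diff_profile (e := fun _ => 0) (LL l jl') (BL l jl') (LL j ll) (LB jl' ll) typeC_K) => n n0.
  by rewrite jlt ltn_eqF // subrr.
by rewrite ltnNge ltnW // gtn_eqF //= addr0 subrr.
Qed.

Lemma typeC_B_eq0 r : r != 0 -> cc d A (dr (B j)) r = 0.
Proof.
move: r; apply: (diff_profile (e := fun _ => 0) (LB ll jl') (BB ll jl') (BL j ll) (BB jl' ll) typeC_K) => n n0.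
  by rewrite ltn_eqF // ltnNge ltnW //= addr0 subrr.
by rewrite gtn_eqF // jlt subrr.
Qed.
End Zero.
End TypeC.

Section TypeD.
Hypotheses (cl : c l = c l.+1) (l2 : (2 <= l)%N).
Local Notation p := l.-1.
Let pl : (1 <= p <= l)%N. Proof. by case: (ell d) l2 => [|[|n]] //= _; rewrite leqnSn. Qed.
Let plt : (p < l)%N. Proof. by rewrite prednK. Qed.
Local Notation A := (vmul (L p) (vinv (B l))).

Lemma a_pred n : a_ d p ^ n = 1.
Proof.
have -> : a_ d p = 1.
  by rewrite (a_rec plt) prednK // a_ell /Clast lC invrK cl divff ?s_neq0.
exact: exp1rz.
Qed.

Lemma typeD_K n : 0 < n -> cc d (KK d) (L p) n = cc d (KK d) (B l) n.
Proof. exact: cc_KLB. Qed.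

Lemma typeD_Lp r : r != 0 -> cc d A (dr (L p)) r = - 1 ^ r * kappa d r / (1 - q_ d (c p) ^ r).
Proof.
move: r; apply: (diff_profile (LL p pl) (BL l pl) (LL p pl) (LB pl ll) typeD_K) => n n0; rewrite !exp1rz.
  by rewrite ltnn eqxx ltn_eqF // subr0 !mulN1r.
rewrite ltnn eqxx gtn_eqF // (kappaN lnq0) -!invr_expz !q_s_expz.
have := qs1 (c p) n0; have := qs1' (c p) n0.
move: (kappa d n) (s_ d (c p) ^ n) (s_expz_neq0 d n (c p)) => k q q0 n1 n2.
by field; rewrite ?q0 ?n1 ?n2.
Qed.

Lemma typeD_L r : r != 0 -> cc d A (dr (L l)) r = - 1 ^ r * kappa d r / (1 - q_ d (c l) ^ r).
Proof.
move: r; apply: (diff_profile (LL p ll) (BL l ll) (LL l pl) (LB ll ll) typeD_K) => n n0; rewrite !exp1rz.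
  rewrite ltnNge ltnW // gtn_eqF //= eqxx a_ell_CD -cl q_s_expz; have := qs1 (c l) n0.
  by move: (s_ d (c l) ^ n) (kappa d n) => q k n1; field.
rewrite plt eqxx a_ell_CD -cl (kappaN lnq0) -!invr_expz !q_s_expz.
have := qs1 (c l) n0; have := qs1' (c l) n0.
move: (kappa d n) (s_ d (c l) ^ n) (s_expz_neq0 d n (c l)) => k q q0 n1 n2.
by field; rewrite ?q0 ?n1 ?n2.
Qed.

Lemma typeD_B r : r != 0 -> cc d A (dr (B l)) r =
  1 ^ r * q_ d (c l) ^ r * kappa d r / (1 - q_ d (c l) ^ r).
Proof.
move: r; apply: (diff_profile (LB pl ll) (BB ll ll) (BL l pl) (BB ll ll) typeD_K) => n n0; rewrite !exp1rz.
  rewrite ltnn gtn_eqF // eqxx q_s_expz; have := qs1 (c l) n0.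
  by move: (s_ d (c l) ^ n) (kappa d n) => q k n1; field.
rewrite ltnn ltn_eqF // eqxx (kappaN lnq0) -!invr_expz !q_s_expz.
have := qs1 (c l) n0; have := qs1' (c l) n0.
move: (kappa d n) (s_ d (c l) ^ n) (s_expz_neq0 d n (c l)) => k q q0 n1 n2.
by field; rewrite ?q0 ?n1 ?n2.
Qed.

Lemma typeD_Bp r : r != 0 -> cc d A (dr (B p)) r =
  1 ^ r * q_ d (c p) ^ r * kappa d r / (1 - q_ d (c p) ^ r).
Proof.
move: r; apply: (diff_profile (LB pl pl) (BB ll pl) (BL p pl) (BB pl ll) typeD_K) => n n0; rewrite !exp1rz.
  rewrite eqxx a_pred ltnNge ltnW // ltn_eqF //= q_s_expz; have := qs1 (c p) n0.
  by move: (s_ d (c p) ^ n) (kappa d n) => q k n1; field.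
rewrite eqxx a_pred plt (kappaN lnq0) -!invr_expz !q_s_expz.
have := qs1 (c p) n0; have := qs1' (c p) n0.
move: (kappa d n) (s_ d (c p) ^ n) (s_expz_neq0 d n (c p)) => k q q0 n1 n2.
by field; rewrite ?q0 ?n1 ?n2.
Qed.

Section Zero.
Variable j : nat.
Hypothesis jl : (1 <= j < p)%N.
Let jp : (j < p)%N. Proof. by case/andP: jl. Qed.
Let jlt : (j < l)%N. Proof. exact: ltn_trans jp plt. Qed.
Let jl' : (1 <= j <= l)%N. Proof. by case/andP: jl => -> _; rewrite ltnW. Qed.

Lemma typeD_L_eq0 r : r != 0 -> cc d A (dr (L j)) r = 0.
Proof.
move: r; apply: (diff_profile (e := fun _ => 0) (LL p jl') (BL l jl') (LL j pl) (LB jl' ll) typeD_K) => n n0.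
  by rewrite jp ltn_eqF // subrr.
by rewrite ltnNge ltnW // !gtn_eqF //= addr0 subrr.
Qed.

Lemma typeD_B_eq0 r : r != 0 -> cc d A (dr (B j)) r = 0.
Proof.
move: r; apply: (diff_profile (e := fun _ => 0) (LB pl jl') (BB ll jl') (BL j pl) (BB jl' ll) typeD_K) => n n0.
  by rewrite !ltn_eqF // ltnNge ltnW //= addr0 subrr.
by rewrite gtn_eqF // jlt subrr.
Qed.
End Zero.
End TypeD.
End LastCD.

End Profiles.

(** * The zeroth root current and the extra term *)

Section Node0.
Variables (R : realType) (d : datum R).
Hypothesis lnq0 : \sum_(x < 3) lnq d x = 0.
Hypothesis gen : generic d.
Hypothesis mu1 : `|mu d| < 1.
Local Notation c := (colr d).
Local Notation l := (ell d).
Hypothesis l1 : (1 <= l)%N.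
Implicit Types (X Y Z : vertex R).
Variable u : nat -> R[i].
Local Notation L i := (Lambda d u i).
Local Notation B i := (Lambdab d u i).
Local Notation dr := (dress d).
Local Notation h0 := (sh d (c 0)).
Local Notation A0 := (Defs.root0 d u).
Let i1 : (1 <= 1 <= l)%N. Proof. by rewrite l1. Qed.

Lemma Cc_neq0 : Cc d != 0.
Proof.
rewrite /Cc mulf_neq0 ?Clast_neq0 // prodf_seq_neq0; apply/allP => j _.
by rewrite /= s_neq0.
Qed.

Lemma muh_neq0 : muh d != 0.
Proof. by rewrite mulf_neq0 ?Cc_neq0 ?sh_neq0. Qed.

Lemma muh2 : muh d ^+ 2 = mu d.
Proof. by rewrite /muh /mu exprMn s_sh. Qed.

Lemma a_1 : a_ d 1 = s_ d (c 1) / Cc d.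
Proof.
rewrite /Cc big_ltn // /a_ prodfV !invfM mulrCA; congr (_ * _).
by rewrite mulrA divff ?s_neq0 // mul1r.
Qed.

Lemma mu_expz (r : int) : mu d ^ r = (muh d ^ r) ^+ 2.
Proof. by rewrite -muh2 exprz_AC. Qed.

Lemma mu_neq1 (n : int) : 0 < n -> 1 - (muh d ^ n) ^+ 2 != 0.
Proof.
move=> n0; rewrite -mu_expz subr_eq0 eq_sym.
apply: contraTneq isT => e.
have : `|mu d ^ n| < 1.
  by case: n n0 e => // -[//|n] _ _; rewrite -exprnP normrX exprn_ilt1.
by rewrite e normr1 ltxx.
Qed.

Lemma h_neq0 (r : int) : h0 ^ r != 0. Proof. exact: sh_expz_neq0. Qed.
Lemma m_neq0 (r : int) : muh d ^ r != 0. Proof. by rewrite expfz_neq0 // muh_neq0. Qed.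

Lemma hsum (r : int) : h0 ^ r + h0 ^ (- r) = (1 + (h0 ^ r) ^+ 2) / h0 ^ r.
Proof. by rewrite -invr_expz; have := h_neq0 r; move: (h0 ^ r) => h h0'; field. Qed.

Let Q := vmul (vscale (muh d)^-1 (dr (B 1))) (vinv (vscale (muh d) (dr (L 1)))).

Lemma cc_root0l Z (r : int) : cc d A0 Z r = cc d Q Z r / (h0 ^ r + h0 ^ (- r)).
Proof.
rewrite !ccE /brk -mulrA mulr_suml; congr (_ * _); apply: eq_bigr => j _.
rewrite (_ : osc A0 j r = osc Q j r / (h0 ^ r + h0 ^ (- r))) //.
by move: (osc Q j r) (osc Z j (- r)) (boson_comm d j r) (h0 ^ r + _) => x y z w; ring.
Qed.

Lemma cc_Q Z (r : int) : cc d Q Z r = muh d ^ r * cc d (dr (B 1)) Z r - (muh d ^ r)^-1 * cc d (dr (L 1)) Z r.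
Proof.
by rewrite /Q ccDl ccNl !(ccZl lnq0) expzV -!invr_expz invrK.
Qed.

Lemma cc_root0r Z (r : int) : cc d Z A0 r =
  ((muh d ^ r)^-1 * cc d Z (dr (B 1)) r - muh d ^ r * cc d Z (dr (L 1)) r) / (h0 ^ r + h0 ^ (- r)).
Proof.
rewrite -(ccC lnq0 A0) cc_root0l cc_Q !(ccC lnq0) opprK [h0 ^ (- r) + _]addrC.
by rewrite -!invr_expz invrK.
Qed.

(** Dividing by [s_(c_0)^(r/2) + s_(c_0)^(-r/2)] in the definition of [A_0] makes the extra term a
    geometric mean: its contraction averages those of [Lambda_bar(1)(z)] and [Lambda_1(mu z)] with
    weights [s^r / (1 + s^r)] and [1 / (1 + s^r)], where [s = s_(c_0)]. *)
Lemma cc_Lambda0b Z (r : int) : r != 0 -> cc d Z (Lambda0b d u) r =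
  (s_ d (c 0) ^ r * cc d Z (dr (B 1)) r + mu d ^ r * cc d Z (dr (L 1)) r) / (1 + s_ d (c 0) ^ r).
Proof.
move=> r0; rewrite /Lambda0b (ccDr lnq0) (ccNr lnq0) ccZr cc_root0r mu_expz s_expz hsum.
rewrite mul_expz ?muh_neq0 ?invr_neq0 ?sh_neq0 // expzV.
have := sh_expz2_neqN1 lnq0 gen (c 0) r0; have := h_neq0 r; have := m_neq0 r.
move: (cc d Z (dr (B 1)) r) (cc d Z (dr (L 1)) r) (muh d ^ r) (h0 ^ r) => x y m h m0 h0' hh.
by field; rewrite m0 h0' hh.
Qed.

(** Dressing adds [kappa_n / (1 - mu^n)] to both contractions. They enter with weights [mu^(n/2)]
    and [- mu^(-n/2)], or the same weights exchanged, so the two geometric series collapse to one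
    correction by [kappa_n]. *)
Lemma node0_profile Z (a b a' b' e : int -> R[i]) :
  (forall n, 0 < n -> cc d (B 1) Z n = a n) -> (forall n, 0 < n -> cc d (L 1) Z n = b n) ->
  (forall n, 0 < n -> cc d Z (B 1) n = a' n) -> (forall n, 0 < n -> cc d Z (L 1) n = b' n) ->
  (forall n, 0 < n -> cc d (KK d) Z n = - kappa d n) ->
  (forall n, 0 < n -> (muh d ^ n * a n - (muh d ^ n)^-1 * (b n + kappa d n)) / (h0 ^ n + h0 ^ (- n)) = e n) ->
  (forall n, 0 < n -> ((muh d ^ n)^-1 * (a' n + kappa d n) - muh d ^ n * b' n) / (h0 ^ n + h0 ^ (- n)) = e (- n)) ->
  forall r, r != 0 -> cc d A0 (dr Z) r = e r.
Proof.
move=> Ha Hb Ha' Hb' HK He He'; apply: int_neq0_ind => n n0.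
  rewrite -He // cc_root0l cc_Q !(cc_dressr lnq0 n0) !(cc_dressl mu1 n0) HK // Ha // Hb //.
  congr (_ / _); rewrite mu_expz; have := mu_neq1 n0; have := m_neq0 n.
  by move: (muh d ^ n) (a n) (b n) (kappa d n) => m x y k m0 m1; field; rewrite m0 m1.
have KB := ccKB lnq0 gen n0 u i1; have KL := ccKL lnq0 gen n0 u i1.
rewrite -He' // (ccC lnq0) cc_root0r !(cc_dressr lnq0 n0) !(cc_dressl mu1 n0) Ha' // Hb' // KB KL.
congr (_ / _); rewrite mu_expz; have := mu_neq1 n0; have := m_neq0 n.
by move: (muh d ^ n) (a' n) (b' n) (kappa d n) => m x y k m0 m1; field; rewrite m0 m1.
Qed.

Let LL i j (jl : (1 <= j <= l)%N) n n0 := @ccLL _ d lnq0 gen n n0 u u i j jl.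
Let BL i j (jl : (1 <= j <= l)%N) n n0 := @ccBL _ d lnq0 gen n n0 u u i j jl.
Let LB i j (il : (1 <= i <= l)%N) (jl : (1 <= j <= l)%N) n n0 := @ccLB _ d lnq0 gen n n0 u u i j il jl.
Let BB i j (il : (1 <= i <= l)%N) (jl : (1 <= j <= l)%N) n n0 := @ccBB _ d lnq0 gen n n0 u u i j il jl.
Let KL i (il : (1 <= i <= l)%N) n n0 := @ccKL _ d lnq0 gen n n0 u i il.
Let KB i (il : (1 <= i <= l)%N) n n0 := @ccKB _ d lnq0 gen n n0 u i il.

Definition al0 := muh d * h0^-1.

Lemma al0_neq0 : al0 != 0.
Proof. by rewrite mulf_neq0 ?muh_neq0 ?invr_neq0 ?sh_neq0. Qed.

Lemma al0_expz (r : int) : al0 ^ r = muh d ^ r / h0 ^ r.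
Proof. by rewrite mul_expz ?muh_neq0 ?invr_neq0 ?sh_neq0 // expzV. Qed.

Lemma a1_expz (r : int) : a_ d 1 ^ r = s_ d (c 1) ^ r * h0 ^ r / muh d ^ r.
Proof.
rewrite a_1 /muh mul_expz ?s_neq0 ?invr_neq0 ?Cc_neq0 // expzV mul_expz ?Cc_neq0 ?sh_neq0 //.
have := h_neq0 r; have : Cc d ^ r != 0 by rewrite expfz_neq0 // Cc_neq0.
by move: (Cc d ^ r) (h0 ^ r) (s_ d (c 1) ^ r) => w h s w0 h0'; field; rewrite w0 h0'.
Qed.

Lemma node0_B (r : int) : r != 0 ->
  cc d A0 (dr (B 1)) r = - al0 ^ r * kappa d r / (1 - q_ d (c 1) ^ r).
Proof.
move: r; apply: (node0_profile (BB i1 i1) (LB i1 i1) (BB i1 i1) (BL 1 i1) (KB i1)) => n n0; rewrite ?ltnn ?eqxx.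
  rewrite al0_expz hsum a1_expz q_s_expz.
  have := qs1 lnq0 gen (c 1) n0; have := m_neq0 n; have := h_neq0 n.
  have := sh_expz2_neqN1 lnq0 gen (c 0) (lt0r_neq0 n0).
  move: (kappa d n) (muh d ^ n) (h0 ^ n) (s_ d (c 1) ^ n) (s_expz_neq0 d n (c 1)) => k m h q q0 hh h0' m0 n1.
  by field; rewrite q0 hh h0' m0 n1.
rewrite al0_expz hsum a1_expz (kappaN lnq0) -!invr_expz q_s_expz.
have := qs1 lnq0 gen (c 1) n0; have := qs1' lnq0 gen (c 1) n0; have := m_neq0 n; have := h_neq0 n.
have := sh_expz2_neqN1 lnq0 gen (c 0) (lt0r_neq0 n0).
move: (kappa d n) (muh d ^ n) (h0 ^ n) (s_ d (c 1) ^ n) (s_expz_neq0 d n (c 1)) => k m h q q0 hh h0' m0 n1 n2.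
by field; rewrite ?q0 ?hh ?h0' ?m0 ?n1 ?n2.
Qed.

Lemma node0_L (r : int) : r != 0 ->
  cc d A0 (dr (L 1)) r = (muh d ^ r)^-1 * h0 ^ r * q_ d (c 1) ^ r * kappa d r / (1 - q_ d (c 1) ^ r).
Proof.
move: r; apply: (node0_profile (BL 1 i1) (LL 1 i1) (LB i1 i1) (LL 1 i1) (KL i1)) => n n0; rewrite ?ltnn ?eqxx.
  rewrite hsum a1_expz q_s_expz.
  have := qs1 lnq0 gen (c 1) n0; have := m_neq0 n; have := h_neq0 n.
  have := sh_expz2_neqN1 lnq0 gen (c 0) (lt0r_neq0 n0).
  move: (kappa d n) (muh d ^ n) (h0 ^ n) (s_ d (c 1) ^ n) (s_expz_neq0 d n (c 1)) => k m h q q0 hh h0' m0 n1.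
  by field; rewrite hh h0' m0 n1.
rewrite hsum a1_expz (kappaN lnq0) -!invr_expz q_s_expz.
have := qs1 lnq0 gen (c 1) n0; have := qs1' lnq0 gen (c 1) n0; have := m_neq0 n; have := h_neq0 n.
have := sh_expz2_neqN1 lnq0 gen (c 0) (lt0r_neq0 n0).
move: (kappa d n) (muh d ^ n) (h0 ^ n) (s_ d (c 1) ^ n) (s_expz_neq0 d n (c 1)) => k m h q q0 hh h0' m0 n1 n2.
by field; rewrite ?q0 ?hh ?h0' ?m0 ?n1 ?n2.
Qed.

(** With [node0_B] and [node0_0b], these are exactly the profiles assumed for a type B chain, with
    [al = al0], [e = c_1] and [f = c_0]. The rescaling by [mu] is what puts [Lambda_1] in the right
    position. *)
Lemma node0_Lmu (r : int) : r != 0 -> cc d A0 (vscale (mu d) (dr (L 1))) r =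
  al0 ^ r * s_ d (c 0) ^ r * q_ d (c 1) ^ r * kappa d r / (1 - q_ d (c 1) ^ r).
Proof.
move=> r0; rewrite ccZr node0_L // al0_expz s_expz mu_expz.
have := m_neq0 r; have := h_neq0 r.
move: (kappa d r) (muh d ^ r) (h0 ^ r) (q_ d (c 1) ^ r) (1 - _)^-1 => k m h q w h0' m0.
by field; rewrite h0' m0.
Qed.

Lemma node0_0b (r : int) : r != 0 -> cc d A0 (Lambda0b d u) r =
  - al0 ^ r * kappa d r * s_ d (c 0) ^ r / (1 + s_ d (c 0) ^ r).
Proof.
move=> r0; rewrite cc_Lambda0b // node0_B // node0_L // al0_expz s_expz mu_expz q_expz.
have := sh_expz4_neq1 lnq0 gen (c 1) r0; have := sh_expz2_neqN1 lnq0 gen (c 0) r0.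
have := m_neq0 r; have := h_neq0 r.
move: (kappa d r) (muh d ^ r) (h0 ^ r) (sh d (c 1) ^ r) => k m h q h0' m0 hh n1.
by field; rewrite ?h0' ?m0 ?hh ?n1.
Qed.

Section Zero.
Variable j : nat.
Hypothesis jl : (2 <= j <= l)%N.
Let jl' : (1 <= j <= l)%N. Proof. by case/andP: jl => /ltnW -> ->. Qed.
Let j1 : (1 < j)%N. Proof. by case/andP: jl. Qed.

Lemma node0_L_eq0 (r : int) : r != 0 -> cc d A0 (dr (L j)) r = 0.
Proof.
move: r; apply: (node0_profile (e := fun _ => 0) (BL 1 jl') (LL 1 jl') (LB jl' i1) (LL j i1) (KL jl')) => n n0.
  by rewrite gtn_eqF // ltnNge ltnW //= addNr !mulr0 subrr mul0r.
by rewrite ltn_eqF // j1 addr0 addNr !mulr0 subrr mul0r.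
Qed.

Lemma node0_B_eq0 (r : int) : r != 0 -> cc d A0 (dr (B j)) r = 0.
Proof.
move: r; apply: (node0_profile (e := fun _ => 0) (BB i1 jl') (LB i1 jl') (BB jl' i1) (BL j i1) (KB jl')) => n n0.
  by rewrite gtn_eqF // j1 addr0 addNr !mulr0 subrr mul0r.
by rewrite ltn_eqF // ltnNge ltnW //= addNr !mulr0 subrr mul0r.
Qed.
End Zero.

Lemma node0_0_eq0 (r : int) : lastf d = FockB -> r != 0 -> cc d A0 (dr (Lambda0 d)) r = 0.
Proof.
move=> lB; move: r; apply: (node0_profile (e := fun _ => 0)
  (fun n n0 => @ccB0 _ d lnq0 gen n n0 lB u 1 i1) (fun n n0 => @ccL0 _ d lnq0 gen n n0 lB u 1 i1)
  (fun n n0 => @cc0B _ d lnq0 gen n n0 lB u 1 i1) (fun n n0 => @cc0L _ d lnq0 gen n n0 u 1 i1)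
  (fun n n0 => @ccK0 _ d lnq0 gen n n0 lB)) => n n0;
  by rewrite addNr !mulr0 subrr mul0r.
Qed.

Lemma root_of_B1 : root_of d A0 al0 (dr (B 1)) (Lambda0b d u).
Proof. by move=> j r jl r0; rewrite [osc (Lambda0b d u) j r]/= opprD addrA subrr add0r opprK. Qed.

Lemma root_of_L1mu :
  root_of d A0 (al0 * s_ d (c 0)) (Lambda0b d u) (vscale (mu d) (dr (L 1))).
Proof.
move=> j r jl r0.
have -> : osc (Lambda0b d u) j r = osc (dr (B 1)) j r - osc A0 j r * al0 ^ (- r) by [].
have -> : osc A0 j r = (osc (dr (B 1)) j r * (muh d)^-1 ^ (- r) - osc (dr (L 1)) j r * muh d ^ (- r))
   / (h0 ^ r + h0 ^ (- r)) by [].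
have -> : osc (vscale (mu d) (dr (L 1))) j r = osc (dr (L 1)) j r * mu d ^ (- r) by [].
rewrite hsum mul_expz ?al0_neq0 ?s_neq0 // expzV -!invr_expz al0_expz s_expz mu_expz.
have := sh_expz2_neqN1 lnq0 gen (c 0) r0; have := h_neq0 r; have := m_neq0 r.
move: (osc (dr (B 1)) j r) (osc (dr (L 1)) j r) (muh d ^ r) (h0 ^ r) => x y m h m0 h0' hh.
by field; rewrite m0 h0' hh.
Qed.

End Node0.

(** * The second presentation of each root current *)

Section RootOf.
Variables (R : realType) (d : datum R).
Hypothesis lnq0 : \sum_(x < 3) lnq d x = 0.
Hypothesis gen : generic d.
Local Notation c := (colr d).
Local Notation l := (ell d).
Implicit Types (X Y Z : vertex R).
Variable u : nat -> R[i].
Local Notation L i := (Lambda d u i).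
Local Notation B i := (Lambdab d u i).
Local Notation dr := (dress d).

Lemma osc_dress X j r : osc (dr X) j r = osc X j r - osc (KKmu d) j r.
Proof. by []. Qed.

Lemma root_of_root x X Y : x != 0 -> root_of d (rootv x^-1 X Y) x (dr X) (dr Y).
Proof.
move=> x0 j r jl r0; rewrite !osc_dress.
have -> : osc (rootv x^-1 X Y) j r = osc X j r * x^-1 ^ (- r) - osc Y j r * x^-1 ^ (- r) by [].
rewrite expzV -!invr_expz; have : x ^ r != 0 by rewrite expfz_neq0.
by move: (x ^ r) (osc X j r) (osc Y j r) (osc (KKmu d) j r) => y a b k y0; field.
Qed.

Lemma root_of_diff X Y : root_of d (vmul X (vinv Y)) 1 (dr X) (dr Y).
Proof.
move=> j r jl r0; rewrite !osc_dress.
have -> : osc (vmul X (vinv Y)) j r = osc X j r - osc Y j r by [].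
by rewrite exp1rz; move: (osc X j r) (osc Y j r) (osc (KKmu d) j r) => a b k; ring.
Qed.

(* The positive and the negative modes of X in the factors of the module and in
   the last factor. *)
Definition osc_spec X (p m : int -> nat -> R[i]) (pl ml : int -> R[i]) : Prop :=
  (forall n j, 0 < n -> (j <= l)%N -> osc X j n = p n j /\ osc X j (- n) = m n j) /\
  (forall n, 0 < n -> osc X l.+1 n = pl n /\ osc X l.+1 (- n) = ml n).

(** A link [X], [Y] at [g] yields a link [X'], [Y'] at [g'] once the two ratios agree after the
    rescaling by [g / g']. Positive and negative modes are compared separately, the last factor
    apart, since the modes are given by different formulas there. *)
Lemma root_of_transfer A g g' X Y X' Y' p1 m1 pl1 ml1 p2 m2 pl2 ml2 p3 m3 pl3 ml3 p4 m4 pl4 ml4 :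
  g != 0 -> g' != 0 ->
  osc_spec X p1 m1 pl1 ml1 -> osc_spec Y p2 m2 pl2 ml2 ->
  osc_spec X' p3 m3 pl3 ml3 -> osc_spec Y' p4 m4 pl4 ml4 ->
  root_of d A g (dr X) (dr Y) ->
  (forall n j, 0 < n -> (j <= l)%N -> (p1 n j - p2 n j) * (g / g') ^ n = p3 n j - p4 n j) ->
  (forall n j, 0 < n -> (j <= l)%N -> m1 n j - m2 n j = (m3 n j - m4 n j) * (g / g') ^ n) ->
  (forall n, 0 < n -> (pl1 n - pl2 n) * (g / g') ^ n = pl3 n - pl4 n) ->
  (forall n, 0 < n -> ml1 n - ml2 n = (ml3 n - ml4 n) * (g / g') ^ n) ->
  root_of d A g' (dr X') (dr Y').
Proof.
move=> g0 g'0 [s1 t1] [s2 t2] [s3 t3] [s4 t4] Ag Hp Hm Hpl Hml j r jl r0.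
have H n : 0 < n ->
    (osc X j n - osc Y j n) * (g / g') ^ n = osc X' j n - osc Y' j n /\
    osc X j (- n) - osc Y j (- n) = (osc X' j (- n) - osc Y' j (- n)) * (g / g') ^ n.
  move=> n0; case/andP: jl => _; rewrite leq_eqVlt => /orP[/eqP->|].
    have [-> ->] := t1 n n0; have [-> ->] := t2 n n0.
    by have [-> ->] := t3 n n0; have [-> ->] := t4 n n0; split; [apply: Hpl|apply: Hml].
  rewrite ltnS => jl.
  have [-> ->] := s1 n j n0 jl; have [-> ->] := s2 n j n0 jl.
  by have [-> ->] := s3 n j n0 jl; have [-> ->] := s4 n j n0 jl; split; [apply: Hp|apply: Hm].
have dd X1 Y1 k : osc (dr X1) j k - osc (dr Y1) j k = osc X1 j k - osc Y1 j k.
  by rewrite !osc_dress; move: (osc X1 j k) (osc Y1 j k) (osc (KKmu d) j k) => a b y; ring.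
have := Ag j r jl r0; rewrite !dd; move: r r0.
apply: (int_neq0_ind (P := fun r => osc A j r * g ^ (- r) = osc X j r - osc Y j r ->
  osc A j r * g' ^ (- r) = osc X' j r - osc Y' j r)) => n n0; have [Hp' Hn'] := H n n0.
  rewrite -Hp' => <-; rewrite mul_expz ?invr_neq0 // expzV -!invr_expz.
  have : g ^ n != 0 by rewrite expfz_neq0. have : g' ^ n != 0 by rewrite expfz_neq0.
  by move: (osc A j n) (g ^ n) (g' ^ n) => a x y y0 x0; field; rewrite x0 y0.
rewrite Hn' !opprK mul_expz ?invr_neq0 // expzV.
have : g ^ n != 0 by rewrite expfz_neq0. have : g' ^ n != 0 by rewrite expfz_neq0.
move: (osc A j (- n)) (osc X' j (- n) - _) (g ^ n) (g' ^ n) => a b x y y0 x0 e.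
have -> : a = b / y by apply: (mulIf x0); rewrite e mulrA mulrAC.
by field.
Qed.

Lemma L_spec i : (1 <= i <= l)%N -> osc_spec (L i)
  (fun n j => if (j < i)%N then 0
              else if j == i then kappa d n / (1 - q_ d (c i) ^ n) * s_ d (c i) ^ n / a_ d i ^ n
              else kappa d n * s_ d (c j) ^ n / a_ d j ^ n)
  (fun n j => if j == i then kappa d n / (1 - q_ d (c i) ^ n) * a_ d i ^ n else 0)
  (fun=> 1) (fun=> 0).
Proof.
move=> il; split=> [n j n0 jl|n n0]; split.
- exact: Lambda_pos.
- exact: Lambda_neg.
- exact: Lambda_pos_last.
- exact: Lambda_neg_last.
Qed.

Lemma B_spec i : (1 <= i <= l)%N -> osc_spec (B i)
  (fun n j => if j == i then - (kappa d n / (1 - q_ d (c i) ^ n) * s_ d (c i) ^ n * a_ d i ^ n) else 0)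
  (fun n j => if (j < i)%N then 0
              else if j == i then - (kappa d n / (1 - q_ d (c i) ^ n) / a_ d i ^ n)
              else - (kappa d n / a_ d j ^ n))
  (fun=> 0) (fun=> 1).
Proof.
move=> il; split=> [n j n0 jl|n n0]; split.
- exact: Lambdab_pos.
- exact: Lambdab_neg.
- exact: Lambdab_pos_last.
- exact: Lambdab_neg_last.
Qed.

(** The same root current links the barred terms in reverse order; this produces the second pair
    that cancels at a middle node. *)
Lemma root_of_mid A i : (1 <= i < l)%N ->
  root_of d A (a_ d i) (dr (L i)) (dr (L i.+1)) ->
  root_of d A (a_ d i)^-1 (dr (B i.+1)) (dr (B i)).
Proof.
move=> il; have i1 : (1 <= i <= l)%N by case/andP: il => -> /ltnW.
have i2 : (1 <= i.+1 <= l)%N by case/andP: il.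
have aV n : (a_ d i / (a_ d i)^-1) ^ n = (a_ d i ^ n) ^+ 2.
  by rewrite invrK mul_expz ?a_neq0.
have aV0 : (a_ d i)^-1 != 0 by rewrite invr_neq0 // a_neq0.
move=> Ag; apply: (root_of_transfer (a_neq0 d i) aV0 (L_spec i1) (L_spec i2) (B_spec i2) (B_spec i1) Ag).
- move=> n j n0 jl; rewrite aV !(a_next il) !q_s_expz.
  have := qs1 lnq0 gen (c i) n0; have := qs1 lnq0 gen (c i.+1) n0.
  have := a_expz_neq0 d n i; have := s_expz_neq0 d n (c i.+1).
  case: (ltngtP j i) => ji.
  + have [e1 e2] : (j == i.+1) = false /\ (j < i.+1)%N by split; [rewrite ltn_eqF // ltnW|rewrite ltnW].
    by rewrite ?e1 ?e2 !subrr ?mul0r.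
  + have e1 : (j < i.+1)%N = false by rewrite ltnS leqNgt ji.
    rewrite ?e1; case: (j =P i.+1) => [->|_]; last by rewrite !subrr ?mul0r.
    rewrite ?a_next //; move: (a_ d i ^ n) (s_ d (c i.+1) ^ n) (kappa d n) => a s k s0 a0 n1 n2.
    by field; rewrite a0 s0 n1.
  + rewrite ji ?ltnSn ltn_eqF //.
    move: (a_ d i ^ n) (s_ d (c i.+1) ^ n) (s_ d (c i) ^ n) (kappa d n) => a s t k s0 a0 n1 n2.
    by field; rewrite a0 n2.
- move=> n j n0 jl; rewrite aV !(a_next il) !q_s_expz.
  have := qs1 lnq0 gen (c i) n0; have := qs1 lnq0 gen (c i.+1) n0.
  have := a_expz_neq0 d n i; have := s_expz_neq0 d n (c i.+1).
  case: (ltngtP j i) => ji.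
  + have [e1 e2] : (j == i.+1) = false /\ (j < i.+1)%N by split; [rewrite ltn_eqF // ltnW|rewrite ltnW].
    by rewrite ?e1 ?e2 !subrr ?mul0r.
  + have e1 : (j < i.+1)%N = false by rewrite ltnS leqNgt ji.
    rewrite ?e1; case: (j =P i.+1) => [->|_]; last by rewrite !subrr ?mul0r.
    rewrite ?a_next //; move: (a_ d i ^ n) (s_ d (c i.+1) ^ n) (kappa d n) => a s k s0 a0 n1 n2.
    by field; rewrite a0 s0 n1.
  + rewrite ji ?ltnSn ltn_eqF //.
    move: (a_ d i ^ n) (s_ d (c i.+1) ^ n) (s_ d (c i) ^ n) (kappa d n) => a s t k s0 a0 n1 n2.
    by field; rewrite a0 n2.
- by move=> n n0; rewrite !subrr mul0r.
- by move=> n n0; rewrite !subrr mul0r.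
Qed.

Section LastB.
Hypotheses (lB : lastf d = FockB) (l1 : (1 <= l)%N).
Let ll : (1 <= l <= l)%N. Proof. by rewrite l1 leqnn. Qed.
Local Notation s := (s_ d (c l.+1)).

Lemma Lambda0_spec : osc_spec (Lambda0 d) (fun _ _ => 0) (fun _ _ => 0)
  (fun n => (1 + s ^ n)^-1) (fun n => (1 + s ^ n)^-1).
Proof.
split=> [n j n0 jl|n n0]; split.
- exact: Lambda0_pos.
- exact: Lambda0_neg.
- exact: Lambda0_pos_last.
- exact: Lambda0_neg_last.
Qed.

Lemma root_of_lastB A :
  root_of d A (a_ d l) (dr (L l)) (dr (Lambda0 d)) ->
  root_of d A (a_ d l * s) (dr (Lambda0 d)) (dr (B l)).
Proof.
have as0 : a_ d l * s != 0 by rewrite mulf_neq0 ?a_neq0 ?s_neq0.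
have gE n : (a_ d l / (a_ d l * s)) ^ n = (s ^ n)^-1.
  rewrite -expzV; congr (_ ^ _); have := s_neq0 d (c l.+1); have := a_neq0 d l.
  by move: (a_ d l) s => x y x0 y0; field; rewrite x0 y0.
move=> Ag; apply: (root_of_transfer (a_neq0 d l) as0 (L_spec ll) Lambda0_spec
  Lambda0_spec (B_spec ll) Ag).
- move=> n j n0; rewrite gE -(a_ell2 lB n) !q_s_expz; have := qs1 lnq0 gen (c l) n0.
  have := a_expz_neq0 d n l; case: (ltngtP j l) => [_|_|_] // + + _.
    by rewrite !subrr mul0r.
  move: (a_ d l ^ n) (s_ d (c l) ^ n) (kappa d n) => a t k a0 t1.
  by field; rewrite ?a0 ?t1.
- move=> n j n0; rewrite gE -(a_ell2 lB n) !q_s_expz; have := qs1 lnq0 gen (c l) n0.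
  have := a_expz_neq0 d n l; case: (ltngtP j l) => [_|_|_] // + + _.
    by rewrite !subrr mul0r.
  move: (a_ d l ^ n) (s_ d (c l) ^ n) (kappa d n) => a t k a0 t1.
  by field; rewrite ?a0 ?t1.
- move=> n n0; rewrite gE; have := s_expz_neq0 d n (c l.+1).
  have := s1_neq0 lnq0 gen n0.
  by move: (s ^ n) => t t1 t0; field; rewrite t0 t1.
- move=> n n0; rewrite gE; have := s_expz_neq0 d n (c l.+1).
  have := s1_neq0 lnq0 gen n0.
  by move: (s ^ n) => t t1 t0; field; rewrite t0 t1.
Qed.
End LastB.

Section TypeD.
Hypotheses (lC : lastf d = FockCD) (cl : c l = c l.+1) (l2 : (2 <= l)%N).
Local Notation p := l.-1.

Lemma root_of_typeD A :
  root_of d A 1 (dr (L p)) (dr (B l)) -> root_of d A 1 (dr (L l)) (dr (B p)).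
Proof.
have l1 : (1 <= l)%N by rewrite ltnW.
have ll : (1 <= l <= l)%N by rewrite l1 leqnn.
have pl : (1 <= p <= l)%N by case: (ell d) l2 => [|[|n]] //= _; rewrite leqnSn.
have ltp : (p < l)%N by rewrite prednK.
have aE n : a_ d l ^ n = s_ d (c l) ^ n by rewrite (a_ell_CD lC) cl.
have one0 : (1 : R[i]) != 0 by exact: oner_neq0.
have oneE n : ((1 : R[i]) / 1) ^ n = 1 by rewrite invr1 mulr1 exp1rz.
move=> Ag; apply: (root_of_transfer one0 one0 (L_spec pl) (B_spec ll)
  (L_spec ll) (B_spec pl) Ag).
- move=> n j n0 jl; rewrite oneE mulr1 !aE !(a_pred lC l1 cl) !q_s_expz.
  have := qs1 lnq0 gen (c l) n0; have := qs1 lnq0 gen (c p) n0.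
  have := s_expz_neq0 d n (c l).
  move: jl; rewrite leq_eqVlt => /orP[/eqP->|jl].
    rewrite ltnn eqxx (gtn_eqF ltp) ltnNge ltnW //= aE.
    move: (s_ d (c l) ^ n) (kappa d n) => t k t0 _ t1.
    by field; rewrite ?t0 ?t1.
  rewrite jl (ltn_eqF jl); case: (ltngtP j p) => [_|pj|_].
  + by rewrite !subrr.
  + by move: pj; rewrite prednK // leqNgt jl.
  move: (s_ d (c p) ^ n) (kappa d n) => t k _ t1 _.
  by field; rewrite ?t1.
- move=> n j n0 jl; rewrite oneE mulr1 !aE !(a_pred lC l1 cl) !q_s_expz.
  have := qs1 lnq0 gen (c l) n0; have := qs1 lnq0 gen (c p) n0.
  have := s_expz_neq0 d n (c l).
  move: jl; rewrite leq_eqVlt => /orP[/eqP->|jl].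
    rewrite ltnn eqxx (gtn_eqF ltp) ltnNge ltnW //= aE.
    move: (s_ d (c l) ^ n) (kappa d n) => t k t0 _ t1.
    by field; rewrite ?t0 ?t1.
  rewrite jl (ltn_eqF jl); case: (ltngtP j p) => [_|pj|_].
  + by rewrite !subrr.
  + by move: pj; rewrite prednK // leqNgt jl.
  move: (s_ d (c p) ^ n) (kappa d n) => t k _ t1 _.
  by field; rewrite ?t1.
- by move=> n n0; rewrite oneE mulr1.
- by move=> n n0; rewrite oneE mulr1.
Qed.
End TypeD.

End RootOf.

(** * Stability keeps the last node away from the first factor *)

Section Stable.
Variables (R : realType) (d : datum R).
Hypothesis lnq0 : \sum_(x < 3) lnq d x = 0.
Hypothesis gen : generic d.
Hypothesis mu1 : `|mu d| < 1.
Hypothesis l1 : (1 <= ell d)%N.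
Local Notation c := (colr d).
Local Notation l := (ell d).
Variables (V : lmodType R[i]) (h : nat -> int -> V -> V) (vac : V).
Hypothesis fk : is_fock d h vac.
Variable u : nat -> R[i].
Local Notation L i := (Lambda d u i).
Local Notation B i := (Lambdab d u i).
Local Notation dr := (dress d).
Local Notation A0 := (Defs.root0 d u).
Hypothesis st : stable d h u.
Let i1 : (1 <= 1 <= l)%N. Proof. by rewrite l1. Qed.

Lemma stable_cc : cc d A0 (root_current d u l) 1 = 0.
Proof.
(* Applied to the nonzero vacuum, commutation of the modes 1 and -1 forces their scalar bracket to
   vanish. *)
have e := mode_comm fk A0 (root_current d u l) (r := 1) (s := -1) vac erefl erefl.
have := st (r := 1) (r' := -1) vac erefl erefl.
rewrite /root_current eqxx -/(root_current d u l) -!(lmodeE fk) // e => /eqP.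
rewrite -subr_eq0 addrAC subrr add0r scaler_eq0 (negPf (fock_vac_neq0 fk)) orbF.
by rewrite ccE => /eqP->; rewrite mulr0.
Qed.

Lemma node0_L_neq0 : cc d A0 (L 1) 1 != 0.
Proof.
rewrite -(cc_dressr lnq0 (r := 1)) // (node0_L lnq0 gen mu1 l1 u) //.
have k0 := kappa_neq0 lnq0 gen (r := 1) erefl.
have q1 := qexp1 lnq0 gen (c 1) (n := 1) erefl.
have m0 := m_neq0 d 1; have h0 := h_neq0 d 1; have q0 := q_expz_nz d (c 1) 1.
by rewrite !mulf_neq0 ?invr_neq0.
Qed.

(** For [l = 1] the last root current is the ratio of [Lambda_1] and [Lambda_0], and [A_0] contracts
    trivially with [Lambda_0] but not with [Lambda_1]. *)
Lemma ell_neq1_B : lastf d = FockB -> (2 <= l)%N.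
Proof.
move=> lB; rewrite ltn_neqAle l1 andbT; apply/eqP => el.
have := stable_cc; rewrite /root_current gtn_eqF // ltnn /ntype lB.
rewrite -/(rootv (a_ d l)^-1 (L l) (Lambda0 d)) (cc_rootr lnq0) -el expr1z => /eqP.
have e0 : cc d A0 (Lambda0 d) 1 = 0.
  by rewrite -(cc_dressr lnq0 (r := 1)) // (node0_0_eq0 lnq0 gen mu1 l1 u).
by rewrite e0 subr0 mulf_eq0 invr_eq0 (negPf (a_neq0 d 1)) (negPf node0_L_neq0).
Qed.

(** For [l = 1] the last root current is the ratio of [Lambda_1] and [Lambda_bar(1)]; its
    contraction with [A_0] is a nonzero multiple of [1 + q_(c_2)], which is nonzero by
    genericity. *)
Lemma ell_neq1_C : ntype d = TypeC -> (2 <= l)%N.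
Proof.
move=> nC; rewrite ltn_neqAle l1 andbT; apply/eqP => el.
have lC : lastf d = FockCD by move: nC; rewrite /ntype; case: (lastf d).
have := stable_cc; rewrite /root_current gtn_eqF // ltnn nC.
rewrite (ccDr lnq0) (ccNr lnq0) -el.
have := node0_L lnq0 gen mu1 l1 u (r := 1) erefl.
have := node0_B lnq0 gen mu1 l1 u (r := 1) erefl.
rewrite !(cc_dressr lnq0 (r := 1)) // => -> ->; rewrite al0_expz !expr1z => /eqP.
have k0 := kappa_neq0 lnq0 gen (r := 1) erefl.
have := qexp1 lnq0 gen (c 1) (n := 1) erefl; rewrite expr1z => q1.
have := m_neq0 d 1; have := h_neq0 d 1; rewrite !expr1z => h0 m0.
have q2 : 1 + s_ d (c 2) ^+ 2 != 0.
  by have := sh_expz2_neqN1 lnq0 gen (c 2) (r := 2) erefl; rewrite -exprnP sh2.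
have := a1_expz l1 1; have := a_ell_CD lC 1; rewrite -el !expr1z => ->.
rewrite -s2; have s10 := s_neq0 d (c 1); rewrite -s2 in q1.
move: (s_neq0 d (c 2)) q1 q2 s10 k0 h0 m0.
move: (s_ d (c 1)) (s_ d (c 2)) (sh d (c 0)) (muh d) (kappa d 1) => s1 t2 y z k t20 q1 q2 s10 k0 y0 z0 e.
have -> : z = s1 * y / t2 by rewrite e; field; rewrite ?s10 ?y0 ?z0.
apply/negP; rewrite (_ : _ - _ = s1 * (1 + t2 ^+ 2) / t2 * (k / (1 - s1 ^+ 2))); last first.
  by field; rewrite ?t20 ?s10 ?y0 ?q1.
by rewrite !mulf_neq0 ?invr_neq0.
Qed.

(** For [l = 2] the last root current is the ratio of [Lambda_1] and [Lambda_bar(2)], of which only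
    [Lambda_1] contracts with [A_0]. *)
Lemma ell_neq2_D : ntype d = TypeD -> (2 <= l)%N -> (3 <= l)%N.
Proof.
move=> nD l2; rewrite ltn_neqAle l2 andbT; apply/eqP => el.
have := stable_cc; rewrite /root_current gtn_eqF // ltnn nD.
rewrite (ccDr lnq0) (ccNr lnq0).
have -> : cc d A0 (B l) 1 = 0.
  have ll : (2 <= l <= l)%N by rewrite l2 leqnn.
  by rewrite -(cc_dressr lnq0 (r := 1)) // (node0_B_eq0 lnq0 gen mu1 l1 u ll).
by rewrite -el subr0 => /eqP; rewrite (negPf node0_L_neq0).
Qed.
End Stable.

Lemma sum_one (V : zmodType) (l i : nat) (G : nat -> V) : (1 <= i <= l)%N ->
  (forall j, (1 <= j <= l)%N -> j != i -> G j = 0) -> \sum_(1 <= j < l.+1) G j = G i.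
Proof.
move=> il G0; rewrite (bigD1_seq i) ?iota_uniq ?mem_index_iota //=.
by rewrite big_nat_cond big1 ?addr0 // => j /andP[jl ji]; apply: G0.
Qed.

Lemma sum_two (V : zmodType) (l i k : nat) (G : nat -> V) :
  (1 <= i <= l)%N -> (1 <= k <= l)%N -> i != k ->
  (forall j, (1 <= j <= l)%N -> j != i -> j != k -> G j = 0) ->
  \sum_(1 <= j < l.+1) G j = G i + G k.
Proof.
move=> il kl ik G0; rewrite (bigD1_seq i) ?iota_uniq ?mem_index_iota //=; congr (_ + _).
rewrite big_mkcond /= (@sum_one _ l k) //= => [|j jl jk]; first by rewrite eq_sym ik.
by case: eqP => //= /eqP ji; apply: G0.
Qed.

Lemma scalerD_cons (K : pzRingType) (V : lmodType K) (b : K) (x y A B : V) :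
  b *: x + (b *: y + (A + B)) = b *: (x + y) + A + B.
Proof. by rewrite scalerDr !addrA. Qed.

(** * Expansion of the commutator with the extended current, term by term *)

Section Etilde.
Variables (R : realType) (d : datum R).
Hypothesis lnq0 : \sum_(x < 3) lnq d x = 0.
Local Notation c := (colr d).
Local Notation l := (ell d).
Local Notation dr := (dress d).
Variables (V : lmodType R[i]) (h : nat -> int -> V -> V) (vac : V).
Hypothesis fk : is_fock d h vac.
Variables (u T : nat -> R[i]).

Section Expand.
Variables (S : vertex R) (a n : int) (v : V).
Local Notation D X := (vcomm d h S a (X u) (X (change T u)) n v).

Lemma scr_comm_nil : scr_comm d h (vcoef d h S a) T u (fun _ => [::]) n v = 0.
Proof.
by rewrite /scr_comm /cur_coef !big_nil subr0 -[X in vcoef _ _ _ _ X](scale0r (0 : V)) (vcoefZ fk) scale0r.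
Qed.

Lemma scr_comm_cons (x : R[i]) (X : (nat -> R[i]) -> vertex R) Y :
  scr_comm d h (vcoef d h S a) T u (fun w => (x, X w) :: Y w) n v =
  x *: D X + scr_comm d h (vcoef d h S a) T u Y n v.
Proof.
rewrite /scr_comm /cur_coef !big_cons (vcoef_linear fk) /vcomm scalerBr.
by rewrite opprD addrACA.
Qed.

Lemma scr_comm_Etilde :
  scr_comm d h (vcoef d h S a) T u (Etilde d) n v =
  \sum_(1 <= j < l.+1) b_ d (c j) *: (D (fun w => dr (Lambda d w j)) + D (fun w => dr (Lambdab d w j)))
  + (if ntype d is TypeB then kB d (c l.+1) *: D (fun _ => dr (Lambda0 d)) else 0)
  + kB d (c 0) *: D (Lambda0b d).
Proof.
pose Z := if ntype d is TypeB then [:: (kB d (c l.+1), dr (Lambda0 d))] else [::].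
have E w : Etilde d w =
    flatten [seq [:: (b_ d (c j), dr (Lambda d w j)); (b_ d (c j), dr (Lambdab d w j))] | j <- iota 1 l]
    ++ Z ++ [:: (kB d (c 0), Lambda0b d w)].
  rewrite /Etilde /Ecur /dress_cur -cats1 map_cat -catA map_flatten -map_comp; congr (_ ++ _).
  by rewrite /Z; case: ntype.
rewrite {1}/scr_comm !E -/(scr_comm d h (vcoef d h S a) T u (fun w => flatten [seq [:: (b_ d (c j), dr (Lambda d w j)); (b_ d (c j), dr (Lambdab d w j))] | j <- iota 1 l]
    ++ Z ++ [:: (kB d (c 0), Lambda0b d w)]) n v).
rewrite -addrA /index_iota subSS subn0.
elim: (iota 1 l) => [|j s IH].
  rewrite big_nil add0r /= /Z; case: ntype; rewrite /= ?scr_comm_cons scr_comm_nil ?addr0 ?add0r //.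
rewrite big_cons; pose Y w := flatten [seq [:: (b_ d (c j), dr (Lambda d w j)); (b_ d (c j), dr (Lambdab d w j))] | j <- s] ++ Z ++ [:: (kB d (c 0), Lambda0b d w)].
apply: etrans (scr_comm_cons (b_ d (c j)) (fun w => dr (Lambda d w j)) (fun w => (b_ d (c j), dr (Lambdab d w j)) :: Y w)) _.
rewrite (scr_comm_cons (b_ d (c j)) (fun w => dr (Lambdab d w j)) Y) IH.
exact: scalerD_cons.
Qed.
End Expand.
End Etilde.

(** * Terms that commute with a given screening operator *)

Section Nodes.
Variables (R : realType) (d : datum R).
Hypothesis lnq0 : \sum_(x < 3) lnq d x = 0.
Hypothesis gen : generic d.
Hypothesis mu1 : `|mu d| < 1.
Hypothesis l1 : (1 <= ell d)%N.
Local Notation c := (colr d).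
Local Notation l := (ell d).
Local Notation dr := (dress d).
Variables (V : lmodType R[i]) (h : nat -> int -> V -> V) (vac : V).
Hypothesis fk : is_fock d h vac.
Variables (u T : nat -> R[i]).
Hypotheses (u10 : u 1%N != 0) (T10 : T 1%N != 0).
Local Notation L i := (Lambda d u i).
Local Notation B i := (Lambdab d u i).
Variables (A : vertex R) (p : R[i]) (m n : int) (v : V).
Local Notation S := (scr_osc A p).
Local Notation D X := (vcomm d h S (-1 - m) (X u) (X (change T u)) n v).
Local Notation DL j := (vcomm d h S (-1 - m) (dr (Lambda d u j)) (dr (Lambda d (change T u) j)) n v).
Local Notation DB j := (vcomm d h S (-1 - m) (dr (Lambdab d u j)) (dr (Lambdab d (change T u) j)) n v).
Local Notation D0 := (vcomm d h S (-1 - m) (dr (Lambda0 d)) (dr (Lambda0 d)) n v).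
Local Notation D0b := (vcomm d h S (-1 - m) (Lambda0b d u) (Lambda0b d (change T u)) n v).

Lemma cc_scr_eq0 X r : cc d A X r = 0 -> cc d S X r = 0.
Proof. by rewrite cc_scr => ->; rewrite mul0r. Qed.

Lemma pref_dL w j : pref (dr (Lambda d w j)) = w j.
Proof. by rewrite /= invr1 mulr1. Qed.

Lemma pref_dB w j : pref (dr (Lambdab d w j)) = (w j)^-1.
Proof. by rewrite /= invr1 mulr1. Qed.

Lemma pref_d0 : pref (dr (Lambda0 d)) = 1.
Proof. by rewrite /= invr1 mulr1. Qed.

(** The scalars [u_1^(-1)] of [Lambda_bar(1)] and of [A_0] cancel, so the extra term is unaffected
    by the change of parameters, like [Lambda_0]. *)
Lemma pref_0b w : w 1%N != 0 -> pref (Lambda0b d w) = 1.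
Proof. by move=> w0; rewrite /= invr1 mulr1 invrK mulVf. Qed.

Lemma change10 : change T u 1%N != 0.
Proof. exact: mulf_neq0. Qed.

Lemma pair_eq0 j : T j = 1 ->
  (forall r, r != 0 -> cc d A (dr (L j)) r = 0) ->
  (forall r, r != 0 -> cc d A (dr (B j)) r = 0) ->
  b_ d (c j) *: (DL j + DB j) = 0.
Proof.
move=> Tj AL AB.
have e1 : DL j = 0.
  apply: (vcomm_eq0 lnq0 fk) => [//||r r0]; last exact: cc_scr_eq0 (AL r r0).
  by rewrite !pref_dL /change Tj mul1r.
have e2 : DB j = 0.
  apply: (vcomm_eq0 lnq0 fk) => [//||r r0]; last exact: cc_scr_eq0 (AB r r0).
  by rewrite !pref_dB /change Tj mul1r.
by rewrite e1 e2 addr0 scaler0.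
Qed.

Lemma D0_eq0 : (forall r, r != 0 -> cc d A (dr (Lambda0 d)) r = 0) -> D0 = 0.
Proof.
by move=> A0; apply: (vcomm_eq0 lnq0 fk) => [//|//|r r0]; apply: cc_scr_eq0 (A0 r r0).
Qed.

Lemma D0b_eq0 : (forall r, r != 0 -> cc d A (Lambda0b d u) r = 0) -> D0b = 0.
Proof.
move=> A0; apply: (vcomm_eq0 lnq0 fk) => [//||r r0]; last exact: cc_scr_eq0 (A0 r r0).
by rewrite !pref_0b // change10.
Qed.

Lemma cc_0b_eq0 :
  (forall r, r != 0 -> cc d A (dr (L 1)) r = 0) ->
  (forall r, r != 0 -> cc d A (dr (B 1)) r = 0) ->
  forall r, r != 0 -> cc d A (Lambda0b d u) r = 0.
Proof.
move=> AL AB r r0; rewrite (cc_Lambda0b lnq0 gen u A r0) AL // AB //.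
by rewrite !mulr0 addr0 mul0r.
Qed.

Local Notation SC := (scr_comm d h (scr_op d h A p m) T u (Etilde d) n v).

Lemma scr_comm_one i : (1 <= i <= l)%N ->
  (forall j, (1 <= j <= l)%N -> j != i -> T j = 1) ->
  (forall j r, (1 <= j <= l)%N -> j != i -> r != 0 -> cc d A (dr (L j)) r = 0) ->
  (forall j r, (1 <= j <= l)%N -> j != i -> r != 0 -> cc d A (dr (B j)) r = 0) ->
  SC = b_ d (c i) *: (DL i + DB i)
   + (if ntype d is TypeB then kB d (c l.+1) *: D0 else 0) + kB d (c 0) *: D0b.
Proof.
move=> il Tj AL AB; rewrite (scr_comm_Etilde fk) (sum_one il) // => j jl ji.
by apply: pair_eq0; [exact: Tj|move=> r; exact: AL|move=> r; exact: AB].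
Qed.

Lemma scr_comm_two i k : (1 <= i <= l)%N -> (1 <= k <= l)%N -> i != k ->
  (forall j, j != i -> j != k -> T j = 1) ->
  (forall j r, (1 <= j <= l)%N -> j != i -> j != k -> r != 0 -> cc d A (dr (L j)) r = 0) ->
  (forall j r, (1 <= j <= l)%N -> j != i -> j != k -> r != 0 -> cc d A (dr (B j)) r = 0) ->
  (lastf d = FockB -> forall r, r != 0 -> cc d A (dr (Lambda0 d)) r = 0) ->
  (forall r, r != 0 -> cc d A (Lambda0b d u) r = 0) ->
  SC = b_ d (c i) *: (DL i + DB i) + b_ d (c k) *: (DL k + DB k).
Proof.
move=> il kl ik Tj AL AB A0 A0b; rewrite (scr_comm_Etilde fk) (sum_two il kl ik); last first.
  move=> j jl ji jk.
  by apply: pair_eq0; [exact: Tj|move=> r; exact: AL|move=> r; exact: AB].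
have -> : (if ntype d is TypeB then kB d (c l.+1) *: D0 else 0) = 0.
  rewrite /ntype; case: (lastf d) A0 => A0; last by case: ifP.
  by rewrite D0_eq0 ?scaler0 //; apply: A0.
by rewrite D0b_eq0 // scaler0 !addr0.
Qed.

End Nodes.

Lemma scaler_regroup (K : pzRingType) (V : lmodType K) (b b' : K) (x y x' y' : V) :
  b *: x + b' *: x' = 0 -> b' *: y' + b *: y = 0 ->
  b *: (x + y) + b' *: (x' + y') = 0.
Proof. by move=> e1 e2; rewrite !scalerDr addrACA e1 add0r addrC. Qed.

(** * The middle nodes *)

Section Nodes.
Variables (R : realType) (d : datum R).
Hypothesis lnq0 : \sum_(x < 3) lnq d x = 0.
Hypothesis gen : generic d.
Hypothesis mu1 : `|mu d| < 1.
Hypothesis l1 : (1 <= ell d)%N.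
Local Notation c := (colr d).
Local Notation l := (ell d).
Local Notation dr := (dress d).
Variables (V : lmodType R[i]) (h : nat -> int -> V -> V) (vac : V).
Hypothesis fk : is_fock d h vac.
Variable u : nat -> R[i].
Hypothesis u0 : forall j : nat, (1 <= j <= l)%N -> u j != 0.
Local Notation L i := (Lambda d u i).
Local Notation B i := (Lambdab d u i).
Variables (m n : int) (v : V).
Local Notation SC A p T := (scr_comm d h (scr_op d h A p m) T u (Etilde d) n v).
Let i1 : (1 <= 1 <= l)%N. Proof. by rewrite l1. Qed.
Let u10 := u0 i1.

Lemma chg1_neq0 (i : nat) (x : R[i]) j : x != 0 -> chg1 i x j != 0.
Proof. by rewrite /chg1; case: ifP => // _ _; exact: oner_neq0. Qed.

Lemma chg2_neq0 (i k : nat) (x y : R[i]) j : x != 0 -> y != 0 -> chg2 i x k y j != 0.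
Proof. by rewrite /chg2 => x0 y0; case: ifP => // _; case: ifP => // _; exact: oner_neq0. Qed.

Section Mid.
Variable i : nat.
Hypothesis il : (1 <= i < l)%N.
Local Notation A := (root_current d u i).
Let i1' : (1 <= i <= l)%N. Proof. by case/andP: il => -> /ltnW. Qed.
Let i2' : (1 <= i.+1 <= l)%N. Proof. by case/andP: il. Qed.

Lemma root_mid : A = rootv (a_ d i)^-1 (L i) (L i.+1).
Proof. by case/andP: il => i0 il'; rewrite /root_current gtn_eqF // il'. Qed.

(** For [i > 1] the root current contracts with neither [Lambda_1] nor [Lambda_bar(1)]. For [i = 1]
    both contractions are nonzero, and their weighted mean vanishes because
    [a_1^2 mu = q_(c_1) s_(c_0)]. *)
Lemma mid_0b r : r != 0 -> cc d A (Lambda0b d u) r = 0.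
Proof.
rewrite root_mid; case: (eqVneq i 1%N) => [ie|ni] r0; last first.
  have n1 : (1%N != i) by rewrite eq_sym.
  have n2 : (1%N != i.+1) by case: i il.
  by apply: (cc_0b_eq0 lnq0 gen) r0 => t t0; [apply: (midL_eq0 lnq0 gen mu1)|apply: (midB_eq0 lnq0 gen mu1)].
have il' : (1 <= 1 < l)%N by move: il; rewrite ie.
rewrite ie (cc_Lambda0b lnq0 gen u _ r0) (midL lnq0 gen mu1 u il' r0) (midB lnq0 gen mu1 u il' r0).
rewrite (expzV (a_ d 1)) (a1_expz l1) s_expz (mu_expz d r).
have := sh_expz4_neq1 lnq0 gen (c 1) r0; rewrite q_expz s_expz.
have := m_neq0 d r; have := h_neq0 d r; have := sh_expz_neq0 d (c 1) r.
move: (sh d (c 0) ^ r) (sh d (c 1) ^ r) (muh d ^ r) (kappa d r) => y s z k s0 y0 z0 q1.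
rewrite (_ : _ + _ = 0) ?mul0r //; field.
by rewrite ?s0 ?y0 ?z0 ?q1.
Qed.

Lemma scr_comm_mid p x y : x != 0 -> y != 0 ->
  let T := chg2 i x i.+1 y in
  let w X := vcomm d h (scr_osc A p) (-1 - m) (dr (X u)) (dr (X (change T u))) n v in
  SC A p T =
    b_ d (c i) *: (w (Lambda d ^~ i) + w (Lambdab d ^~ i)) +
    b_ d (c i.+1) *: (w (Lambda d ^~ i.+1) + w (Lambdab d ^~ i.+1)).
Proof.
move=> x0 y0 T w.
have T10 : T 1%N != 0 by exact: chg2_neq0.
have ii : i != i.+1 by rewrite ltn_eqF.
have Tj j : j != i -> j != i.+1 -> T j = 1.
  by move=> /negPf ji /negPf ji1; rewrite /T /chg2 ji ji1.
apply: (scr_comm_two lnq0 fk u10 T10 p m n v i1' i2' ii Tj); rewrite root_mid.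
- by move=> j r jl ji ji1 r0; apply: (midL_eq0 lnq0 gen mu1).
- by move=> j r jl ji ji1 r0; apply: (midB_eq0 lnq0 gen mu1).
- by move=> lB r r0; apply: (mid0_eq0 lnq0 gen mu1).
- by move=> r r0; rewrite -root_mid; apply: mid_0b.
Qed.

Lemma mid_rootL : root_of d A (a_ d i) (dr (L i)) (dr (L i.+1)).
Proof. by rewrite root_mid; apply: root_of_root; rewrite a_neq0. Qed.

Lemma mid_pref w : pref (root_current d w i) = w i / w i.+1.
Proof. by case/andP: il => i0 il'; rewrite /root_current gtn_eqF // il'. Qed.

Lemma mid_bose x y : c i = c i.+1 -> all_colors (c i) x y ->
  well_defined d u i (s_ d (c i) * s_ d (c i.+1)) (s_ d x) m ->
  SC A (s_ d x) (chg2 i (q_ d y) i.+1 (q_ d y)^-1) = 0.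
Proof.
move=> cii exy; rewrite /well_defined mid_pref => wd.
have qy0 := q_neq0 d y; have qyV0 : (q_ d y)^-1 != 0 by rewrite invr_neq0.
have ui0 := u0 i1'; have ui10 := u0 i2'.
rewrite (scr_comm_mid _ qy0 qyV0) -cii.
have RL := mid_rootL; have RB := root_of_mid lnq0 gen il mid_rootL.
have a0 := a_neq0 d i; have aV0 : (a_ d i)^-1 != 0 by rewrite invr_neq0.
have Ti : change (chg2 i (q_ d y) i.+1 (q_ d y)^-1) u i = q_ d y * u i by rewrite /change /chg2 eqxx.
have Ti1 : change (chg2 i (q_ d y) i.+1 (q_ d y)^-1) u i.+1 = (q_ d y)^-1 * u i.+1.
  by rewrite /change /chg2 eqxx gtn_eqF.
have wd' : u i = q_ d (c i) * s_ d x ^ (- (2 * m)) * u i.+1.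
  by rewrite -(divfK ui10 (u i)) wd -cii -s2.
set ch := change _ _ in Ti Ti1 *.
(* The four surviving terms are regrouped into the unbarred pair, linked at [a_i], and the barred
   pair, linked at [a_i^(-1)]. *)
apply: scaler_regroup; rewrite -scalerDr.
- rewrite (@pair_bose _ d lnq0 gen _ h _ fk A (dr (L i)) (dr (L i.+1)) (dr (Lambda d ch i))
    (dr (Lambda d ch i.+1)) (a_ d i) (c i) (c i.+1) m a0 RL erefl erefl _ _ x y n v cii exy) ?scaler0 //.
  + by move=> r r0; rewrite root_mid; apply: (midL lnq0 gen mu1).
  + by move=> r r0; rewrite root_mid; apply: (midL1 lnq0 gen mu1).
  + by rewrite !pref_dL Ti.
  + by rewrite !pref_dL Ti1.
  + by apply: etrans (pref_dL d u i) _; rewrite wd'; congr (_ * _); apply/esym/pref_dL.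
- rewrite (@pair_bose _ d lnq0 gen _ h _ fk A (dr (B i.+1)) (dr (B i)) (dr (Lambdab d ch i.+1))
    (dr (Lambdab d ch i)) (a_ d i)^-1 (c i.+1) (c i) m aV0 RB erefl erefl _ _ x y n v (esym cii)) ?scaler0 //.
  + by move=> r r0; rewrite root_mid; apply: (midB1 lnq0 gen mu1).
  + by move=> r r0; rewrite root_mid; apply: (midB lnq0 gen mu1).
  + by rewrite -cii.
  + by rewrite !pref_dB Ti1 invfM invrK.
  + by rewrite !pref_dB Ti invfM.
  + apply: etrans (pref_dB d u i.+1) _; apply: etrans (congr1 _ (esym (pref_dB d u i))).
    rewrite wd' -cii; have := q_neq0 d (c i); have := s_expz_neq0 d (- (2 * m)) x.
    move: (q_ d (c i)) (s_ d x ^ _) (u i.+1) ui10 => q s w w0 s0 q0.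
    by field; rewrite ?w0 ?s0 ?q0.
Qed.

Lemma mid_fermi x : all_colors (c i) (c i.+1) x ->
  well_defined d u i (s_ d (c i) * s_ d (c i.+1)) (s_ d x) m ->
  SC A (s_ d x) (chg2 i (q_ d (c i.+1)) i.+1 (q_ d (c i))^-1) = 0.
Proof.
move=> efx; rewrite /well_defined mid_pref => wd.
have qy0 := q_neq0 d (c i.+1); have qyV0 : (q_ d (c i))^-1 != 0 by rewrite invr_neq0 // q_neq0.
have ui0 := u0 i1'; have ui10 := u0 i2'.
rewrite (scr_comm_mid _ qy0 qyV0).
have RL := mid_rootL; have RB := root_of_mid lnq0 gen il mid_rootL.
have a0 := a_neq0 d i; have aV0 : (a_ d i)^-1 != 0 by rewrite invr_neq0.
have Ti : change (chg2 i (q_ d (c i.+1)) i.+1 (q_ d (c i))^-1) u i = q_ d (c i.+1) * u i by rewrite /change /chg2 eqxx.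
have Ti1 : change (chg2 i (q_ d (c i.+1)) i.+1 (q_ d (c i))^-1) u i.+1 = (q_ d (c i))^-1 * u i.+1.
  by rewrite /change /chg2 eqxx gtn_eqF.
have fex := all_colorsC efx.
have wd' : u i = s_ d (c i) * s_ d (c i.+1) * s_ d x ^ (- (2 * m)) * u i.+1.
  by rewrite -wd divfK.
set ch := change _ _ in Ti Ti1 *.
apply: scaler_regroup.
- apply: (@pair_fermi _ d lnq0 gen _ h _ fk A (dr (L i)) (dr (L i.+1)) (dr (Lambda d ch i))
    (dr (Lambda d ch i.+1)) (a_ d i) (c i) (c i.+1) m a0 RL erefl erefl _ _ x n v efx) => //.
  + by move=> r r0; rewrite root_mid; apply: (midL lnq0 gen mu1).
  + by move=> r r0; rewrite root_mid; apply: (midL1 lnq0 gen mu1).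
  + by rewrite !pref_dL Ti.
  + by rewrite !pref_dL Ti1.
  + by apply: etrans (pref_dL d u i) _; rewrite wd'; congr (_ * _); apply/esym/pref_dL.
- apply: (@pair_fermi _ d lnq0 gen _ h _ fk A (dr (B i.+1)) (dr (B i)) (dr (Lambdab d ch i.+1))
    (dr (Lambdab d ch i)) (a_ d i)^-1 (c i.+1) (c i) m aV0 RB erefl erefl _ _ x n v fex) => //.
  + by move=> r r0; rewrite root_mid; apply: (midB1 lnq0 gen mu1).
  + by move=> r r0; rewrite root_mid; apply: (midB lnq0 gen mu1).
  + by rewrite !pref_dB Ti1 invfM invrK.
  + by rewrite !pref_dB Ti invfM.
  + apply: etrans (pref_dB d u i.+1) _; apply: etrans (congr1 _ (esym (pref_dB d u i))).
    rewrite wd'; have := s_neq0 d (c i); have := s_neq0 d (c i.+1).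
    have := s_expz_neq0 d (- (2 * m)) x.
    move: (s_ d (c i)) (s_ d (c i.+1)) (s_ d x ^ _) (u i.+1) ui10 => q q' s w w0 s0 q'0 q0.
    by field; rewrite ?w0 ?s0 ?q'0 ?q0.
Qed.
End Mid.
End Nodes.

(** * The last node in types B, C and D *)

Section Nodes.
Variables (R : realType) (d : datum R).
Hypothesis lnq0 : \sum_(x < 3) lnq d x = 0.
Hypothesis gen : generic d.
Hypothesis mu1 : `|mu d| < 1.
Hypothesis l1 : (1 <= ell d)%N.
Local Notation c := (colr d).
Local Notation l := (ell d).
Local Notation dr := (dress d).
Variables (V : lmodType R[i]) (h : nat -> int -> V -> V) (vac : V).
Hypothesis fk : is_fock d h vac.
Variable u : nat -> R[i].
Hypothesis u0 : forall j : nat, (1 <= j <= l)%N -> u j != 0.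
Hypothesis st : stable d h u.
Local Notation L i := (Lambda d u i).
Local Notation B i := (Lambdab d u i).
Variables (m n : int) (v : V).
Local Notation SC A p T := (scr_comm d h (scr_op d h A p m) T u (Etilde d) n v).
Local Notation A := (root_current d u l).
Let i1 : (1 <= 1 <= l)%N. Proof. by rewrite l1. Qed.
Let ll : (1 <= l <= l)%N. Proof. by rewrite l1 leqnn. Qed.
Let u10 := u0 i1.

Lemma jl_lt j : (1 <= j <= l)%N -> j != l -> (1 <= j < l)%N.
Proof. by move=> /andP[-> jl] jn; rewrite ltn_neqAle jn. Qed.

Lemma change1 i (x : R[i]) : change (chg1 i x) u i = x * u i.
Proof. by rewrite /change /chg1 eqxx. Qed.

Lemma prefL_change w z j : w j = z * u j -> pref (dr (Lambda d w j)) = z * pref (dr (L j)).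
Proof.
move=> e; apply: etrans (pref_dL d w j) _; apply: etrans e _.
by congr (_ * _); apply/esym/pref_dL.
Qed.

Lemma prefB_change w z j : w j = z * u j -> pref (dr (Lambdab d w j)) = z^-1 * pref (dr (B j)).
Proof.
move=> e; apply: etrans (pref_dB d w j) _; apply: etrans (congr1 _ e) _.
by rewrite invfM; congr (_ * _); apply/esym/pref_dB.
Qed.
Section LastB.
Hypothesis lB : lastf d = FockB.

Lemma ntypeB : ntype d = TypeB. Proof. by rewrite /ntype lB. Qed.

Lemma root_lastB : A = rootv (a_ d l)^-1 (L l) (Lambda0 d).
Proof. by rewrite /root_current gtn_eqF // ltnn ntypeB. Qed.

Lemma lastB_pref : pref A = u l.
Proof. by rewrite root_lastB /= invr1 mulr1. Qed.

Let l2 : (2 <= l)%N := ell_neq1_B lnq0 gen mu1 l1 fk st lB.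

Lemma lastB_scr_comm p x : x != 0 ->
  let w X := vcomm d h (scr_osc A p) (-1 - m) (dr (X u)) (dr (X (change (chg1 l x) u))) n v in
  b_ d (c l) *: w (Lambda d ^~ l) + kB d (c l.+1) *: w (fun _ => Lambda0 d)
    + b_ d (c l) *: w (Lambdab d ^~ l) = 0 ->
  SC A p (chg1 l x) = 0.
Proof.
move=> x0 w e.
have T10 : chg1 l x 1 != 0 by exact: chg1_neq0.
have Tj j : (1 <= j <= l)%N -> j != l -> chg1 l x j = 1.
  by move=> _ /negPf jl; rewrite /chg1 jl.
have AL j r : (1 <= j <= l)%N -> j != l -> r != 0 -> cc d A (dr (L j)) r = 0.
  by move=> jl jn r0; rewrite root_lastB; apply: (lastB_L_eq0 lnq0 gen mu1) => //; apply: jl_lt.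
have AB j r : (1 <= j <= l)%N -> j != l -> r != 0 -> cc d A (dr (B j)) r = 0.
  by move=> jl jn r0; rewrite root_lastB; apply: (lastB_B_eq0 lnq0 gen mu1) => //; apply: jl_lt.
(* This is where stability enters: with [l >= 2], the first factor is not the last, so the extra
   term commutes with the screening. *)
have n1 : (1 != l)%N by rewrite ltn_eqF.
have A0b r : r != 0 -> cc d A (Lambda0b d u) r = 0.
  by move=> r0; apply: (cc_0b_eq0 lnq0 gen) r0 => t t0; [apply: AL|apply: AB].
apply: etrans (scr_comm_one lnq0 fk p m n v ll Tj AL AB) _.
have eb := D0b_eq0 lnq0 fk u10 T10 p m n v A0b.
rewrite eb scaler0 addr0 ntypeB scalerDr addrAC.
exact: e.
Qed.


Lemma lastB_L_A r : r != 0 ->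
  cc d A (dr (L l)) r = - a_ d l ^ r * kappa d r / (1 - q_ d (c l) ^ r).
Proof. by move=> r0; rewrite root_lastB; apply: (lastB_L lnq0 gen mu1). Qed.

Lemma lastB_0_A r : r != 0 -> cc d A (dr (Lambda0 d)) r =
  - a_ d l ^ r * kappa d r * s_ d (c l.+1) ^ r / (1 + s_ d (c l.+1) ^ r).
Proof. by move=> r0; rewrite root_lastB; apply: (lastB_0 lnq0 gen mu1). Qed.

Lemma lastB_B_A r : r != 0 -> cc d A (dr (B l)) r =
  a_ d l ^ r * s_ d (c l.+1) ^ r * q_ d (c l) ^ r * kappa d r / (1 - q_ d (c l) ^ r).
Proof. by move=> r0; rewrite root_lastB; apply: (lastB_B lnq0 gen mu1). Qed.

Lemma lastB_rootL : root_of d A (a_ d l) (dr (L l)) (dr (Lambda0 d)).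
Proof. by rewrite root_lastB; apply: root_of_root; rewrite a_neq0. Qed.

Lemma lastB_root0 : root_of d A (a_ d l * s_ d (c l.+1)) (dr (Lambda0 d)) (dr (B l)).
Proof. exact: (root_of_lastB lnq0 gen lB l1 lastB_rootL). Qed.

Lemma lastB_pB : pref (dr (B l)) = (pref (dr (L l)))^-1.
Proof. by apply: etrans (pref_dB d u l) _; apply: (congr1 _ (esym (pref_dL d u l))). Qed.

Lemma scr_lastB_eq x y : c l = c l.+1 -> cycl (c l) x y ->
  well_defined d u l (s_ d (c l) ^+ 2 * s_ d y) (s_ d x) m ->
  SC A (s_ d x) (chg1 l (q_ d y)) = 0.
Proof.
move=> cl exy; rewrite /well_defined lastB_pref => wd.
apply: lastB_scr_comm; first exact: q_neq0.
apply: (typeB_eq lnq0 gen fk (T' := dr (Lambda d (change (chg1 l (q_ d y)) u) l))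
  (M' := dr (Lambda0 d)) (B' := dr (Lambdab d (change (chg1 l (q_ d y)) u) l)) (a_neq0 d l) lastB_rootL lastB_root0 erefl erefl erefl
  (pref_d0 d) (pref_d0 d) lastB_pB lastB_L_A lastB_0_A lastB_B_A n v cl exy
  (prefL_change (change1 _ _)) (prefB_change (change1 _ _))).
by apply: etrans (pref_dL d u l) wd.
Qed.

Lemma scr_lastB_plus x : all_colors (c l) (c l.+1) x ->
  well_defined d u l (orient R (c l) (c l.+1) * (s_ d (c l) ^+ 2 * s_ d (c l.+1))) (s_ d x) m ->
  SC A (s_ d x) (chg1 l (q_ d (c l.+1))) = 0.
Proof.
move=> efx; rewrite /well_defined lastB_pref => wd.
apply: lastB_scr_comm; first exact: q_neq0.
apply: (typeB_plus lnq0 gen fk (T' := dr (Lambda d (change (chg1 l (q_ d (c l.+1))) u) l))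
  (M' := dr (Lambda0 d)) (B' := dr (Lambdab d (change (chg1 l (q_ d (c l.+1))) u) l)) (a_neq0 d l) lastB_rootL lastB_root0 erefl erefl erefl
  (pref_d0 d) (pref_d0 d) lastB_pB lastB_L_A lastB_0_A lastB_B_A n v efx
  (prefL_change (change1 _ _)) (prefB_change (change1 _ _))).
by apply: etrans (pref_dL d u l) wd.
Qed.

Lemma scr_lastB_minus x : all_colors (c l) (c l.+1) x ->
  well_defined d u l (orient R (c l) (c l.+1) * (s_ d (c l) ^+ 2 * s_ d (c l.+1))) (sh d (c l.+1)) m ->
  SC A (sh d (c l.+1)) (chg1 l (q_ d x ^+ 2)) = 0.
Proof.
move=> efx; rewrite /well_defined lastB_pref => wd.
apply: lastB_scr_comm; first by rewrite expf_neq0 // q_neq0.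
apply: (typeB_minus lnq0 gen fk (T' := dr (Lambda d (change (chg1 l (q_ d x ^+ 2)) u) l))
  (M' := dr (Lambda0 d)) (B' := dr (Lambdab d (change (chg1 l (q_ d x ^+ 2)) u) l)) (a_neq0 d l) lastB_rootL lastB_root0 erefl erefl erefl
  (pref_d0 d) (pref_d0 d) lastB_pB lastB_L_A lastB_0_A lastB_B_A n v efx
  (prefL_change (change1 _ _)) (prefB_change (change1 _ _))).
by apply: etrans (pref_dL d u l) wd.
Qed.
End LastB.

Section LastC.
Hypothesis nC : ntype d = TypeC.

Lemma lastC : lastf d = FockCD.
Proof. by move: nC; rewrite /ntype; case: (lastf d). Qed.

Lemma root_lastC : A = vmul (L l) (vinv (B l)).
Proof. by rewrite /root_current gtn_eqF // ltnn nC. Qed.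

Let l2 : (2 <= l)%N := ell_neq1_C lnq0 gen mu1 l1 fk st nC.

Lemma lastC_scr_comm p x : x != 0 ->
  let w X := vcomm d h (scr_osc A p) (-1 - m) (dr (X u)) (dr (X (change (chg1 l x) u))) n v in
  w (Lambda d ^~ l) + w (Lambdab d ^~ l) = 0 -> SC A p (chg1 l x) = 0.
Proof.
move=> x0 w e.
have T10 : chg1 l x 1 != 0 by exact: chg1_neq0.
have Tj j : (1 <= j <= l)%N -> j != l -> chg1 l x j = 1.
  by move=> _ /negPf jl; rewrite /chg1 jl.
have AL j r : (1 <= j <= l)%N -> j != l -> r != 0 -> cc d A (dr (L j)) r = 0.
  by move=> jl jn r0; rewrite root_lastC; exact: (typeC_L_eq0 lnq0 gen mu1 u l1 (jl_lt jl jn) r0).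
have AB j r : (1 <= j <= l)%N -> j != l -> r != 0 -> cc d A (dr (B j)) r = 0.
  by move=> jl jn r0; rewrite root_lastC; exact: (typeC_B_eq0 lnq0 gen mu1 u l1 (jl_lt jl jn) r0).
have n1 : (1 != l)%N by rewrite ltn_eqF.
have A0b r : r != 0 -> cc d A (Lambda0b d u) r = 0.
  by move=> r0; apply: (cc_0b_eq0 lnq0 gen) r0 => t t0; [apply: AL|apply: AB].
apply: etrans (scr_comm_one lnq0 fk p m n v ll Tj AL AB) _.
have eb := D0b_eq0 lnq0 fk u10 T10 p m n v A0b.
by rewrite eb scaler0 addr0 nC addr0 -[X in _ *: X]/(w (Lambda d ^~ l) + w (Lambdab d ^~ l)) e scaler0.
Qed.

Lemma lastC_L_A r : r != 0 ->
  cc d A (dr (L l)) r = - kappa d r * (1 + q_ d (c l.+1) ^ r) / (1 - q_ d (c l) ^ r).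
Proof. by move=> r0; rewrite root_lastC; apply: (typeC_L lnq0 gen mu1 u lastC). Qed.

Lemma lastC_B_A r : r != 0 -> cc d A (dr (B l)) r =
  kappa d r * q_ d (c l) ^ r * (1 + (q_ d (c l.+1) ^ r)^-1) / (1 - q_ d (c l) ^ r).
Proof. by move=> r0; rewrite root_lastC; apply: (typeC_B lnq0 gen mu1 u lastC). Qed.

Lemma lastC_root : root_of d A 1 (dr (L l)) (dr (B l)).
Proof. rewrite root_lastC; exact: root_of_diff. Qed.

Lemma lastC_pref k : pref A = k -> pref (dr (L l)) = k * pref (dr (B l)).
Proof.
rewrite root_lastC => <-; apply: etrans (pref_dL d u l) _.
apply: etrans _ (congr1 _ (esym (pref_dB d u l))).
rewrite -[pref _]/(u l * (u l)^-1^-1) invrK.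
by have := u0 ll; move: (u l) => x x0; field.
Qed.

Lemma scr_lastC_plus x : all_colors (c l) (c l.+1) x ->
  well_defined d u l (q_ d (c l) * (q_ d (c l.+1))^-1) (s_ d x) m ->
  SC A (s_ d x) (chg1 l (q_ d (c l.+1) ^+ 2)) = 0.
Proof.
move=> efx wd; apply: lastC_scr_comm; first by rewrite expf_neq0 // q_neq0.
exact: (typeC_plus lnq0 gen fk (X' := dr (Lambda d (change (chg1 l (q_ d (c l.+1) ^+ 2)) u) l))
  (Y' := dr (Lambdab d (change (chg1 l (q_ d (c l.+1) ^+ 2)) u) l)) efx lastC_root erefl erefl lastC_L_A lastC_B_A n v
  (prefL_change (change1 _ _)) (prefB_change (change1 _ _)) (lastC_pref wd)).
Qed.

Lemma scr_lastC_minus x : all_colors (c l) (c l.+1) x ->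
  well_defined d u l (q_ d (c l) * (q_ d (c l.+1))^-1) (s_ d (c l.+1) ^+ 2) m ->
  SC A (s_ d (c l.+1) ^+ 2) (chg1 l (q_ d x)) = 0.
Proof.
move=> efx wd; apply: lastC_scr_comm; first exact: q_neq0.
exact: (typeC_minus lnq0 gen fk (X' := dr (Lambda d (change (chg1 l (q_ d x)) u) l))
  (Y' := dr (Lambdab d (change (chg1 l (q_ d x)) u) l)) efx lastC_root erefl erefl lastC_L_A lastC_B_A n v
  (prefL_change (change1 _ _)) (prefB_change (change1 _ _)) (lastC_pref wd)).
Qed.
End LastC.

Section LastD.
Hypotheses (nD : ntype d = TypeD) (l2 : (2 <= l)%N).
Local Notation k := l.-1.

Lemma lastD : lastf d = FockCD.
Proof. by move: nD; rewrite /ntype; case: (lastf d). Qed.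

Lemma lastD_cl : c l = c l.+1.
Proof. by move: nD; rewrite /ntype; case: (lastf d) => //; case: eqP. Qed.

Lemma root_lastD : A = vmul (L k) (vinv (B l)).
Proof. by rewrite /root_current gtn_eqF // ltnn nD. Qed.

Let l3 : (3 <= l)%N := ell_neq2_D lnq0 gen mu1 l1 fk st nD l2.
Let kl : (1 <= k <= l)%N. Proof. by case: (ell d) l2 => [|[|i]] //= _; rewrite leqnSn. Qed.

Lemma lastD_scr_comm p x y : x != 0 -> y != 0 ->
  let w X := vcomm d h (scr_osc A p) (-1 - m) (dr (X u)) (dr (X (change (chg2 k x l y) u))) n v in
  b_ d (c k) *: w (Lambda d ^~ k) + b_ d (c l) *: w (Lambdab d ^~ l) = 0 ->
  b_ d (c l) *: w (Lambda d ^~ l) + b_ d (c k) *: w (Lambdab d ^~ k) = 0 ->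
  SC A p (chg2 k x l y) = 0.
Proof.
move=> x0 y0 w e1 e2.
have T10 : chg2 k x l y 1 != 0 by exact: chg2_neq0.
have Tj j : j != k -> j != l -> chg2 k x l y j = 1.
  by move=> /negPf jk /negPf jl; rewrite /chg2 jk jl.
have ltk j : (1 <= j <= l)%N -> j != k -> j != l -> (1 <= j < k)%N.
  by move=> /andP[-> jl] jk jn; rewrite ltn_neqAle jk -ltnS prednK // ltn_neqAle jn.
have AL j r : (1 <= j <= l)%N -> j != k -> j != l -> r != 0 -> cc d A (dr (L j)) r = 0.
  move=> jl jk jn r0; rewrite root_lastD.
  by exact: (typeD_L_eq0 lnq0 gen mu1 u l1 l2 (ltk j jl jk jn) r0).
have AB j r : (1 <= j <= l)%N -> j != k -> j != l -> r != 0 -> cc d A (dr (B j)) r = 0.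
  move=> jl jk jn r0; rewrite root_lastD.
  by exact: (typeD_B_eq0 lnq0 gen mu1 u l1 l2 (ltk j jl jk jn) r0).
have n1 : (1 != l)%N by rewrite ltn_eqF.
(* Type D touches the factors [l - 1] and [l]; the bound [l >= 3] given by stability keeps both away
   from the first. *)
have nk : (1 != k)%N by rewrite ltn_eqF // -ltnS prednK.
have A0b r : r != 0 -> cc d A (Lambda0b d u) r = 0.
  by move=> r0; apply: (cc_0b_eq0 lnq0 gen) r0 => t t0; [apply: AL|apply: AB].
have kn : k != l by rewrite ltn_eqF // prednK.
have A0 : lastf d = FockB -> forall r, r != 0 -> cc d A (dr (Lambda0 d)) r = 0 by rewrite lastD.
apply: etrans (scr_comm_two lnq0 fk u10 T10 p m n v kl ll kn Tj AL AB A0 A0b) _.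
have := scaler_regroup e1 e2.
by rewrite [X in _ + _ *: X]addrC.
Qed.

Section Change2.
Variables x y : R[i].
Local Notation ch := (change (chg2 k x l y) u).
Let nkl : (l == k) = false. Proof. by rewrite gtn_eqF // prednK. Qed.

Lemma change2_k : ch k = x * u k. Proof. by rewrite /change /chg2 eqxx. Qed.
Lemma change2_l : ch l = y * u l. Proof. by rewrite /change /chg2 nkl eqxx. Qed.

End Change2.

Lemma lastD_pref z : pref A = z ->
  pref (dr (L k)) = z * pref (dr (B l)) /\ pref (dr (L l)) = z * pref (dr (B k)).
Proof.
have ul0 := u0 ll; have uk0 := u0 kl.
rewrite root_lastD -[pref _]/(u k * (u l)^-1^-1) invrK => <-; split.
  apply: etrans (pref_dL d u k) _; apply: etrans _ (congr1 _ (esym (pref_dB d u l))).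
  by rewrite mulfK.
apply: etrans (pref_dL d u l) _; apply: etrans _ (congr1 _ (esym (pref_dB d u k))).
by rewrite mulrC mulKf.
Qed.

Lemma lastD_root1 : root_of d A 1 (dr (L k)) (dr (B l)).
Proof. by rewrite root_lastD; apply: root_of_diff. Qed.

Lemma lastD_root2 : root_of d A 1 (dr (L l)) (dr (B k)).
Proof. exact: (root_of_typeD lnq0 gen lastD lastD_cl l2 lastD_root1). Qed.

Lemma lastD_Lk r : r != 0 -> cc d A (dr (L k)) r = - 1 ^ r * kappa d r / (1 - q_ d (c k) ^ r).
Proof. by move=> r0; rewrite root_lastD; apply: (typeD_Lp lnq0 gen mu1 u l1 l2). Qed.

Lemma lastD_Ll r : r != 0 -> cc d A (dr (L l)) r = - 1 ^ r * kappa d r / (1 - q_ d (c l) ^ r).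
Proof. by move=> r0; rewrite root_lastD; apply: (typeD_L lnq0 gen mu1 u lastD l1 lastD_cl l2). Qed.

Lemma lastD_Bl r : r != 0 -> cc d A (dr (B l)) r = 1 ^ r * q_ d (c l) ^ r * kappa d r / (1 - q_ d (c l) ^ r).
Proof. by move=> r0; rewrite root_lastD; apply: (typeD_B lnq0 gen mu1 u l1 l2). Qed.

Lemma lastD_Bk r : r != 0 -> cc d A (dr (B k)) r = 1 ^ r * q_ d (c k) ^ r * kappa d r / (1 - q_ d (c k) ^ r).
Proof. by move=> r0; rewrite root_lastD; apply: (typeD_Bp lnq0 gen mu1 u lastD l1 lastD_cl l2). Qed.

Lemma scr_lastD_bose x y : c k = c l -> all_colors (c l) x y ->
  well_defined d u l (q_ d (c l)) (s_ d x) m ->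
  SC A (s_ d x) (chg2 k (q_ d y) l (q_ d y)) = 0.
Proof.
move=> ckl exy wd; have [p1 p2] := lastD_pref wd.
have kxy : all_colors (c k) x y by rewrite ckl.
have q0 := q_neq0 d y; have o0 := oner_neq0 R[i].
apply: lastD_scr_comm => //; rewrite ckl -scalerDr.
  have e1 := pair_bose lnq0 gen fk (X' := dr (Lambda d (change (chg2 k (q_ d y) l (q_ d y)) u) k))
    (Y' := dr (Lambdab d (change (chg2 k (q_ d y) l (q_ d y)) u) l)) o0 lastD_root1 erefl erefl
    lastD_Lk lastD_Bl n v ckl kxy (prefL_change (change2_k _ _)) (prefB_change (change2_l _ _)).
  apply: etrans (congr1 _ (e1 _ _)) (scaler0 _ _).
  by rewrite ckl; exact: p1.
have e2 := pair_bose lnq0 gen fk (X' := dr (Lambda d (change (chg2 k (q_ d y) l (q_ d y)) u) l))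
  (Y' := dr (Lambdab d (change (chg2 k (q_ d y) l (q_ d y)) u) k)) o0 lastD_root2 erefl erefl
  lastD_Ll lastD_Bk n v (esym ckl) exy (prefL_change (change2_l _ _)) (prefB_change (change2_k _ _)) p2.
exact: etrans (congr1 _ e2) (scaler0 _ _).
Qed.

Lemma scr_lastD_fermi x : all_colors (c k) (c l) x ->
  well_defined d u l (s_ d x)^-1 (s_ d x) m ->
  SC A (s_ d x) (chg2 k (q_ d (c l)) l (q_ d (c k))) = 0.
Proof.
move=> efx wd; have [p1 p2] := lastD_pref wd.
have fex := all_colorsC efx.
(* The constant [k = s_x^(-1)] of this screening is the constant [s_e s_f] of a fermionic pair,
   since the three [s] multiply to 1. *)
have sx : (s_ d x)^-1 = s_ d (c k) * s_ d (c l).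
  have := sh_colors lnq0 efx; have := sh_neq0 d x; rewrite !s_sh -!exprVn -exprMn.
  move: (sh d _) (sh d _) (sh d x) => a b e e0 abe; congr (_ ^+ _).
  by apply: (mulIf e0); rewrite mulVf // abe.
have o0 := oner_neq0 R[i].
apply: lastD_scr_comm; rewrite ?q_neq0 //.
  apply: (pair_fermi lnq0 gen fk (X' := dr (Lambda d (change (chg2 k (q_ d (c l)) l (q_ d (c k))) u) k))
    (Y' := dr (Lambdab d (change (chg2 k (q_ d (c l)) l (q_ d (c k))) u) l)) o0 lastD_root1 erefl erefl
    lastD_Lk lastD_Bl n v efx (prefL_change (change2_k _ _)) (prefB_change (change2_l _ _))).
  by rewrite -sx; exact: p1.
apply: (pair_fermi lnq0 gen fk (X' := dr (Lambda d (change (chg2 k (q_ d (c l)) l (q_ d (c k))) u) l))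
  (Y' := dr (Lambdab d (change (chg2 k (q_ d (c l)) l (q_ d (c k))) u) k)) o0 lastD_root2 erefl erefl
  lastD_Ll lastD_Bk n v fex (prefL_change (change2_l _ _)) (prefB_change (change2_k _ _))).
by rewrite [s_ d (c l) * _]mulrC -sx; exact: p2.
Qed.
End LastD.
End Nodes.

(** Here [x], [y], [z], [t] stand for the commutators with [Lambda_1(z)], [Lambda_bar(1)(z)], the
    weighted extra term and [Lambda_1(mu z)]. The chain relation replaces [b y + z] by [- b t]. *)
Lemma scaler_chain (K : pzRingType) (V : lmodType K) (b : K) (x y z t : V) :
  b *: y + z + b *: t = 0 -> b *: (x + y) + 0 + z = b *: (x - t).
Proof. by move/eqP; rewrite addr_eq0 addr0 scalerDr scalerBr -addrA => /eqP->. Qed.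

(** * The zeroth node *)

Section Zero.
Variables (R : realType) (d : datum R).
Hypothesis lnq0 : \sum_(x < 3) lnq d x = 0.
Hypothesis gen : generic d.
Hypothesis mu1 : `|mu d| < 1.
Hypothesis l1 : (1 <= ell d)%N.
Local Notation c := (colr d).
Local Notation l := (ell d).
Local Notation dr := (dress d).
Variables (V : lmodType R[i]) (h : nat -> int -> V -> V) (vac : V).
Hypothesis fk : is_fock d h vac.
Variable u : nat -> R[i].
Hypothesis u0 : forall j : nat, (1 <= j <= l)%N -> u j != 0.
Local Notation L i := (Lambda d u i).
Local Notation B i := (Lambdab d u i).
Variables (m n : int) (v : V).
Local Notation A := (root_current d u 0).
Local Notation SC p T := (scr_comm d h (scr_op d h A p m) T u).
Let i1 : (1 <= 1 <= l)%N. Proof. by rewrite l1. Qed.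
Let u10 := u0 i1.

Lemma scr_comm_Lambda1 p T (w := vcomm d h (scr_osc A p) (-1 - m)) :
  SC p T (Lambda1_diff d) n v =
  w (dr (L 1)) (dr (Lambda d (change T u) 1)) n v -
  w (vscale (mu d) (dr (L 1))) (vscale (mu d) (dr (Lambda d (change T u) 1))) n v.
Proof.
apply: etrans (scr_comm_cons fk u T (scr_osc A p) (-1 - m) n v 1 (fun w => dr (Lambda d w 1))
  (fun w => [:: (-1, vscale (mu d) (dr (Lambda d w 1)))])) _.
rewrite scale1r; congr (_ + _).
apply: etrans (scr_comm_cons fk u T (scr_osc A p) (-1 - m) n v (-1)
  (fun w => vscale (mu d) (dr (Lambda d w 1))) (fun _ => [::])) _.
by rewrite (scr_comm_nil fk) addr0 scaleN1r.
Qed.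

(** The hypothesis is the cancellation of a complete type B chain. The term [Lambda_1(mu z)] ending
    that chain is absent from the current, while [Lambda_1(z)] is present in it, and this mismatch
    is the right-hand side. *)
Lemma scr_comm_zero p x : x != 0 -> let T := chg1 1 x in
  let w X := vcomm d h (scr_osc A p) (-1 - m) (X u) (X (change T u)) n v in
  b_ d (c 1) *: w (fun t => dr (Lambdab d t 1)) + kB d (c 0) *: w (Lambda0b d)
    + b_ d (c 1) *: w (fun t => vscale (mu d) (dr (Lambda d t 1))) = 0 ->
  SC p T (Etilde d) n v = b_ d (c 1) *: SC p T (Lambda1_diff d) n v.
Proof.
move=> x0 T w e.
have T10 : T 1%N != 0 by exact: chg1_neq0.
have Tj j : (1 <= j <= l)%N -> j != 1%N -> T j = 1.
  by move=> _ /negPf jl; rewrite /T /chg1 jl.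
have jl2 j : (1 <= j <= l)%N -> j != 1%N -> (2 <= j <= l)%N.
  by move=> /andP[j1 ->] jn; rewrite andbT ltn_neqAle eq_sym jn.
have AL j r : (1 <= j <= l)%N -> j != 1%N -> r != 0 -> cc d A (dr (L j)) r = 0.
  by move=> jl jn r0; apply: (node0_L_eq0 lnq0 gen mu1 l1 u (jl2 j jl jn) r0).
have AB j r : (1 <= j <= l)%N -> j != 1%N -> r != 0 -> cc d A (dr (B j)) r = 0.
  by move=> jl jn r0; apply: (node0_B_eq0 lnq0 gen mu1 l1 u (jl2 j jl jn) r0).
apply: etrans (scr_comm_one lnq0 fk p m n v i1 Tj AL AB) _.
have -> : (if ntype d is TypeB then kB d (c l.+1) *: vcomm d h (scr_osc A p) (-1 - m)
    (dr (Lambda0 d)) (dr (Lambda0 d)) n v else 0) = 0.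
  rewrite /ntype; case lB: (lastf d); last by case: ifP.
  rewrite (D0_eq0 lnq0 fk) ?scaler0 // => r r0.
  exact: (node0_0_eq0 lnq0 gen mu1 l1 u lB r0).
rewrite scr_comm_Lambda1; exact: scaler_chain.
Qed.

Lemma zero_pB : pref (vscale (mu d) (dr (L 1))) = (pref (dr (B 1)))^-1.
Proof.
apply: etrans (pref_dL d u 1) _; apply: etrans _ (congr1 _ (esym (pref_dB d u 1))).
by rewrite invrK.
Qed.

Lemma pref_A0 : pref A = pref (dr (B 1)).
Proof. by apply: etrans _ (esym (pref_dB d u 1)). Qed.

Section Change.
Variable x : R[i].
Local Notation ch := (change (chg1 1 x^-1) u).

Lemma change0_B : pref (dr (Lambdab d ch 1)) = x * pref (dr (B 1)).
Proof. by rewrite -{2}[x]invrK; apply: prefB_change; apply: change1. Qed.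

Lemma change0_L : pref (vscale (mu d) (dr (Lambda d ch 1))) = x^-1 * pref (vscale (mu d) (dr (L 1))).
Proof. by apply: prefL_change; apply: change1. Qed.

Lemma change0_0 : x != 0 -> pref (Lambda0b d ch) = 1.
Proof.
move=> x0; apply: pref_0b; rewrite (change1 u 1 x^-1).
by rewrite mulf_neq0 ?invr_neq0.
Qed.
End Change.

Lemma scr_zero_eq x y : c 0 = c 1%N -> cycl (c 1%N) x y ->
  well_defined d u 0 (s_ d (c 1) ^+ 2 * s_ d y) (s_ d x) m ->
  SC (s_ d x) (chg1 1 (q_ d y)^-1) (Etilde d) n v =
  b_ d (c 1) *: SC (s_ d x) (chg1 1 (q_ d y)^-1) (Lambda1_diff d) n v.
Proof.
move=> c01 exy; rewrite /well_defined pref_A0 => wd.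
have q0 := q_neq0 d y.
apply: scr_comm_zero; first by rewrite invr_neq0.
exact: (typeB_eq lnq0 gen fk (T' := dr (Lambdab d (change (chg1 1 (q_ d y)^-1) u) 1))
  (M' := Lambda0b d (change (chg1 1 (q_ d y)^-1) u))
  (B' := vscale (mu d) (dr (Lambda d (change (chg1 1 (q_ d y)^-1) u) 1)))
  (al0_neq0 d) (root_of_B1 u) (root_of_L1mu lnq0 gen u) erefl erefl erefl
  (pref_0b d u10) (change0_0 q0) zero_pB
  (node0_B lnq0 gen mu1 l1 u) (node0_0b lnq0 gen mu1 l1 u) (node0_Lmu lnq0 gen mu1 l1 u)
  n v (esym c01) exy (change0_B _) (change0_L _) wd).
Qed.

Lemma scr_zero_plus x : all_colors (c 0) (c 1%N) x ->
  well_defined d u 0 (orient R (c 1) (c 0) * (s_ d (c 1) ^+ 2 * s_ d (c 0))) (s_ d x) m ->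
  SC (s_ d x) (chg1 1 (q_ d (c 0))^-1) (Etilde d) n v =
  b_ d (c 1) *: SC (s_ d x) (chg1 1 (q_ d (c 0))^-1) (Lambda1_diff d) n v.
Proof.
move=> /all_colorsC efx; rewrite /well_defined pref_A0 => wd.
have q0 := q_neq0 d (c 0).
apply: scr_comm_zero; first by rewrite invr_neq0.
exact: (typeB_plus lnq0 gen fk (T' := dr (Lambdab d (change (chg1 1 (q_ d (c 0))^-1) u) 1))
  (M' := Lambda0b d (change (chg1 1 (q_ d (c 0))^-1) u))
  (B' := vscale (mu d) (dr (Lambda d (change (chg1 1 (q_ d (c 0))^-1) u) 1)))
  (al0_neq0 d) (root_of_B1 u) (root_of_L1mu lnq0 gen u) erefl erefl erefl
  (pref_0b d u10) (change0_0 q0) zero_pB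
  (node0_B lnq0 gen mu1 l1 u) (node0_0b lnq0 gen mu1 l1 u) (node0_Lmu lnq0 gen mu1 l1 u)
  n v efx (change0_B _) (change0_L _) wd).
Qed.

Lemma scr_zero_minus x : all_colors (c 0) (c 1%N) x ->
  well_defined d u 0 (orient R (c 1) (c 0) * (s_ d (c 1) ^+ 2 * s_ d (c 0))) (sh d (c 0)) m ->
  SC (sh d (c 0)) (chg1 1 (q_ d x ^+ 2)^-1) (Etilde d) n v =
  b_ d (c 1) *: SC (sh d (c 0)) (chg1 1 (q_ d x ^+ 2)^-1) (Lambda1_diff d) n v.
Proof.
move=> /all_colorsC efx; rewrite /well_defined pref_A0 => wd.
have q0 : q_ d x ^+ 2 != 0 by rewrite expf_neq0 // q_neq0.
apply: scr_comm_zero; first by rewrite invr_neq0.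
exact: (typeB_minus lnq0 gen fk (T' := dr (Lambdab d (change (chg1 1 (q_ d x ^+ 2)^-1) u) 1))
  (M' := Lambda0b d (change (chg1 1 (q_ d x ^+ 2)^-1) u))
  (B' := vscale (mu d) (dr (Lambda d (change (chg1 1 (q_ d x ^+ 2)^-1) u) 1)))
  (al0_neq0 d) (root_of_B1 u) (root_of_L1mu lnq0 gen u) erefl erefl erefl
  (pref_0b d u10) (change0_0 q0) zero_pB
  (node0_B lnq0 gen mu1 l1 u) (node0_0b lnq0 gen mu1 l1 u) (node0_Lmu lnq0 gen mu1 l1 u)
  n v efx (change0_B _) (change0_L _) wd).
Qed.
End Zero.


(** * Assembly over all screening operators *)

Lemma lastB_ntype (R : realType) (d : datum R) : ntype d = TypeB -> lastf d = FockB.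
Proof. by rewrite /ntype; case: (lastf d) => //; case: ifP. Qed.

Theorem theorem4p8 (R : realType) (d : datum R) (u : nat -> R[i])
    (V : lmodType R[i]) (h : nat -> int -> V -> V) (vac : V)
    (lnq_sum : \sum_(x < 3) lnq d x = 0)
    (q_generic : generic d)
    (ell_ge1 : (1 <= ell d)%N)
    (typeD_ell : ntype d = TypeD -> (2 <= ell d)%N)
    (mu_lt1 : `|mu d| < 1)
    (u_neq0 : forall j : nat, (1 <= j <= ell d)%N -> u j != 0)
    (fockV : is_fock d h vac)
    (B_stable : stable d h u) :
  (forall (i : nat) (k p : R[i]) (T : nat -> R[i]) (m : int),
     (1 <= i <= ell d)%N -> screening d i k p T -> well_defined d u i k p m ->
     forall (n : int) (v : V),
       scr_comm d h (scr_op d h (root_current d u i) p m) T u (Etilde d) n v = 0)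
  /\
  (forall (k p : R[i]) (T : nat -> R[i]) (m : int),
     screening d 0 k p T -> well_defined d u 0 k p m ->
     forall (n : int) (v : V),
       scr_comm d h (scr_op d h (root_current d u 0) p m) T u (Etilde d) n v =
       b_ d (colr d 1) *:
         scr_comm d h (scr_op d h (root_current d u 0) p m) T u (Lambda1_diff d) n v).
Proof.
have cyc x y z : cycl x y z -> all_colors x z y.
  move/cycl_colors; rewrite /all_colors /= !inE !negb_or !andbT => /andP[/andP[xy xz] yz].
  by rewrite xz xy eq_sym yz.
split=> [i k p T m il scr wd n v|]; last first.
  (* The node is generalised to a variable [i] with [i = 0] as a hypothesis, so that case analysis
     on [screening] applies; the cases of middle and last nodes then contradict [i = 0]. *)
  suff H i k p T m : screening d i k p T -> i = 0%N -> well_defined d u 0 k p m -> forall n v,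
      scr_comm d h (scr_op d h (root_current d u 0) p m) T u (Etilde d) n v =
      b_ d (colr d 1) *:
        scr_comm d h (scr_op d h (root_current d u 0) p m) T u (Lambda1_diff d) n v.
    by move=> k p T m scr; apply: H scr erefl.
  have l0 : ell d <> 0%N by move: ell_ge1; case: (ell d).
  case=> {i k p T}.
  - by move=> i x y /andP[+ _] _ _ i0; rewrite i0.
  - by move=> i x y /andP[+ _] _ _ i0; rewrite i0.
  - by move=> i x /andP[+ _] _ i0; rewrite i0.
  - by move=> x y _ _ _ /l0.
  - by move=> x _ _ /l0.
  - by move=> x _ _ /l0.
  - by move=> x _ _ /l0.
  - by move=> x _ _ /l0.
  - by move=> x y _ _ _ /l0.
  - by move=> x y _ _ _ /l0.
  - by move=> x _ _ /l0.
  - move=> x y c01 cy _ wd n v.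
    exact: (scr_zero_eq lnq_sum q_generic mu_lt1 ell_ge1 fockV u_neq0 n v c01 cy wd).
  - move=> x efx _ wd n v.
    exact: (scr_zero_plus lnq_sum q_generic mu_lt1 ell_ge1 fockV u_neq0 n v efx wd).
  - move=> x efx _ wd n v.
    exact: (scr_zero_minus lnq_sum q_generic mu_lt1 ell_ge1 fockV u_neq0 n v efx wd).
case: scr il wd => {i k p T}.
  - move=> i x y il cii cy _ wd.
    exact: (mid_bose lnq_sum q_generic mu_lt1 ell_ge1 fockV u_neq0 n v il cii (cycl_colors cy) wd).
  - move=> i x y il cii cy _ wd.
    exact: (mid_bose lnq_sum q_generic mu_lt1 ell_ge1 fockV u_neq0 n v il cii (cyc _ _ _ cy) wd).
  - move=> i x il efx _ wd.
    exact: (mid_fermi lnq_sum q_generic mu_lt1 ell_ge1 fockV u_neq0 n v il efx wd).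
  - move=> x y nB cl cy _ wd.
    exact: (scr_lastB_eq lnq_sum q_generic mu_lt1 ell_ge1 fockV u_neq0 B_stable n v (lastB_ntype nB) cl cy wd).
  - move=> x nB efx _ wd.
    exact: (scr_lastB_plus lnq_sum q_generic mu_lt1 ell_ge1 fockV u_neq0 B_stable n v (lastB_ntype nB) efx wd).
  - move=> x nB efx _ wd.
    exact: (scr_lastB_minus lnq_sum q_generic mu_lt1 ell_ge1 fockV u_neq0 B_stable n v (lastB_ntype nB) efx wd).
  - move=> x nC efx _ wd.
    exact: (scr_lastC_plus lnq_sum q_generic mu_lt1 ell_ge1 fockV u_neq0 B_stable n v nC efx wd).
  - move=> x nC efx _ wd.
    exact: (scr_lastC_minus lnq_sum q_generic mu_lt1 ell_ge1 fockV u_neq0 B_stable n v nC efx wd).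
  - move=> x y nD cl cy _ wd.
    exact: (scr_lastD_bose lnq_sum q_generic mu_lt1 ell_ge1 fockV u_neq0 B_stable n v nD (typeD_ell nD) cl (cycl_colors cy) wd).
  - move=> x y nD cl cy _ wd.
    exact: (scr_lastD_bose lnq_sum q_generic mu_lt1 ell_ge1 fockV u_neq0 B_stable n v nD (typeD_ell nD) cl (cyc _ _ _ cy) wd).
  - move=> x nD efx _ wd.
    exact: (scr_lastD_fermi lnq_sum q_generic mu_lt1 ell_ge1 fockV u_neq0 B_stable n v nD (typeD_ell nD) efx wd).
  - by [].
  - by [].
  - by [].
Qed.
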